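(* Let $\theta\in\mathcal S(\mathcal U,\mathcal Y)$ be co-inner, and let $\Sigma=(A,B,C,D;\mathcal X,\mathcal U,\mathcal Y)$ be a minimal realization of $\theta$. Then $\mathrm{RI}_\Sigma^\circ$ consists of a single element, $H_\bullet$ say, and $\delta_{\Sigma^*}(H_\bullet^{-1})=0$, where $\Sigma^*$ is the adjoint system of $\Sigma$.
   Context: A system $\Sigma=(A,B,C,D;\mathcal X,\mathcal U,\mathcal Y)$ is the discrete time-invariant linear system $x_{n+1}=Ax_n+Bu_n$, $y_n=Cx_n+Du_n$ $(n\ge 0)$, where $A:\mathcal X\to\mathcal X$, $B:\mathcal U\to\mathcal X$, $C:\mathcal X\to\mathcal Y$, $D:\mathcal U\to\mathcal Y$ are bounded linear operators between separable (complex) Hilbert spaces. Its transfer function is $\theta_\Sigma(\lambda)=D+\lambda C(I-\lambda A)^{-1}B$, defined for those $\lambda\in\mathbb C$ for which $I-\lambda A$ is boundedly invertible. Put $\operatorname{Im}(A|B)=\operatorname{span}\{\operatorname{Im}A^nB\mid n\ge 0\}$ (linear span, not closed), $\operatorname{Im}(A^*|C^* )=\operatorname{span}\{\operatorname{Im}(A^* )^nC^*\mid n\ge0\}$ and $\operatorname{Ker}(C|A)=\bigcap_{n\ge0}\operatorname{Ker}CA^n$. $\Sigma$ is minimal if $\operatorname{Im}(A|B)$ is dense in $\mathcal X$ and $\operatorname{Ker}(C|A)=\{0\}$. The adjoint system is $\Sigma^*=(A^*,C^*,B^*,D^*;\mathcal X,\mathcal Y,\mathcal U)$. The Schur class $\mathcal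 S(\mathcal U,\mathcal Y)$ consists of the functions $\theta$ analytic on the open unit disc $\mathbb D$ with values bounded operators $\mathcal U\to\mathcal Y$ with $\|\theta(z)\|\le1$ for all $z\in\mathbb D$. $\theta$ is co-inner if its boundary values satisfy $\theta(\zeta)\theta(\zeta)^*=I_{\mathcal Y}$ for almost every $\zeta$ in the unit circle $\mathbb T$. $\Sigma$ is a realization of $\theta$ if $\theta_\Sigma$ coincides with $\theta$ in a neighborhood of zero. For a bounded selfadjoint operator $T$ on a Hilbert space $\mathcal H$, put $\mathcal H_1=\overline{T\mathcal H}$, $\mathcal H_2=\operatorname{Ker}T=\mathcal H\ominus\mathcal H_1$, $T_1=T|_{\mathcal H_1}$ (injective on $\mathcal H_1$). The Moore--Penrose pseudo-inverse $T^{[-1]}$ is the (possibly unbounded) selfadjoint operator with domain $\operatorname{Im}T_1\oplus\mathcal H_2$ acting as $T_1^{-1}$ on $\operatorname{Im}T_1$ and as $0$ on $\mathcal H_2$. $\mathcal D(\cdot)$ denotes the domain of an operator. $\mathrm{RI}_\Sigma$ is the set of all (possibly unbounded) selfadjoint operators $H$ in $\mathcal X$ such that: (1) $\langle Hx,x\rangle>0$ for each $0\ne x\in\mathcal D(H)$; (2) $A\mathcal D(H^{1/2})\subset\mathcal D(H^{1/2})$ and $B\mathcal U\subset\mathcal D(H^{1/2})$ (so $H^{1/2}B:\mathcal U\to\mathcal X$ is bounded); (3) the operator $\delta_\Sigma(H)=I_{\mathcal U}-D^*D-(H^{1/2}B)^*H^{1/2}B$ is bounded and nonnegative, and $\big(D^*C+(H^{1/2}B)^*H^{1/2}A\big)\mathcal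 D(H^{1/2})\subset\delta_\Sigma(H)^{1/2}\mathcal U$; (4) for each $x\in\mathcal D(H^{1/2})$, $$\|H^{1/2}x\|^2-\|H^{1/2}Ax\|^2-\|Cx\|^2\ \ge\ \big\|\big(\delta_\Sigma(H)^{1/2}\big)^{[-1]}\big(D^*C+(H^{1/2}B)^*H^{1/2}A\big)x\big\|^2 .$$ For $H\in\mathrm{RI}_\Sigma$ one has $\operatorname{Im}(A|B)\subset\mathcal D(H^{1/2})$ and $\operatorname{Im}(A^*|C^* )\subset\mathcal D(H^{-1/2})$. $\mathrm{RI}_\Sigma^\circ$ is the set of all $H\in\mathrm{RI}_\Sigma$ such that (a) both $H^{1/2}\operatorname{Im}(A|B)$ and $H^{-1/2}\operatorname{Im}(A^*|C^* )$ are dense in $\mathcal X$, and (b) $\operatorname{Im}(A|B)$ is a core for $H^{1/2}$, i.e. $\{(u,H^{1/2}u)\mid u\in\operatorname{Im}(A|B)\}$ is dense in the graph of $H^{1/2}$ with respect to the graph norm. Applying the definition of $\delta$ to the adjoint system, $\delta_{\Sigma^*}(K)=I_{\mathcal Y}-DD^*-(K^{1/2}C^* )^*K^{1/2}C^*$; thus $\delta_{\Sigma^*}(H^{-1})=I_{\mathcal Y}-DD^*-(H^{-1/2}C^* )^*H^{-1/2}C^*$. *)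

(* Defs.v *)
(* The scalars are the complex numbers R[i], for an arbitrary R : realType. *)
From HB Require Import structures.
From mathcomp Require Import all_boot all_order all_algebra.
From mathcomp Require Import complex.
From mathcomp Require Import all_classical all_reals all_analysis.

Set Implicit Arguments.
Unset Strict Implicit.
Unset Printing Implicit Defensive.

Import Order.TTheory GRing.Theory Num.Theory.
Import numFieldNormedType.Exports.

Local Open Scope classical_set_scope.
Local Open Scope ring_scope.

(* Complex Hilbert spaces.  Elements of {dot X for Num.conj} are linear in
   their first argument and conjugate-linear in the second one; being an
   element of the numClosedFieldType R[i], the norm `|x| is a nonnegative real
   complex number. *)
HB.mixin Record CompleteNormedModule_isHilbert (R : realType) X
    of CompleteNormedModule R[i] X := {
  inner : {dot X for (@Num.conj R[i])} ;
  sqr_normE : forall x : X, `|x| ^+ 2 = inner x x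
}.

#[short(type="hilbertType")]
HB.structure Definition Hilbert (R : realType) :=
  { X of CompleteNormedModule_isHilbert R X & CompleteNormedModule R[i] X }.

Definition separable (R : realType) (X : hilbertType R) : Prop :=
  exists2 S : set X, countable S & dense S.

Section Operators.
Variable R : realType.
Implicit Types X Y Z : hilbertType R.

(* Everywhere defined bounded operators are functions. *)
Definition bounded_op X Y (f : X -> Y) : Prop :=
  linear f /\ exists M : R, forall x, `|f x| <= M%:C%C * `|x|.

(* Possibly unbounded, partially defined operators are identified with their
   graphs: (x, y) \in G means that x is in the domain of G and G x = y.  Hence
   equality of operators includes equality of their domains. *)
Definition is_operator X Y (G : set (X * Y)) : Prop :=
  [/\ G (0, 0),
      forall (a : R[i]) p q, G p -> G q -> G (a *: p.1 + q.1, a *: p.2 + q.2)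
    & forall x y y', G (x, y) -> G (x, y') -> y = y'].

Definition dom X Y (G : set (X * Y)) : set X := [set x | exists y, G (x, y)].

Definition ran X Y (G : set (X * Y)) : set Y := [set y | exists x, G (x, y)].

Definition ker X Y (G : set (X * Y)) : set X := [set x | G (x, 0)].

(* The value of G at x; the default value 0 is only used outside dom G. *)
Definition app X Y (G : set (X * Y)) (x : X) : Y := xget 0 [set y | G (x, y)].

Definition graph X Y (f : X -> Y) : set (X * Y) := [set p | p.2 = f p.1].

Definition op_image X Y (G : set (X * Y)) (V : set X) : set Y :=
  [set y | exists2 x, V x & G (x, y)].

Definition op_comp X Y Z (G : set (Y * Z)) (F : set (X * Y)) : set (X * Z) :=
  [set p | exists2 y, F (p.1, y) & G (y, p.2)].

Definition op_inv X Y (G : set (X * Y)) : set (Y * X) :=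
  [set p | G (p.2, p.1)].

(* y is in the domain of the adjoint, with image z, when
   <G x, y> = <x, z> for all x in dom G. *)
Definition op_adj X Y (G : set (X * Y)) : set (Y * X) :=
  [set q | forall p, G p -> inner p.2 q.1 = inner p.1 q.2].

(* The adjoint of an everywhere defined bounded operator. *)
Definition adj X Y (f : X -> Y) : Y -> X := app (op_adj (graph f)).

Definition selfadjoint X (H : set (X * X)) : Prop :=
  [/\ is_operator H, dense (dom H) & op_adj H = H].

Definition nonneg_op X (H : set (X * X)) : Prop :=
  forall x y, H (x, y) -> 0 <= inner y x.

Definition positive_op X (H : set (X * X)) : Prop :=
  forall x y, H (x, y) -> x != 0 -> 0 < inner y x.

(* H^{1/2}: the nonnegative selfadjoint S with S S = H (domains included).
   When there is no such S the default value is the empty graph, whose domain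
   is empty. *)
Definition op_sqrt X (H : set (X * X)) : set (X * X) :=
  xget set0 [set S | [/\ selfadjoint S, nonneg_op S & op_comp S S = H]].

(* The Moore-Penrose pseudo-inverse of a selfadjoint T: it maps T y + k to y,
   for y in dom T and in the closure of the range of T, and k in ker T. *)
Definition pinv X (T : set (X * X)) : set (X * X) :=
  [set p | closure (ran T) p.2 /\ exists2 k, ker T k & T (p.2, p.1 - k)].

(* The linear span, not closed. *)
Definition lspan X (S : set X) : set X :=
  [set x | exists n (c : 'I_n -> R[i]) (v : 'I_n -> X),
     (forall i, S (v i)) /\ x = \sum_(i < n) c i *: v i].

End Operators.

Record system (R : realType) (X U Y : hilbertType R) := System {
  sysA : X -> X ;
  sysB : U -> X ;
  sysC : X -> Y ;
  sysD : U -> Y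
}.

Section Systems.
Variables (R : realType) (X U Y : hilbertType R).
Implicit Types (Sg : system X U Y) (H : set (X * X)).

Definition bounded_system Sg : Prop :=
  [/\ bounded_op (sysA Sg), bounded_op (sysB Sg),
      bounded_op (sysC Sg) & bounded_op (sysD Sg)].

Definition adj_system Sg : system X Y U :=
  System (adj (sysA Sg)) (adj (sysC Sg)) (adj (sysB Sg)) (adj (sysD Sg)).

(* Im(A|B) *)
Definition reach Sg : set X :=
  lspan [set x | exists n u, x = iter n (sysA Sg) (sysB Sg u)].

(* Ker(C|A) *)
Definition unobs Sg : set X :=
  \bigcap_(n : nat) [set x | sysC Sg (iter n (sysA Sg) x) = 0].

Definition minimal Sg : Prop := dense (reach Sg) /\ unobs Sg = [set 0].

Definition pencil Sg (lam : R[i]) : X -> X := fun x => x - lam *: sysA Sg x.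

Definition boundedly_invertible (f : X -> X) : Prop :=
  exists g : X -> X, [/\ bounded_op g, cancel f g & cancel g f].

(* The transfer function; meaningful when pencil Sg lam is boundedly
   invertible. *)
Definition transfer Sg (lam : R[i]) : U -> Y := fun u =>
  sysD Sg u +
    lam *: sysC Sg (app (op_inv (graph (pencil Sg lam))) (sysB Sg u)).

Definition realization (theta : R[i] -> U -> Y) Sg : Prop :=
  exists2 r : R, 0 < r & forall lam : R[i], `|lam| < r%:C%C ->
    boundedly_invertible (pencil Sg lam) /\ theta lam =1 transfer Sg lam.

Definition op_norm_le (f : U -> Y) (c : R) : Prop :=
  forall u, `|f u| <= c%:C%C * `|u|.

(* Complex differentiability in the operator norm at every point of the open
   unit disc. *)
Definition disc_analytic (theta : R[i] -> U -> Y) : Prop :=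
  forall z : R[i], `|z| < 1 -> exists2 L : U -> Y, bounded_op L &
    forall e : R, 0 < e -> exists2 d : R, 0 < d &
      forall h : R[i], 0 < `|h| < d%:C%C ->
        op_norm_le (fun u => h^-1 *: (theta (z + h) u - theta z u) - L u) e.

(* Only the values of theta on the open unit disc matter. *)
Definition schur (theta : R[i] -> U -> Y) : Prop :=
  [/\ forall z, `|z| < 1 -> bounded_op (theta z),
      disc_analytic theta
    & forall z, `|z| < 1 -> op_norm_le (theta z) 1].

(* T is the boundary value of theta at zeta: the radial limit in the strong
   operator topology. *)
Definition boundary_value (theta : R[i] -> U -> Y) (zeta : R[i])
    (T : U -> Y) : Prop :=
  bounded_op T /\
  forall u, (fun r : R => theta (r%:C%C * zeta) u) @ 1^'- --> T u.

Definition co_inner (theta : R[i] -> U -> Y) : Prop :=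
  {ae (@lebesgue_measure R), forall t : R, t \in `[0, 2 * pi] ->
    exists2 T : U -> Y, boundary_value theta (cos t +i* sin t)%C T &
      forall y, T (adj T y) = y}.

Definition sqrtB Sg H : U -> X := fun u => app (op_sqrt H) (sysB Sg u).

Definition delta Sg H : U -> U := fun u =>
  u - adj (sysD Sg) (sysD Sg u) - adj (sqrtB Sg H) (sqrtB Sg H u).

Definition crossRI Sg H : X -> U := fun x =>
  adj (sysD Sg) (sysC Sg x)
    + adj (sqrtB Sg H) (app (op_sqrt H) (sysA Sg x)).

Definition sqrt_delta Sg H : set (U * U) := op_sqrt (graph (delta Sg H)).

Definition RI Sg : set (set (X * X)) :=
  [set H | [/\ selfadjoint H,
    positive_op H,
    (forall x, dom (op_sqrt H) x -> dom (op_sqrt H) (sysA Sg x)) /\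
      (forall u, dom (op_sqrt H) (sysB Sg u)),
    [/\ bounded_op (delta Sg H), nonneg_op (graph (delta Sg H)) &
      forall x, dom (op_sqrt H) x -> ran (sqrt_delta Sg H) (crossRI Sg H x)]
  & forall x, dom (op_sqrt H) x ->
      `|app (pinv (sqrt_delta Sg H)) (crossRI Sg H x)| ^+ 2 <=
      `|app (op_sqrt H) x| ^+ 2 - `|app (op_sqrt H) (sysA Sg x)| ^+ 2
        - `|sysC Sg x| ^+ 2]].

(* A subspace V is a core for G when G restricted to V is dense in G for the
   graph norm, which induces the product topology on X * X. *)
Definition core H (V : set X) : Prop :=
  V `<=` dom H /\ H `<=` closure (H `&` [set p | V p.1]).

End Systems.

Section RIcirc.
Variables (R : realType) (X U Y : hilbertType R).

Definition RIcirc (Sg : system X U Y) : set (set (X * X)) :=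
  [set H | [/\ RI Sg H,
    dense (op_image (op_sqrt H) (reach Sg)),
    dense (op_image (op_inv (op_sqrt H)) (reach (adj_system Sg)))
  & core (op_sqrt H) (reach Sg)]].

End RIcirc.

(* Main.v *)
(* Let c_0 = D* and c_(n+1) = B* A*^n C* be the adjoints of the Taylor
   coefficients of theta at 0.  Cauchy estimates on the disc show that
   theta(z)* y is close to the partial sums of conj(z)^n c_n y; integrating
   over circles whose radius tends to 1, where theta* is isometric because
   theta is co-inner, yields sum_n <c_n y, c_(n+k) y'> = <y, y'> for k = 0 and 0
   for k > 0.  Hence q(z) = sum_n |B* A*^n z|^2 satisfies
   q(A*z + C*y) + |B*z + D*y|^2 = q(z) + |y|^2 on the span R of
   the ranges of the A*^n C*.

   In terms of S = H^(1/2), membership in RI is the Kalman-Yakubovich-Popov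
   inequality |S(Ax + Bu)|^2 + |Cx + Du|^2 <= |Sx|^2 + |u|^2.  Its dual, applied
   to the adjoint system, bounds |S^(-1) z|^2 for z in R above by q(z), along the
   trajectory that builds z, and below by q(z), along the free motion from z.
   So the pairings <x, z> = <Sx, S^(-1) z>, z in R, determine |Sx| on Im(A|B)
   when S^(-1) R is dense, and hence determine H when Im(A|B) is a core.
   Conversely the closure of the form q defines H^(-1), the inequality for H
   follows by duality, and the conservation law at z = 0 says that the defect of
   H^(-1) for the adjoint system vanishes. *)
From HB Require Import structures.
From mathcomp Require Import all_boot all_order all_algebra.
From mathcomp Require Import complex.
From mathcomp Require Import all_classical all_reals all_analysis.
From mathcomp Require Import measurable_realfun.
From mathcomp Require Import ring lra.
Require Import Defs.

Set Implicit Arguments.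
Unset Strict Implicit.
Unset Printing Implicit Defensive.

Import Order.TTheory GRing.Theory Num.Theory.
Import numFieldNormedType.Exports.

Local Open Scope classical_set_scope.
Local Open Scope ring_scope.


(** * Hilbert spaces and quadratic forms *)

(** Selfadjoint operators are handled as graphs, and the only functional calculus is the square root
    of a positive contraction, built by iteration. A closed form yields [S = G Q^-1] with
    [Q^2 = (1 + S^2)^-1] and [Q^2 + G^2 = 1]. Since [op_sqrt H] is one chosen root of [H], roots are
    compared only through their domains and the values [|S x|], which already determine the square.

    Closing q on R gives [N], in the role of H^(-1/2), with R as a core, but says nothing on
    Im(A|B), which has to be a core of H^(1/2). So the form [|N^-1 x|^2] is closed a second time,
    starting from Im(A|B). The domain may shrink in this step, and density of S^(-1) R is proved
    anew, from [|S x| = |N^-1 x|].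

    On the analytic side the power series of theta is known only near 0, and the boundary values are
    strong limits of theta, not of its adjoints. Goursat's argument in logarithmic coordinates
    provides the mean value property and with it the Cauchy estimates; norm preservation by the
    adjoints of the boundary values turns weak convergence of the adjoints into strong
    convergence. *)

Section RealInnerProduct.
Variables (R : realType).

Lemma discr_le (A B e : R) : 0 <= A -> 0 <= e ->
  (forall s, 0 <= s ^+ 2 * A + 2 * s * B + e) -> B ^+ 2 <= e * A.
Proof.
move=> A0 e0 h; have [A1|A1] := ltrP 0 A.
  have := h (- B / A).
  have -> : (- B / A) ^+ 2 * A + 2 * (- B / A) * B + e = (e * A - B ^+ 2) / A.
    by field; rewrite gt_eqF.
  by rewrite pmulr_lge0 ?invr_gt0 // subr_ge0.
have AE : A = 0 by apply/eqP; rewrite eq_le A0 A1.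
rewrite {}AE {A0 A1} in h *.
have [->|B0] := eqVneq B 0; first by rewrite expr0n mulr0.
(* With [A = 0] the hypothesis is affine in [s]; this [s] gives it the value -1. *)
have := h (- (e + 1) / (2 * B)).
have -> : (- (e + 1) / (2 * B)) ^+ 2 * 0 + 2 * (- (e + 1) / (2 * B)) * B + e = -1 :> R.
  by field; rewrite B0.
by rewrite oppr_ge0 ler10.
Qed.

Variable X : hilbertType R.
Implicit Types x y z : X.

(** Estimates are made with this real bilinear form, where order and discriminants are available;
    [innerE] recovers [inner] by evaluating it at ['i *: y] as well. *)
Definition rip x y : R := complex.Re (inner x y).

Lemma inner_conj x y : inner y x = (inner x y)^*%C.
Proof. by rewrite hermC expr0 mul1r. Qed.

Lemma ripC x y : rip x y = rip y x.
Proof. by rewrite /rip (inner_conj x y); case: (inner x y). Qed.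

Lemma ripDl x y z : rip (x + y) z = rip x z + rip y z.
Proof. by rewrite /rip linearDl raddfD. Qed.

Lemma ripDr x y z : rip z (x + y) = rip z x + rip z y.
Proof. by rewrite ripC ripDl !(ripC z). Qed.

Lemma ripNl x y : rip (- x) y = - rip x y.
Proof. by rewrite /rip linearNl raddfN. Qed.

Lemma ripNr x y : rip x (- y) = - rip x y.
Proof. by rewrite ripC ripNl ripC. Qed.

Lemma ripBl x y z : rip (x - y) z = rip x z - rip y z.
Proof. by rewrite ripDl ripNl. Qed.

Lemma ripBr x y z : rip z (x - y) = rip z x - rip z y.
Proof. by rewrite ripDr ripNr. Qed.

Lemma ripZl (r : R) x y : rip (r%:C%C *: x) y = r * rip x y.
Proof.
by rewrite /rip linearZl_LR /=; case: (inner x y) => a b /=; rewrite mul0r subr0.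
Qed.

Lemma ripZr (r : R) x y : rip x (r%:C%C *: y) = r * rip x y.
Proof. by rewrite ripC ripZl ripC. Qed.

Lemma rip0l x : rip 0 x = 0.
Proof. by rewrite /rip linear0l. Qed.

Lemma rip0r x : rip x 0 = 0.
Proof. by rewrite ripC rip0l. Qed.

Lemma ripil x y : rip ('i%C *: x) y = - rip x ('i%C *: y).
Proof.
rewrite /rip linearZl_LR linearZr_LR /=; case: (inner x y) => a b /=.
by rewrite !(mul0r, mul1r, mulN1r, oppr0, sub0r, subr0); ring.
Qed.

Lemma scaleii x : 'i%C *: ('i%C *: x) = - x.
Proof. by rewrite scalerA -expr2 sqr_i scaleN1r. Qed.

Lemma ripi x y : rip ('i%C *: x) ('i%C *: y) = rip x y.
Proof. by rewrite ripil scaleii ripNr opprK. Qed.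

Lemma innerE x y : inner x y = (rip x y +i* rip x ('i%C *: y))%C.
Proof.
rewrite /rip linearZr_LR /=; case: (inner x y) => a b /=.
by rewrite !(mul0r, mul1r, mulN1r, oppr0, sub0r, subr0, opprK).
Qed.

Lemma complex_ReIm (a : R[i]) x :
  a *: x = (complex.Re a)%:C%C *: x + (complex.Im a)%:C%C *: ('i%C *: x).
Proof. by rewrite scalerA -scalerDl (mulrC _ 'i%C) -complexE. Qed.

Lemma innerxx x : inner x x = (rip x x)%:C%C.
Proof.
rewrite innerE; congr Complex.
by have := ripil x x; rewrite ripC; lra.
Qed.

Lemma rip_ge0 x : 0 <= rip x x.
Proof. by have := dnorm_ge0 (inner : {dot X for _}) x; rewrite innerxx ler0c. Qed.

Lemma rip_eq0 x : (rip x x == 0) = (x == 0).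
Proof.
rewrite -(dnorm_eq0 (inner : {dot X for _})) innerxx eq_complex /= eqxx.
by rewrite andbT.
Qed.

Lemma normE x : `|x| = (Num.sqrt (rip x x))%:C%C.
Proof.
apply/eqP; rewrite -(@eqrXn2 _ 2) ?normr_ge0 ?ler0c ?sqrtr_ge0 // sqr_normE innerxx.
by rewrite -rmorphXn /= sqr_sqrtr ?rip_ge0.
Qed.

Lemma sqr_normr x : `|x| ^+ 2 = (rip x x)%:C%C.
Proof. by rewrite sqr_normE innerxx. Qed.

Lemma norm_leP x (c : R) : 0 <= c -> (`|x| <= c%:C%C) = (rip x x <= c ^+ 2).
Proof.
by move=> c0; rewrite normE lecR -(@ler_pXn2r _ 2) ?nnegrE ?sqrtr_ge0 // sqr_sqrtr ?rip_ge0.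
Qed.

Lemma norm_ltP x (c : R) : 0 <= c -> (`|x| < c%:C%C) = (rip x x < c ^+ 2).
Proof.
by move=> c0; rewrite normE ltcR -(@ltr_pXn2r _ 2) ?nnegrE ?sqrtr_ge0 // sqr_sqrtr ?rip_ge0.
Qed.

Lemma n2D x y : rip (x + y) (x + y) = rip x x + rip y y + 2 * rip x y.
Proof. by rewrite !(ripDl, ripDr) (ripC y x); ring. Qed.

Lemma n2B x y : rip (x - y) (x - y) = rip x x + rip y y - 2 * rip x y.
Proof. by rewrite n2D !(ripNl, ripNr); ring. Qed.

Lemma n2N x : rip (- x) (- x) = rip x x.
Proof. by rewrite ripNl ripNr opprK. Qed.

Lemma n2BC x y : rip (x - y) (x - y) = rip (y - x) (y - x).
Proof. by rewrite -n2N opprB. Qed.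

Lemma n2Z (a : R[i]) x :
  rip (a *: x) (a *: x) = ((complex.Re a) ^+ 2 + (complex.Im a) ^+ 2) * rip x x.
Proof.
have := dnormZ (inner : {dot X for _}) a x.
by rewrite !innerxx -add_Re2_Im2 -rmorphM => -[].
Qed.

Lemma n2D_le x y : rip (x + y) (x + y) <= 2 * rip x x + 2 * rip y y.
Proof. by have := rip_ge0 (x - y); rewrite n2B n2D; lra. Qed.

Lemma n2_tri x y z :
  rip (x - z) (x - z) <= 2 * rip (x - y) (x - y) + 2 * rip (y - z) (y - z).
Proof. by have -> : x - z = (x - y) + (y - z); [rewrite addrA subrK|exact: n2D_le]. Qed.

Lemma rip_CS x y : rip x y ^+ 2 <= rip x x * rip y y.
Proof.
rewrite mulrC; apply: discr_le; rewrite ?rip_ge0 // => s.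
by have := rip_ge0 (s%:C%C *: x + y); rewrite n2D !(ripZl, ripZr); lra.
Qed.

Lemma rip_le x y : 2 * rip x y <= rip x x + rip y y.
Proof. by have := rip_ge0 (x - y); rewrite n2B; lra. Qed.

Lemma rip_suml n (F : 'I_n -> X) y : rip (\sum_(i < n) F i) y = \sum_(i < n) rip (F i) y.
Proof.
elim/big_rec2: _ => [|i a b _ <-]; [exact: rip0l|exact: ripDl].
Qed.

Lemma eq_rip x y : (forall z, rip z x = rip z y) -> x = y.
Proof.
by move=> h; apply/eqP; rewrite -subr_eq0 -rip_eq0 ripBr h subrr.
Qed.

End RealInnerProduct.

Notation n2 x := (rip x x).

Section Convergence.
Variables (R : realType).

(** One-sided on purpose: for nonnegative sequences this is convergence to 0 ([small_cvg]), and an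
    upper bound is all that has to be supplied. *)
Definition small (u : nat -> R) : Prop :=
  forall e : R, 0 < e -> exists N, forall n, (N <= n)%N -> u n <= e.

Lemma small_le (u v : nat -> R) : (forall n, u n <= v n) -> small v -> small u.
Proof.
by move=> uv h e /h[N hN]; exists N => n /hN; apply: le_trans.
Qed.

Lemma smallD (u v : nat -> R) : small u -> small v -> small (fun n => u n + v n).
Proof.
move=> hu hv e e0; have e2 : 0 < e / 2 by rewrite divr_gt0.
have [N hN] := hu _ e2; have [M hM] := hv _ e2; exists (maxn N M) => n.
rewrite geq_max => /andP[/hN ? /hM ?]; lra.
Qed.

Lemma smallZ (c : R) (u : nat -> R) : 0 <= c -> small u -> small (fun n => c * u n).
Proof.
move=> c0 hu e e0; have e2 : 0 < e / (c + 1) by rewrite divr_gt0 //; lra.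
have [N hN] := hu _ e2; exists N => n /hN h.
apply: (@le_trans _ _ (c * (e / (c + 1)))); first by rewrite ler_wpM2l.
rewrite mulrA ler_pdivrMr; last lra.
by rewrite mulrC ler_wpM2l //; lra.
Qed.

Lemma small_inv : small (fun n => n.+1%:R^-1).
Proof.
move=> e e0; exists (Num.trunc e^-1).+1 => n hn.
rewrite invf_ple ?posrE //; apply/ltW; apply: lt_le_trans (truncnS_gt _) _.
by rewrite ler_nat; apply: leq_trans hn _.
Qed.

Lemma small_cvg (u : nat -> R) : (forall n, 0 <= u n) ->
  small u <-> (u @ \oo --> (0 : R)).
Proof.
move=> u0; split.
  move=> h; apply/cvgrPdist_le => e /h[N hN]; exists N => // n /= /hN.
  by rewrite sub0r normrN ger0_norm.
move=> /cvgrPdist_le h e /h[N _ hN]; exists N => n /hN /=.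
by rewrite sub0r normrN ger0_norm.
Qed.

Lemma small0 (a : R) (u : nat -> R) : small u -> (forall n, a <= u n) -> a <= 0.
Proof.
move=> h ha; rewrite leNgt; apply/negP => a0.
have [|N hN] := h (a / 2); first by rewrite divr_gt0.
by have := hN N (leqnn _); have := ha N; lra.
Qed.

Variable X : hilbertType R.
Implicit Types (x y : X) (u : nat -> X).

Lemma cvg_n2P u x :
  u @ \oo --> x <-> small (fun n => n2 (u n - x)).
Proof.
split.
  move=> /cvgrPdist_le h e e0.
  have s0 : (0 : R[i]) < (Num.sqrt e)%:C%C by rewrite ltcR sqrtr_gt0.
  have [N _ hN] := h _ s0; exists N => n /hN /=.
  by rewrite norm_leP ?sqrtr_ge0 // sqr_sqrtr ?(ltW e0) // n2BC.
move=> h; apply/cvgrPdist_le => e e0.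
have ee : e = (complex.Re e)%:C%C by rewrite RRe_real // gtr0_real.
have e1 : 0 < complex.Re e by rewrite -ltcR -ee.
have [N hN] := h _ (exprn_gt0 2 e1); exists N => // n /hN hn /=.
by rewrite ee norm_leP ?(ltW e1) // n2BC.
Qed.

Lemma cauchy_n2 u :
  (forall e : R, 0 < e -> exists N, forall m n, (N <= m)%N -> (N <= n)%N ->
     n2 (u m - u n) <= e) -> exists x, u @ \oo --> x.
Proof.
move=> h; suff : cvg (u @ \oo) by move=> c; exists (lim (u @ \oo)).
apply/cauchy_cvgP/cauchy_exP => e e0.
have ee : e = (complex.Re e)%:C%C by rewrite RRe_real // gtr0_real.
have e1 : 0 < complex.Re e by rewrite -ltcR -ee.
have [|N hN] := h ((complex.Re e / 2) ^+ 2); first by rewrite exprn_gt0 // divr_gt0.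
exists (u N); exists N => // n /= hn.
rewrite -ball_normE /= ee norm_ltP ?(ltW e1) //.
apply: le_lt_trans (hN _ _ (leqnn _) hn) _.
by rewrite ltr_pXn2r ?nnegrE ?divr_ge0 ?(ltW e1) // ltr_pdivrMr //; lra.
Qed.

Lemma cvg_uniq u x y : u @ \oo --> x -> u @ \oo --> y -> x = y.
Proof. by move=> hx hy; apply: cvg_unique hx hy. Qed.

Lemma cvg_ripl u x y : u @ \oo --> x ->
  (fun n => rip (u n) y) @ \oo --> rip x y.
Proof.
move=> /cvg_n2P h; apply/cvgrPdist_le => e e0.
have [|N hN] := h (e ^+ 2 / (n2 y + 1)).
  by rewrite divr_gt0 ?exprn_gt0 // ltr_wpDl ?rip_ge0.
exists N => // n /hN hn /=; rewrite -ripBl.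
rewrite -(@ler_pXn2r _ 2) ?nnegrE ?normr_ge0 ?(ltW e0) // real_normK ?num_real //.
apply: le_trans (rip_CS _ _) _; rewrite n2BC.
apply: le_trans (ler_wpM2r (rip_ge0 _) hn) _.
rewrite mulrAC ler_pdivrMr ?ltr_wpDl ?rip_ge0 //.
by rewrite ler_wpM2l ?sqr_ge0 // lerDl.
Qed.

Lemma cvg_n2 u x : u @ \oo --> x ->
  (fun n => n2 (u n)) @ \oo --> n2 x.
Proof.
move=> h.
have -> : (fun n => n2 (u n)) =
    (fun n => n2 (u n - x) + (2 * rip (u n) x - n2 x)).
  by apply/funext => n; rewrite n2B; ring.
suff : (fun n => n2 (u n - x) + (2 * rip (u n) x - n2 x)) @ \oo -->
    0 + (2 * n2 x - n2 x).
  by rewrite (_ : 0 + _ = n2 x) //; ring.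
apply: cvgD; first by apply/small_cvg; [move=> n; exact: rip_ge0|exact/cvg_n2P].
apply: cvgB; last exact: cvg_cst.
by apply: cvgM; [exact: cvg_cst|exact: cvg_ripl].
Qed.

Lemma closure_n2P (V : set X) x : closure V x <->
  forall e : R, 0 < e -> exists2 v, V v & n2 (v - x) <= e.
Proof.
split.
  move=> h e e0.
  have s0 : (0 : R[i]) < (Num.sqrt e)%:C%C by rewrite ltcR sqrtr_gt0.
  have [v [Vv]] := h _ (nbhsx_ballx x _ s0).
  rewrite -ball_normE /= => hv; exists v => //; rewrite n2BC.
  move/ltW: hv; rewrite norm_leP ?sqrtr_ge0 // sqr_sqrtr //; exact: ltW.
move=> h B /nbhs_ballP[e /= e0 hB].
have ee : e = (complex.Re e)%:C%C by rewrite RRe_real // gtr0_real.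
have e1 : 0 < complex.Re e by rewrite -ltcR -ee.
have e4 : 0 < (complex.Re e / 2) ^+ 2 by rewrite exprn_gt0 // divr_gt0.
have [v Vv hv] := h _ e4.
exists v; split => //; apply: hB; rewrite -ball_normE /= ee norm_ltP ?(ltW e1) //.
rewrite n2BC; apply: le_lt_trans hv _.
by rewrite ltr_pXn2r ?nnegrE ?divr_ge0 ?(ltW e1) // ltr_pdivrMr //; lra.
Qed.

Lemma dense_closure (V : set X) : dense V <-> forall x, closure V x.
Proof.
split=> [dV x B|h W exW oW].
  rewrite nbhsE => -[W [oW Wx] WB].
  by have [|y [Wy Vy]] := dV W _ oW; [exists x|exists y; split => //; exact: WB].
have [x Wx] := exW.
by have [y [Vy Wy]] := h x W (open_nbhs_nbhs (conj oW Wx)); exists y.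
Qed.

Lemma dense_n2P (V : set X) : dense V <->
  forall x (e : R), 0 < e -> exists2 v, V v & n2 (v - x) <= e.
Proof.
rewrite dense_closure; split=> h x; first by have /closure_n2P := h x.
by apply/closure_n2P => e; exact: h.
Qed.

Lemma dense_seq (V : set X) x : closure V x ->
  exists2 u, (forall n, V (u n)) & u @ \oo --> x.
Proof.
move=> /closure_n2P h.
have hn n : exists w : X, V w /\ n2 (w - x) <= n.+1%:R^-1.
  by have [|v Vv hv] := h (n.+1%:R^-1 : R); [rewrite invr_gt0|exists v].
have [u hu] := choice hn; exists u => [n|]; first by have [] := hu n.
apply/cvg_n2P; apply: small_le small_inv => n; by have [] := hu n.
Qed.

Lemma perp_closure (V : set X) x y : closure V x ->
  (forall v, V v -> rip v y = 0) -> rip x y = 0.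
Proof.
move=> /dense_seq[u Vu ux] h.
have := cvg_ripl (y := y) ux.
have -> : (fun n => rip (u n) y) = (fun=> 0) by apply/funext => n; exact: h.
by move=> /(cvg_unique _ (@cvg_cst _ _ _ _ _)) /= ->.
Qed.

Lemma dense_perp0 (V : set X) y : dense V ->
  (forall v, V v -> rip v y = 0) -> y = 0.
Proof.
move=> /dense_closure dV h; apply/eqP; rewrite -rip_eq0; apply/eqP.
exact: perp_closure h.
Qed.

End Convergence.

Section Riesz.
Variables (R : realType).

Definition subspace (V : lmodType R[i]) (P : set V) : Prop :=
  P 0 /\ forall (a : R[i]) x y, P x -> P y -> P (a *: x + y).

Section Subspace.
Variables (V : lmodType R[i]) (P : set V).
Hypothesis sP : subspace P.

Lemma subspaceZ a x : P x -> P (a *: x).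
Proof. by move=> Px; rewrite -[_ *: _]addr0; apply: sP.2 => //; exact: sP.1. Qed.

Lemma subspaceD x y : P x -> P y -> P (x + y).
Proof. by move=> Px Py; rewrite -[x]scale1r; exact: sP.2. Qed.

Lemma subspaceN x : P x -> P (- x).
Proof. by move=> Px; rewrite -scaleN1r; exact: subspaceZ. Qed.

Lemma subspaceB x y : P x -> P y -> P (x - y).
Proof. by move=> Px Py; apply: subspaceD => //; exact: subspaceN. Qed.

Lemma subspace_sum n (F : 'I_n -> V) : (forall i, P (F i)) -> P (\sum_(i < n) F i).
Proof. by move=> h; elim/big_rec: _ => [|i x _]; [exact: sP.1|exact: subspaceD]. Qed.

End Subspace.

(* The form [b] is only required to be bilinear on the subspace [P]. *)
Record sform (V : lmodType R[i]) (P : set V) (b : V -> V -> R) : Prop := Sform {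
  sf_sub : subspace P ;
  sf_sym : forall x y, P x -> P y -> b x y = b y x ;
  sf_add : forall x y z, P x -> P y -> P z -> b (x + y) z = b x z + b y z ;
  sf_scale : forall (r : R) x y, P x -> P y -> b (r%:C%C *: x) y = r * b x y ;
  sf_ge0 : forall x, P x -> 0 <= b x x
}.

Definition rlinear_on (V : lmodType R[i]) (P : set V) (phi : V -> R) : Prop :=
  (forall x y, P x -> P y -> phi (x + y) = phi x + phi y) /\
  (forall (r : R) x, P x -> phi (r%:C%C *: x) = r * phi x).

Section Form.
Variables (V : lmodType R[i]) (P : set V) (b : V -> V -> R).
Hypothesis fb : sform P b.
Let sP := sf_sub fb.

Lemma sf_00 : b 0 0 = 0.
Proof. by have := sf_scale fb 0 sP.1 sP.1; rewrite mul0r scaler0. Qed.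

Lemma sf_addr x y z : P x -> P y -> P z -> b z (x + y) = b z x + b z y.
Proof.
move=> Px Py Pz; rewrite (sf_sym fb) //; last exact: subspaceD.
by rewrite (sf_add fb) // !(sf_sym fb _ Pz).
Qed.

Lemma sf_scaler (r : R) x y : P x -> P y -> b x (r%:C%C *: y) = r * b x y.
Proof.
move=> Px Py; rewrite (sf_sym fb) //; last exact: subspaceZ.
by rewrite (sf_scale fb) // (sf_sym fb).
Qed.

Lemma sf_opp x y : P x -> P y -> b (- x) y = - b x y.
Proof.
move=> Px Py; have := sf_scale fb (-1) Px Py.
by rewrite rmorphN1 scaleN1r mulN1r.
Qed.

Lemma sf_oppr x y : P x -> P y -> b x (- y) = - b x y.
Proof.
move=> Px Py; rewrite (sf_sym fb) //; last exact: subspaceN.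
by rewrite sf_opp // (sf_sym fb).
Qed.

Lemma sf_sqrD x y : P x -> P y -> b (x + y) (x + y) = b x x + b y y + 2 * b x y.
Proof.
move=> Px Py; have Pxy := subspaceD sP Px Py.
by rewrite (sf_add fb) // !sf_addr // (sf_sym fb Py Px); ring.
Qed.

Lemma sf_sqrB x y : P x -> P y -> b (x - y) (x - y) = b x x + b y y - 2 * b x y.
Proof.
move=> Px Py; have PNy := subspaceN sP Py.
by rewrite sf_sqrD // sf_opp // !sf_oppr //; ring.
Qed.

Lemma sf_sqrZ (r : R) x : P x -> b (r%:C%C *: x) (r%:C%C *: x) = r ^+ 2 * b x x.
Proof.
move=> Px; rewrite (sf_scale fb) //; last exact: subspaceZ.
by rewrite sf_scaler //; ring.
Qed.

Lemma sf_CS x y : P x -> P y -> b x y ^+ 2 <= b x x * b y y.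
Proof.
move=> Px Py; rewrite mulrC; apply: discr_le; rewrite ?(sf_ge0 fb) // => s.
have Psx : P (s%:C%C *: x) by exact: subspaceZ.
have := sf_ge0 fb (subspaceD sP Psx Py).
by rewrite sf_sqrD // sf_sqrZ // (sf_scale fb) //; lra.
Qed.

Lemma sf_sqrD_le x y : P x -> P y ->
  b (x + y) (x + y) <= 2 * b x x + 2 * b y y.
Proof.
move=> Px Py; have := sf_ge0 fb (subspaceB sP Px Py).
by rewrite sf_sqrB // sf_sqrD //; lra.
Qed.

Lemma sf_sqrB_le x y z : P x -> P y -> P z ->
  b (x - z) (x - z) <= 2 * b (x - y) (x - y) + 2 * b (y - z) (y - z).
Proof.
move=> Px Py Pz; have Pxy := subspaceB sP Px Py; have Pyz := subspaceB sP Py Pz.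
have -> : x - z = (x - y) + (y - z) by rewrite addrA subrK.
exact: sf_sqrD_le.
Qed.

(* A minimizing sequence of [b x x - 2 phi x]. *)
Lemma riesz_seq (phi : V -> R) (M : R) : rlinear_on P phi -> 0 <= M ->
  (forall x, P x -> phi x ^+ 2 <= M * b x x) ->
  exists w : nat -> V, [/\ forall n, P (w n),
    forall m n, b (w m - w n) (w m - w n) <= 2 * m.+1%:R^-1 + 2 * n.+1%:R^-1
  & forall x n, P x -> (b (w n) x - phi x) ^+ 2 <= n.+1%:R^-1 * b x x].
Proof.
move=> [phiD phiZ] M0 phib.
pose J x := b x x - 2 * phi x.
have Jge x : P x -> - M <= J x.
  move=> Px; have b0 := sf_ge0 fb Px; have h := phib _ Px.
  (* From [phi x ^+ 2 <= M * b x x] and the inequality between arithmetic and geometric means. *)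
  have : 2 * phi x <= M + b x x.
    rewrite leNgt; apply/negP => hlt.
    have : (M + b x x) ^+ 2 < (2 * phi x) ^+ 2 by rewrite ltr_pXn2r ?nnegrE //; lra.
    by have := sqr_ge0 (M - b x x); move: h; lra.
  by rewrite /J; lra.
pose S := [set J x | x in P].
have hS : has_inf S.
  split; first by exists (J 0), 0 => //; exact: sP.1.
  by exists (- M) => _ [x Px <-]; exact: Jge.
have hw n : exists x, P x /\ J x <= inf S + n.+1%:R^-1.
  have n0 : (0 : R) < n.+1%:R^-1 by rewrite invr_gt0.
  have [_ [x Px <-] Jx] := inf_adherent n0 hS.
  by exists x; split => //; exact: ltW.
have infle x : P x -> inf S <= J x.
  by move=> Px; apply: ge_inf; [exact: hS.2|exists x].
have [w Hw] := choice hw; exists w; split => [n|m n|x n Px].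
- by have [] := Hw n.
- have [Pm Jm] := Hw m; have [Pn Jn] := Hw n.
  have Pmn := subspaceD sP Pm Pn.
  (* Comparing the midpoint of two nearly minimal points with the infimum bounds their distance, by
     the parallelogram law. *)
  have := infle _ (subspaceZ sP (2^-1 : R)%:C%C Pmn).
  rewrite /J sf_sqrZ // phiZ // phiD // sf_sqrD // sf_sqrB //.
  have -> : (2^-1 : R) ^+ 2 = 4^-1 by field.
  move: Jm Jn; rewrite /J; move: (m.+1%:R^-1) (n.+1%:R^-1) => d e; lra.
- have [Pn Jn] := Hw n; apply: discr_le.
  + exact: sf_ge0 fb _ Px.
  + by rewrite invr_ge0.
  (* [J (s x + w n)] is at least [J (w n) - 1/(n+1)] for every [s]; the discriminant of this
     quadratic in [s] is the claim. *)
  + move=> s; have Psx : P (s%:C%C *: x) by exact: subspaceZ.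
    have := infle _ (subspaceD sP Psx Pn).
    rewrite /J sf_sqrD // sf_sqrZ // phiD // phiZ // (sf_scale fb) // (sf_sym fb Px Pn).
    by move: Jn; rewrite /J; move: (n.+1%:R^-1) => e; lra.
Qed.

End Form.

Lemma sqr_cvg (a : nat -> R) (c B : R) : 0 <= B ->
  (forall n, (a n - c) ^+ 2 <= n.+1%:R^-1 * B) -> a @ \oo --> c.
Proof.
move=> B0 h; apply/cvgrPdist_le => e e0.
have e1 : 0 < e ^+ 2 / (B + 1) by rewrite divr_gt0 ?exprn_gt0 //; lra.
have [N hN] := @small_inv R _ e1; exists N => // n /hN hn /=.
rewrite distrC -(@ler_pXn2r _ 2) ?nnegrE ?normr_ge0 ?(ltW e0) // real_normK ?num_real //.
apply: le_trans (h n) _; apply: le_trans (ler_wpM2r B0 hn) _.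
rewrite mulrAC ler_pdivrMr; last lra.
by rewrite ler_wpM2l ?sqr_ge0 // lerDl.
Qed.

Lemma sform_rip (X : hilbertType R) (V : lmodType R[i]) (P : set V) (J : V -> X) :
  subspace P -> (forall (a : R[i]) x y, P x -> P y -> J (a *: x + y) = a *: J x + J y) ->
  sform P (fun x y => rip (J x) (J y)).
Proof.
move=> sP JL.
have JD x y : P x -> P y -> J (x + y) = J x + J y.
  by move=> Px Py; have := JL 1 x y Px Py; rewrite !scale1r.
have J0 : J 0 = 0.
  by have := JD 0 0 sP.1 sP.1; rewrite addr0 => /eqP; rewrite -subr_eq0 opprD addNKr oppr_eq0 => /eqP.
have JZ a x : P x -> J (a *: x) = a *: J x.
  by move=> Px; have := JL a x 0 Px sP.1; rewrite J0 !addr0.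
split => // [x y _ _|x y z Px Py _|r x y Px _|x _].
- exact: ripC.
- by rewrite JD // ripDl.
- by rewrite JZ // ripZl.
- exact: rip_ge0.
Qed.

(** A minimizing sequence is Cauchy for [|J x|], so its image under [J] converges in [X]. With [P] a
    graph and [J := snd] this finds preimages: a functional of the first component that is bounded
    by the second one is represented by a vector [g], and selfadjointness then puts [g] in the
    domain. *)
Lemma riesz_range (X : hilbertType R) (V : lmodType R[i]) (P : set V) (J : V -> X)
    (phi : V -> R) (M : R) : subspace P ->
  (forall (a : R[i]) x y, P x -> P y -> J (a *: x + y) = a *: J x + J y) ->
  rlinear_on P phi -> 0 <= M ->
  (forall x, P x -> phi x ^+ 2 <= M * n2 (J x)) ->
  exists g, [/\ closure [set J x | x in P] g,
    forall x, P x -> phi x = rip (J x) g & n2 g <= M].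
Proof.
move=> sP JL phiL M0 phib.
have fb := sform_rip sP JL.
have [w [Pw wc wphi]] := riesz_seq fb phiL M0 phib.
have JB x y : P x -> P y -> J (x - y) = J x - J y.
  by move=> Px Py; have := JL (-1) y x Py Px; rewrite !scaleN1r addrC => ->; rewrite addrC.
have [|g wg] := @cauchy_n2 R X (J \o w).
  move=> e e0; have [|N hN] := @small_inv R (e / 4); first by rewrite divr_gt0.
  exists N => m n /hN hm /hN hn /=; rewrite -JB //; apply: le_trans (wc m n) _; move: hm hn.
  move: (m.+1%:R^-1) (n.+1%:R^-1) => d d'; lra.
have gphi x : P x -> phi x = rip (J x) g.
  move=> Px; have h1 := sqr_cvg (rip_ge0 _) (fun n => wphi x n Px).
  by rewrite (cvg_unique _ h1 (cvg_ripl wg)) // ripC.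
have gcl : closure [set J x | x in P] g.
  apply/closure_n2P => e e0; have /cvg_n2P/(_ e e0)[N hN] := wg.
  by exists (J (w N)); [exists (w N)|exact: hN].
exists g; split => //.
have [->|g0] := eqVneq g 0; first by rewrite rip0l.
have g1 : 0 < n2 g by rewrite lt_neqAle rip_ge0 eq_sym rip_eq0 g0.
have : n2 g ^+ 2 <= M * n2 g.
  have h1 : (fun n => rip (J (w n)) g * rip (J (w n)) g) @ \oo --> n2 g ^+ 2.
    by rewrite expr2; apply: cvgM; exact: cvg_ripl.
  have h2 : (fun n => M * n2 (J (w n))) @ \oo --> M * n2 g.
    by apply: cvgM; [exact: cvg_cst|exact: cvg_n2].
  apply: (ler_cvg_to h1 h2); near=> n.
  by rewrite -expr2 -gphi //; exact: phib.
by rewrite expr2 ler_pM2r.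
Unshelve. all: by end_near.
Qed.

(** The vector of the closure of [V] that represents [rip _ x] on [V] is the projection of [x]; the
    difference is orthogonal to [V]. *)
Lemma dense_subspaceP (X : hilbertType R) (V : set X) : subspace V ->
  (forall y, (forall v, V v -> rip v y = 0) -> y = 0) -> dense V.
Proof.
move=> sV h; apply/dense_closure => x.
have [||||g [gcl gx _]] := @riesz_range X X V idfun (fun y => rip y x) (n2 x) sV.
- by [].
- by split => [y z _ _|r y _]; rewrite (ripDl, ripZl).
- exact: rip_ge0.
- by move=> y _; rewrite mulrC; exact: rip_CS.
have : x - g = 0 by apply: h => v Vv; rewrite ripBr gx // subrr.
by move=> /subr0_eq ->; move: gcl; rewrite (image_id V).
Qed.

End Riesz.

Section BoundedOperators.
Variables (R : realType).

Section TwoSpaces.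
Variables (X Y : hilbertType R) (f : X -> Y).

Lemma bounded_opP : bounded_op f <->
  linear f /\ exists2 M : R, 0 <= M & forall x, n2 (f x) <= M * n2 x.
Proof.
split=> [[lf [M hM]]|[lf [M M0 hM]]]; split => //.
  exists (M ^+ 2); first exact: sqr_ge0.
  move=> x; have := hM x; rewrite !normE -rmorphM lecR => h.
  have := ler_pM (sqrtr_ge0 _) (sqrtr_ge0 _) h h.
  rewrite -!expr2 exprMn !sqr_sqrtr ?rip_ge0 //.
exists (Num.sqrt M) => x; rewrite !normE -rmorphM lecR -sqrtrM //.
exact: ler_wsqrtr.
Qed.

Hypothesis lf : linear f.

Lemma linop0 : f 0 = 0.
Proof. by have := lf (-1) 0 0; rewrite scaleN1r oppr0 addr0 scaleN1r addNr. Qed.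

Lemma linopD x y : f (x + y) = f x + f y.
Proof. by have := lf 1 x y; rewrite !scale1r. Qed.

Lemma linopZ a x : f (a *: x) = a *: f x.
Proof. by have := lf a x 0; rewrite linop0 !addr0. Qed.

Lemma linopN x : f (- x) = - f x.
Proof. by rewrite -scaleN1r linopZ scaleN1r. Qed.

Lemma linopB x y : f (x - y) = f x - f y.
Proof. by rewrite linopD linopN. Qed.

Lemma linop_sum n (F : 'I_n -> X) : f (\sum_(i < n) F i) = \sum_(i < n) f (F i).
Proof. by elim/big_rec2: _ => [|i a b _ <-]; [exact: linop0|exact: linopD]. Qed.

Lemma bop_cvg (M : R) u x : (forall x, n2 (f x) <= M * n2 x) ->
  u @ \oo --> x -> (f \o u) @ \oo --> f x.
Proof.
move=> fM /cvg_n2P h; apply/cvg_n2P.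
apply: (@small_le _ _ (fun n => `|M| * n2 (u n - x))).
  move=> n /=; rewrite -linopB; apply: le_trans (fM _) _.
  by rewrite ler_wpM2r ?rip_ge0 // ler_norm.
exact: smallZ.
Qed.

End TwoSpaces.

(** * Square roots of positive contractions *)

Section Sqrt.
Variables (X : hilbertType R).
Implicit Types (E F G K T : X -> X).

Definition symop T := forall x y, rip (T x) y = rip x (T y).

(** Cauchy-Schwarz for the form [rip (T x) y] at [x] and [T x]: |Tx|^4 <= <Tx, x> <T(Tx), Tx> <=
    |x|^2 |Tx|^2. *)
Lemma symop_contr T : linear T -> symop T ->
  (forall x, 0 <= rip (T x) x) -> (forall x, rip (T x) x <= n2 x) ->
  forall x, n2 (T x) <= n2 x.
Proof.
move=> lT sT T0 T1 x.
have fb : sform setT (fun x y => rip (T x) y).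
  split => // [y z _ _|y z t _ _ _|r y z _ _].
  - by rewrite sT ripC.
  - by rewrite linopD // ripDl.
  - by rewrite linopZ // ripZl.
have := @sf_CS _ _ _ _ fb x (T x) I I.
have := T1 (T x); have := T1 x; have := T0 x; have := rip_ge0 x.
have := rip_ge0 (T x); have := T0 (T x); rewrite -sT.
move: (n2 (T x)) (n2 x) (rip (T x) x) (rip (T (T x)) (T x)) => a b c d.
move=> d0 a0 b0 c0 cb da h.
have [->|a1] := eqVneq a 0 => //.
have {}a1 : 0 < a by rewrite lt_neqAle eq_sym a1.
have : a * a <= b * a.
  by rewrite -expr2; apply: le_trans h _; apply: ler_pM.
by rewrite ler_pM2r.
Qed.

(* The polynomials in [E] with nonnegative coefficients; the real index is the
   value at 1 and dominates the operator norm when [E] is a contraction. *)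
Inductive cone E : (X -> X) -> R -> Prop :=
| cone_id : cone E E 1
| cone_zero : cone E (fun=> 0) 0
| cone_add F G c d : cone E F c -> cone E G d -> cone E (fun x => F x + G x) (c + d)
| cone_scale (r : R) F c : 0 <= r -> cone E F c ->
    cone E (fun x => r%:C%C *: F x) (r * c)
| cone_comp F G c d : cone E F c -> cone E G d -> cone E (F \o G) (c * d).

Section Cone.
Variables (E : X -> X).
Hypotheses (lE : linear E) (sE : symop E).
Hypothesis E1 : forall x, n2 (E x) <= n2 x.

Lemma cone_ge0 F c : cone E F c -> 0 <= c.
Proof.
elim=> [//|//|G H a b _ a0 _ b0|r G a r0 _ a0|G H a b _ a0 _ b0].
- exact: addr_ge0.
- exact: mulr_ge0.
- exact: mulr_ge0.
Qed.

Lemma cone_linear F c : cone E F c -> linear F.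
Proof.
elim=> [//|a x y|G H c1 c2 _ lG _ lH a x y|r G c1 _ _ lG a x y|
  G H c1 c2 _ lG _ lH a x y /=].
- by rewrite scaler0 addr0.
- by rewrite lG lH scalerDr addrACA.
- by rewrite lG scalerDr !scalerA mulrC.
- by rewrite lH lG.
Qed.

Lemma cone_comm K F c : linear K -> (forall x, K (E x) = E (K x)) ->
  cone E F c -> forall x, K (F x) = F (K x).
Proof.
move=> lK KE; elim=> [//|x|G H c1 c2 _ KG _ KH x|r G c1 _ _ KG x|
  G H c1 c2 _ KG _ KH x /=].
- exact: linop0.
- by rewrite linopD // KG KH.
- by rewrite linopZ // KG.
- by rewrite KG KH.
Qed.

Lemma cone_comm2 F G c d : cone E F c -> cone E G d -> forall x, F (G x) = G (F x).
Proof.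
move=> cF cG; apply: (cone_comm (cone_linear cF) _ cG) => x.
by rewrite (cone_comm lE _ cF).
Qed.

Lemma cone_sym F c : cone E F c -> symop F.
Proof.
elim=> [//|x y|G H c1 c2 _ sG _ sH x y|r G c1 _ _ sG x y|G H c1 c2 cG sG cH sH x y /=].
- by rewrite rip0l rip0r.
- by rewrite ripDl ripDr sG sH.
- by rewrite ripZl ripZr sG.
- by rewrite sG sH (cone_comm2 cH cG).
Qed.

Lemma cone_bound F c : cone E F c -> forall x, n2 (F x) <= c ^+ 2 * n2 x.
Proof.
elim=> [x|x|G H c1 c2 cG bG cH bH x|r G c1 r0 _ bG x|G H c1 c2 cG bG cH bH x /=].
- by rewrite expr1n mul1r.
- by rewrite rip0l expr0n mul0r.
- have c10 := cone_ge0 cG; have c20 := cone_ge0 cH.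
  rewrite n2D.
  have h : rip (G x) (H x) <= c1 * c2 * n2 x.
    apply: le_trans (ler_norm _) _.
    rewrite -(@ler_pXn2r _ 2) ?nnegrE ?mulr_ge0 ?rip_ge0 // real_normK ?num_real //.
    apply: le_trans (rip_CS _ _) _.
    have -> : (c1 * c2 * n2 x) ^+ 2 = (c1 ^+ 2 * n2 x) * (c2 ^+ 2 * n2 x) by ring.
    by apply: ler_pM; rewrite ?rip_ge0.
  have := bG x; have := bH x; move: h; lra.
- have -> : (r * c1) ^+ 2 * n2 x = r * (r * (c1 ^+ 2 * n2 x)) by ring.
  by rewrite ripZl ripZr; apply: ler_wpM2l => //; apply: ler_wpM2l.
- apply: le_trans (bG (H x)) _; rewrite exprMn -[leRHS]mulrA.
  by apply: ler_wpM2l; rewrite ?sqr_ge0.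
Qed.

(** Its limit [Y] solves [2 Y = E + Y^2], that is [(1 - Y)^2 = 1 - E]. The companion [sq_val] is the
    same recursion at [E = 1]; it increases, stays below 1, and thereby makes the operators
    converge. *)
Fixpoint sq_it (n : nat) : X -> X :=
  if n is m.+1 then fun x => (2^-1 : R)%:C%C *: (E x + (sq_it m \o sq_it m) x)
  else fun=> 0.

Fixpoint sq_val (n : nat) : R :=
  if n is m.+1 then 2^-1 * (1 + sq_val m * sq_val m) else 0.

Lemma sq_it_cone n : cone E (sq_it n) (sq_val n).
Proof.
elim: n => [|n IH] /=; first exact: cone_zero.
apply: cone_scale; first by rewrite invr_ge0.
by apply: cone_add; [exact: cone_id|exact: cone_comp].
Qed.

(** The squares of consecutive iterates differ by the increment times their sum, since all of them
    commute; hence increments stay in [cone], with the differences of [sq_val] as bounds. *)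
Lemma sq_it_step n : exists2 D, cone E D (sq_val n.+1 - sq_val n) &
  forall x, sq_it n.+1 x = sq_it n x + D x.
Proof.
have h2 : (0 : R) <= 2^-1 by rewrite invr_ge0.
elim: n => [|n [D cD hD]].
  exists (fun x => (2^-1 : R)%:C%C *: (E x + 0)).
    rewrite (_ : _ - _ = 2^-1 * (1 + 0)); last by rewrite /= mul0r subr0.
    by apply: cone_scale => //; apply: cone_add; [exact: cone_id|exact: cone_zero].
  by move=> x /=; rewrite add0r.
have lY := cone_linear (sq_it_cone n); have lD := cone_linear cD.
have cY := sq_it_cone n; have cY1 := sq_it_cone n.+1.
exists (fun x => (2^-1 : R)%:C%C *: ((D \o sq_it n.+1) x + (D \o sq_it n) x)).
  rewrite (_ : _ - _ = 2^-1 * ((sq_val n.+1 - sq_val n) * sq_val n.+1 +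
      (sq_val n.+1 - sq_val n) * sq_val n)); last by rewrite /=; field.
  by apply: cone_scale => //; apply: cone_add; apply: cone_comp.
move=> x.
change ((2^-1 : R)%:C%C *: (E x + sq_it n.+1 (sq_it n.+1 x)) =
  (2^-1 : R)%:C%C *: (E x + sq_it n (sq_it n x)) +
  (2^-1 : R)%:C%C *: (D (sq_it n.+1 x) + D (sq_it n x))).
rewrite -scalerDr; congr (_ *: _); rewrite -addrA; congr (_ + _).
rewrite [LHS]hD (cone_comm2 cY cY1) [sq_it n.+1 (sq_it n x)]hD.
by rewrite addrAC addrA.
Qed.

Lemma sq_val_le n : sq_val n <= sq_val n.+1.
Proof. by have [D /cone_ge0] := sq_it_step n; rewrite subr_ge0. Qed.

Lemma sq_val_le1 n : sq_val n <= 1.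
Proof.
elim: n => [|n IH] /=; first exact: ler01.
have h0 := cone_ge0 (sq_it_cone n).
have : sq_val n * sq_val n <= 1 by rewrite -[leRHS]mulr1; apply: ler_pM.
lra.
Qed.

Lemma sq_it_diff m n : (n <= m)%N -> forall x,
  n2 (sq_it m x - sq_it n x) <=
    (sq_val m - sq_val n) ^+ 2 * n2 x.
Proof.
move=> nm; suff [D cD hD] : exists2 D, cone E D (sq_val m - sq_val n) &
    forall x, sq_it m x = sq_it n x + D x.
  by move=> x; rewrite hD addrAC subrr add0r; exact: cone_bound.
rewrite -(subnK nm); elim: (m - n)%N => [|k [D cD hD]].
  by rewrite add0n subrr; exists (fun=> 0) => [|x]; [exact: cone_zero|rewrite addr0].
have [D1 cD1 hD1] := sq_it_step (k + n).
exists (fun x => D x + D1 x) => [|x]; last by rewrite addSn hD1 hD addrA.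
rewrite (_ : _ - _ = (sq_val (k + n) - sq_val n) + (sq_val (k + n).+1 - sq_val (k + n))).
  exact: cone_add.
by rewrite addSn; ring.
Qed.

Lemma sq_val_cauchy (e : R) : 0 < e ->
  exists N, forall m n, (N <= m)%N -> (N <= n)%N -> `|sq_val m - sq_val n| <= e.
Proof.
move=> e0.
have /cvg_ex[l hl] : cvgn sq_val.
  apply: nondecreasing_is_cvgn.
    by apply/nondecreasing_seqP => n; exact: sq_val_le.
  by exists 1 => _ [n _ <-]; exact: sq_val_le1.
have e2 : 0 < e / 2 by rewrite divr_gt0.
move/cvgrPdist_le : hl => /(_ _ e2)[N _ hN]; exists N => m n hm hn.
have := hN m hm; have := hN n hn => /= h1 h2.
have -> : sq_val m - sq_val n = (l - sq_val n) - (l - sq_val m) by ring.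
by apply: le_trans (ler_normB _ _) _; lra.
Qed.

Lemma sq_it_lim : exists Y : X -> X, forall x, (fun n => sq_it n x) @ \oo --> Y x.
Proof.
suff h (x : X) : exists y : X, (fun n => sq_it n x) @ \oo --> y.
  by have [Y hY] := choice h; exists Y.
apply: cauchy_n2 => e e0.
have e1 : 0 < Num.sqrt (e / (n2 x + 1)).
  by rewrite sqrtr_gt0 divr_gt0 // ltr_wpDl ?rip_ge0.
have [N hN] := sq_val_cauchy e1; exists N => m n hm hn.
have key : `|sq_val m - sq_val n| ^+ 2 * n2 x <= e.
  have := hN _ _ hm hn; rewrite -(@ler_pXn2r _ 2) ?nnegrE ?sqrtr_ge0 // sqr_sqrtr; last first.
    by rewrite divr_ge0 ?(ltW e0) // addr_ge0 ?rip_ge0.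
  move=> /(ler_wpM2r (rip_ge0 x)) /le_trans; apply.
  rewrite mulrAC ler_pdivrMr ?ltr_wpDl ?rip_ge0 //.
  by rewrite ler_wpM2l ?(ltW e0) // lerDl.
rewrite real_normK ?num_real // in key.
have [nm|mn] := leqP n m; first exact: le_trans (sq_it_diff nm x) key.
rewrite n2BC; apply: le_trans (sq_it_diff (ltnW mn) x) _.
by rewrite -sqrrN opprB.
Qed.

End Cone.

(** Take [E = 1 - T] and [P = 1 - Y]. A bounded operator that commutes with [T] commutes with the
    iterates, which are polynomials in [E], hence with [P]; this clause allows roots of different
    operators to be combined. *)
Lemma bounded_sqrt T : linear T -> symop T ->
  (forall x, 0 <= rip (T x) x) -> (forall x, rip (T x) x <= n2 x) ->
  exists P : X -> X, [/\ linear P, symop P,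
    forall x, 0 <= rip (P x) x <= n2 x, forall x, P (P x) = T x
  & forall K (M : R), linear K -> (forall x, n2 (K x) <= M * n2 x) ->
      (forall x, K (T x) = T (K x)) -> forall x, K (P x) = P (K x)].
Proof.
move=> lT sT T0 T1.
pose E x := x - T x.
have lE : linear E by move=> a x y; rewrite /E lT scalerBr opprD addrACA.
have sE : symop E by move=> x y; rewrite /E ripBl ripBr sT.
have E1 : forall x, n2 (E x) <= n2 x.
  apply: symop_contr => // x; rewrite /E ripBl.
    by rewrite subr_ge0.
  by rewrite gerBl.
have [Y hY] := sq_it_lim lE E1.
have lY : linear Y.
  move=> a x y; apply: (cvg_uniq (hY _)).
  rewrite (_ : (fun n => _) = (fun n => a *: sq_it E n x + sq_it E n y)); last first.
    by apply/funext => n; exact: (cone_linear lE (sq_it_cone E n)).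
  by apply: cvgD => //; apply: cvgZr; exact: hY.
have sY : symop Y.
  move=> x y; have h1 := cvg_ripl (y := y) (hY x).
  suff h2 : (fun n => rip (sq_it E n x) y) @ \oo --> rip x (Y y).
    by rewrite (cvg_unique _ h1 h2).
  rewrite ripC (_ : (fun n => _) = (fun n => rip (sq_it E n y) x)); first exact: cvg_ripl.
  by apply/funext => n; rewrite (cone_sym lE sE (sq_it_cone E n)) ripC.
have bnd n x : n2 (sq_it E n x) <= n2 x.
  apply: le_trans (cone_bound E1 (sq_it_cone E n) x) _.
  rewrite -[leRHS]mul1r ler_wpM2r ?rip_ge0 // expr_le1 ?sq_val_le1 //.
  exact: cone_ge0 (sq_it_cone E n).
have Y1 x : n2 (Y x) <= n2 x.
  have h2 : (fun _ : nat => n2 x) @ \oo --> n2 x by exact: cvg_cst.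
  apply: (ler_cvg_to (cvg_n2 (hY x)) h2).
  by near=> n; exact: bnd.
have YY x : Y x = (2^-1 : R)%:C%C *: (E x + Y (Y x)).
  apply: (cvg_uniq (u := fun n => sq_it E n.+1 x)).
    by rewrite (cvg_shiftS (fun n => sq_it E n x)); exact: hY.
  apply: cvgZr; apply: cvgD; first exact: cvg_cst.
  apply/cvg_n2P; apply: (@small_le _ _ (fun n => 2 * n2 (sq_it E n x - Y x) +
    2 * n2 (sq_it E n (Y x) - Y (Y x)))).
    move=> n; apply: le_trans (n2_tri _ (sq_it E n (Y x)) _) _.
    rewrite lerD2r; apply: ler_wpM2l => //.
    by rewrite -(linopB (cone_linear lE (sq_it_cone E n))); exact: bnd.
  by apply: smallD; apply: smallZ => //; apply/cvg_n2P; exact: hY.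
have YY2 x : Y (Y x) = Y x + Y x - E x.
  have := congr1 (fun z => (2 : R)%:C%C *: z) (YY x).
  rewrite /= scalerA -rmorphM mulfV ?pnatr_eq0 // scale1r.
  rewrite (_ : (2 : R) = 1 + 1) // rmorphD scalerDl scale1r => ->.
  by rewrite addrAC subrr add0r.
have lP : linear (fun x => x - Y x).
  by move=> a x y; rewrite lY scalerBr opprD addrACA.
have sP : symop (fun x => x - Y x) by move=> x y; rewrite ripBl ripBr sY.
have PP x : x - Y x - Y (x - Y x) = T x.
  rewrite linopB // YY2 /E opprB [_ + _ - _ - _]addrAC addrK addrA subrK.
  exact: subKr.
exists (fun x => x - Y x); split => //.
- move=> x; apply/andP; split.
    by rewrite ripBl; have := rip_le (Y x) x; have := Y1 x; lra.
  have := rip_le (x - Y x) x; have := sP x (x - Y x); rewrite /= PP => ->.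
  by have := T1 x; rewrite (ripC x (T x)); lra.
- move=> K M lK KM KT x; rewrite linopB //; congr (_ - _).
  have KE z : K (E z) = E (K z) by rewrite /E linopB // KT.
  apply: (cvg_uniq (bop_cvg lK KM (hY x))).
  rewrite (_ : _ \o _ = (fun n => sq_it E n (K x))); first exact: hY.
  by apply/funext => n /=; rewrite (cone_comm lK KE (sq_it_cone E n)).
Unshelve. all: by end_near.
Qed.

End Sqrt.
End BoundedOperators.

(** * Unbounded selfadjoint operators *)

Section Graphs.
Variables (R : realType).

Section Operator.
Variables (X Y : hilbertType R) (G : set (X * Y)).
Hypothesis oG : is_operator G.

Lemma op_subspace : subspace G.
Proof. by have [h1 h2 _] := oG; split => // a [x1 x2] [y1 y2] h h'; exact: (h2 a (x1, x2)). Qed.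

Lemma op0 : G (0, 0). Proof. by case: oG. Qed.

Lemma opL (a : R[i]) x s y t : G (x, s) -> G (y, t) -> G (a *: x + y, a *: s + t).
Proof. by have [_ h _] := oG; exact: h. Qed.

Lemma opZ (a : R[i]) x s : G (x, s) -> G (a *: x, a *: s).
Proof. by move=> h; have := opL a h op0; rewrite !addr0. Qed.

Lemma opD x s y t : G (x, s) -> G (y, t) -> G (x + y, s + t).
Proof. by move=> h h'; have := opL 1 h h'; rewrite !scale1r. Qed.

Lemma opB x s y t : G (x, s) -> G (y, t) -> G (x - y, s - t).
Proof. by move=> h h'; have := opL (-1) h' h; rewrite !scaleN1r !(addrC (- _)). Qed.

Lemma op_fun x s t : G (x, s) -> G (x, t) -> s = t.
Proof. by have [_ _ h] := oG; exact: h. Qed.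

Lemma appE x s : G (x, s) -> app G x = s.
Proof.
move=> h; rewrite /app; case: xgetP => [y -> h'|/(_ s)//].
exact: op_fun h' h.
Qed.

Lemma appP x : dom G x -> G (x, app G x).
Proof. by move=> [s h]; rewrite (appE h). Qed.

Lemma dom_subspace : subspace (dom G).
Proof.
split; first by exists 0; exact: op0.
by move=> a x y [s hs] [t ht]; exists (a *: s + t); exact: opL.
Qed.

Lemma ran_subspace : subspace (ran G).
Proof.
split; first by exists 0; exact: op0.
by move=> a x y [s hs] [t ht]; exists (a *: s + t); exact: opL.
Qed.

(** A graph is stable under multiplication by ['i], so the identity of real parts implies that of
    the inner products. *)
Lemma op_adjP q : op_adj G q <-> forall x s, G (x, s) -> rip s q.1 = rip x q.2.
Proof.
split=> [h x s /h /= e|h [x s] Gxs /=]; first by rewrite /rip e.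
have Gi := opZ 'i%C Gxs.
rewrite !innerE (h _ _ Gxs); congr Complex.
by apply: oppr_inj; rewrite -!ripil (h _ _ Gi).
Qed.

End Operator.

Lemma op_inv_operator (X Y : hilbertType R) (G : set (X * Y)) : is_operator G ->
  (forall x, G (x, 0) -> x = 0) -> is_operator (op_inv G).
Proof.
move=> oG inj; split.
- exact: op0 oG.
- by move=> a [x s] [y t]; exact: (opL oG).
- move=> x s t /= h h'; apply/subr0_eq/inj.
  by have := opB oG h h'; rewrite subrr.
Qed.

Lemma graph_operator (X Y : hilbertType R) (f : X -> Y) :
  linear f -> is_operator (graph f).
Proof.
move=> lf; split; rewrite /graph /=.
- by rewrite linop0.
- by move=> a p q -> ->; rewrite lf.
- by move=> x y y' -> ->.
Qed.

Section Adjoint.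
Variables (X Y : hilbertType R) (f : X -> Y).
Hypothesis bf : bounded_op f.

(** Riesz supplies a point of the graph of the adjoint, so the default value in [app] is never
    reached. *)
Lemma adj_rip x y : rip (f x) y = rip x (adj f y).
Proof.
have [lf [M M0 hM]] := (bounded_opP f).1 bf.
have [|||||g [_ hg _]] := @riesz_range R X X setT idfun (fun x => rip (f x) y) (M * n2 y).
- by [].
- by [].
- by split => [z t _ _|r z _]; rewrite ?linopD ?linopZ ?ripDl ?ripZl.
- by rewrite mulr_ge0 ?rip_ge0.
- move=> z _; apply: le_trans (rip_CS _ _) _.
  by rewrite mulrAC ler_wpM2r ?rip_ge0.
have oG := graph_operator lf.
have h : op_adj (graph f) (y, g).
  by apply/op_adjP => // z s e; rewrite (e : s = f z); exact: hg.
rewrite /adj /app; case: xgetP => [z -> h'|/(_ g)//].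
by have := (op_adjP oG _).1 h' x (f x) erefl.
Qed.

Lemma adj_linear : linear (adj f).
Proof.
have [lf _] := (bounded_opP f).1 bf.
move=> a y z; apply: eq_rip => x.
rewrite -adj_rip ripDr ripDr -!adj_rip; congr (_ + _).
by rewrite (complex_ReIm a y) (complex_ReIm a (adj f y)) !ripDr !ripZr -!adj_rip
  -[in RHS](opprK (rip x _)) -ripil -adj_rip linopZ // ripil opprK.
Qed.

End Adjoint.

End Graphs.

Section SelfAdjoint.
Variables (R : realType) (X : hilbertType R).
Implicit Types (S : set (X * X)) (x y s : X).

Lemma selfadjointP S : selfadjoint S <->
  [/\ is_operator S, dense (dom S)
    & forall y t, S (y, t) <-> forall x s, S (x, s) -> rip s y = rip x t].
Proof.
split=> [[oS dS eS]|[oS dS h]]; split => //.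
  by move=> y t; rewrite -{1}eS; exact: (op_adjP oS (y, t)).
apply/seteqP; split=> [[y t] /(op_adjP oS) hyt|[y t] /h hyt].
  exact/h.
exact/(op_adjP oS).
Qed.

Section SelfAdjointTheory.
Variable S : set (X * X).
Hypothesis sS : selfadjoint S.

Lemma sa_op : is_operator S. Proof. by case: sS. Qed.

Lemma sa_dense : dense (dom S). Proof. by case: sS. Qed.

Lemma sa_rip x s y t : S (x, s) -> S (y, t) -> rip s y = rip x t.
Proof. by move=> h1 h2; have /selfadjointP[_ _ h] := sS; exact: (h y t).1. Qed.

Lemma sa_intro y t : (forall x s, S (x, s) -> rip s y = rip x t) -> S (y, t).
Proof. by move=> h1; have /selfadjointP[_ _ h] := sS; exact/h. Qed.

Lemma sa_closed (u v : nat -> X) x s : (forall n, S (u n, v n)) ->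
  u @ \oo --> x -> v @ \oo --> s -> S (x, s).
Proof.
move=> h hu hv; apply: sa_intro => y t Syt.
have h1 := cvg_ripl (y := t) hu; have h2 := cvg_ripl (y := y) hv.
have e : (fun n => rip (u n) t) = (fun n => rip (v n) y).
  by apply/funext => n; rewrite (sa_rip (h n) Syt).
by rewrite e in h1; rewrite (ripC t) (ripC y); exact: (cvg_unique _ h1 h2).
Qed.

Lemma sa_ran_dense : (forall x, S (x, 0) -> x = 0) -> dense (ran S).
Proof.
move=> inj; apply: dense_subspaceP; first exact: ran_subspace sa_op.
move=> y hy; apply: inj; apply: sa_intro => x s Sxs.
by rewrite rip0r hy //; exists x.
Qed.

Lemma sa_inv : (forall x, S (x, 0) -> x = 0) -> selfadjoint (op_inv S).
Proof.
move=> inj; apply/selfadjointP; split.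
- exact: op_inv_operator sa_op inj.
- exact: sa_ran_dense.
- move=> y t; split=> [h x s h'|h].
    by rewrite ripC (sa_rip h h') ripC.
  apply: sa_intro => x s Sxs; by rewrite -(h s x).
Qed.

(** Being nonnegative in [R[i]] includes having no imaginary part; symmetry gives this when [(x, s)]
    is paired with its multiple by ['i]. *)
Lemma sa_nonneg : (forall x s, S (x, s) -> 0 <= rip s x) -> nonneg_op S.
Proof.
move=> h x s Sxs; have := h _ _ Sxs.
rewrite innerE lecE /= => ->; rewrite andbT.
have := sa_rip Sxs (opZ sa_op 'i%C Sxs); rewrite (ripC x) ripil => e.
by apply/eqP; move: e; lra.
Qed.

Lemma nonneg_rip : nonneg_op S -> forall x s, S (x, s) -> 0 <= rip s x.
Proof. by move=> h x s /h; rewrite innerE lecE /= => /andP[]. Qed.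

End SelfAdjointTheory.

Lemma sa_graph (T : X -> X) : linear T -> symop T -> selfadjoint (graph T).
Proof.
move=> lT sT; apply/selfadjointP; split; first exact: graph_operator.
  by apply/dense_n2P => x e e0; exists x; [exists (T x)|rewrite subrr rip0l ltW].
move=> y t; split=> [e x s e'|h].
  by rewrite (e : t = T y) (e' : s = T x); exact: sT.
by apply: eq_rip => z; rewrite -(h z (T z)) // sT.
Qed.

Section Normalized.
Variables Q G : X -> X.
Hypotheses (lQ : linear Q) (sQ : symop Q) (lG : linear G) (sG : symop G).
Hypotheses (QG : forall x, Q (G x) = G (Q x)) (iQ : forall x, Q x = 0 -> x = 0).
Hypothesis QQGG : forall x, Q (Q x) + G (G x) = x.

Lemma sym_ran_dense : dense (range Q).
Proof.
apply: dense_subspaceP.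
  split; first by exists 0 => //; rewrite linop0.
  by move=> a _ _ [x _ <-] [y _ <-]; exists (a *: x + y) => //; rewrite lQ.
move=> y hy; apply: iQ; apply: eq_rip => z; rewrite rip0r -sQ; apply: hy.
by exists z.
Qed.

(** This is the graph of [G Q^-1], parametrized without division. If [(y, t)] satisfies the adjoint
    relation then [G y = Q t], and [Q^2 + G^2 = 1] exhibits [Q y + G t] as its parameter. *)
Lemma sa_normalized : selfadjoint [set p | exists x, p = (Q x, G x)].
Proof.
apply/selfadjointP; split.
- split.
  + by exists 0; rewrite !linop0.
  + move=> a _ _ [x ->] [y ->]; exists (a *: x + y).
    by rewrite lQ lG.
  + move=> _ _ y' [x [-> ->]] [z [e ->]]; congr (G _).
    by apply/subr0_eq/iQ; rewrite linopB // e subrr.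
- have dQ := sym_ran_dense; apply/dense_n2P => x e e0.
  have /dense_n2P/(_ x e e0)[_ [y _ <-] h] := dQ.
  by exists (Q y) => //; exists (G y), y.
- move=> y t; split.
    by move=> [z [-> ->]] _ _ [x [-> ->]]; rewrite !sG sQ QG.
  move=> h; exists (Q y + G t).
  have e : G y = Q t.
    by apply: eq_rip => x; rewrite -sG (h (Q x) (G x)) ?sQ //; exists x.
  by rewrite !linopD // (QG t) -e QQGG -(QG y) e QQGG.
Qed.

End Normalized.

(** * Selfadjoint operators defined by closed forms *)

Section FormOperator.
Variables (D : set X) (t : X -> X -> R) (V : set X).
Hypothesis ft : sform D t.
Hypothesis ti : forall x y, D x -> D y -> t ('i%C *: x) ('i%C *: y) = t x y.
Hypothesis t_closed : forall (u : nat -> X) x, (forall n, D (u n)) ->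
  u @ \oo --> x ->
  (forall e : R, 0 < e -> exists N, forall m n, (N <= m)%N -> (N <= n)%N ->
     t (u m - u n) (u m - u n) <= e) ->
  D x /\ small (fun n => t (u n - x) (u n - x)).
Hypotheses (sV : subspace V) (VD : V `<=` D) (dV : dense V).

Let sD := sf_sub ft.
Let b x y : R := rip x y + t x y.

Let fb : sform D b.
Proof.
split => //.
- by move=> x y Dx Dy; rewrite /b ripC (sf_sym ft).
- by move=> x y z Dx Dy Dz; rewrite /b ripDl (sf_add ft) //; ring.
- by move=> r x y Dx Dy; rewrite /b ripZl (sf_scale ft) //; ring.
- by move=> x Dx; rewrite /b addr_ge0 ?rip_ge0 // (sf_ge0 ft).
Qed.

Let fbV : sform V b.
Proof.
split => //.
- by move=> x y Vx Vy; apply: (sf_sym fb); exact: VD.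
- by move=> x y z Vx Vy Vz; apply: (sf_add fb); exact: VD.
- by move=> r x y Vx Vy; apply: (sf_scale fb); exact: VD.
- by move=> x Vx; apply: (sf_ge0 fb); exact: VD.
Qed.

(** The closure of [V] in the form norm. Restricting the form from [D] to [W] is what makes [V] a
    core of the operator. *)
Let W := [set x | D x /\ forall e : R, 0 < e -> exists2 v, V v & b (v - x) (v - x) <= e].

Let WD x : W x -> D x. Proof. by case. Qed.

Let VW x : V x -> W x.
Proof.
move=> Vx; split=> [|e e0]; first exact: VD.
by exists x => //; rewrite subrr (sf_00 fb) ltW.
Qed.

Lemma sf_small_ripl (u : nat -> X) x y (c : X -> X -> R) : sform D c ->
  (forall n, D (u n)) -> D x -> D y ->
  small (fun n => c (u n - x) (u n - x)) -> (fun n => c (u n) y) @ \oo --> c x y.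
Proof.
move=> fc Du Dx Dy h; apply/cvgrPdist_le => e e0.
have y0 := sf_ge0 fc Dy.
have e1 : 0 < e ^+ 2 / (c y y + 1) by rewrite divr_gt0 ?exprn_gt0 // ltr_wpDl.
have [N hN] := h _ e1; exists N => // n /hN hn /=.
have -> : c x y - c (u n) y = - c (u n - x) y.
  by rewrite (sf_add fc) ?(sf_opp fc) //; [ring|exact: (subspaceN sD)].
rewrite normrN -(@ler_pXn2r _ 2) ?nnegrE ?normr_ge0 ?(ltW e0) // real_normK ?num_real //.
apply: le_trans (sf_CS fc (subspaceB sD (Du n) Dx) Dy) _.
apply: le_trans (ler_wpM2r y0 hn) _.
rewrite mulrAC ler_pdivrMr ?ltr_wpDl //.
by rewrite ler_wpM2l ?sqr_ge0 // lerDl.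
Qed.

Lemma sf_small_sqr (u : nat -> X) x : (forall n, D (u n)) -> D x ->
  small (fun n => t (u n - x) (u n - x)) -> (fun n => t (u n) (u n)) @ \oo --> t x x.
Proof.
move=> Du Dx h; have h1 := sf_small_ripl ft Du Dx Dx h.
have -> : (fun n => t (u n) (u n)) =
    (fun n => t (u n - x) (u n - x) + (2 * t (u n) x - t x x)).
  by apply/funext => n; rewrite (sf_sqrB ft) //; ring.
suff : (fun n => t (u n - x) (u n - x) + (2 * t (u n) x - t x x)) @ \oo -->
    0 + (2 * t x x - t x x).
  by rewrite (_ : 0 + _ = t x x) //; ring.
apply: cvgD.
  by apply/small_cvg => // n; apply: (sf_ge0 ft); exact: (subspaceB sD).
by apply: cvgB; [apply: cvgM => //; exact: cvg_cst|exact: cvg_cst].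
Qed.

Let sW : subspace W.
Proof.
split; first by apply: VW; exact: sV.1.
move=> a x y [Dx hx] [Dy hy]; split; first exact: sD.2.
move=> e e0.
pose c := complex.Re a ^+ 2 + complex.Im a ^+ 2.
have c0 : 0 <= c by rewrite addr_ge0 ?sqr_ge0.
have e1 : 0 < e / (8 * c + 4).
  by rewrite divr_gt0 // ltr_wpDl // mulr_ge0.
have e2 : 0 < e / 4 by rewrite divr_gt0.
have [v Vv hv] := hx _ e1; have [w Vw hw] := hy _ e2.
exists (a *: v + w); first exact: sV.2.
have Dv := VD Vv; have Dw := VD Vw.
have Dvx := subspaceB sD Dv Dx; have Dwy := subspaceB sD Dw Dy.
have -> : a *: v + w - (a *: x + y) = a *: (v - x) + (w - y).
  by rewrite scalerBr opprD addrACA.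
have Daz : D (a *: (v - x)) by exact: subspaceZ.
apply: le_trans (sf_sqrD_le fb Daz Dwy) _.
have : b (a *: (v - x)) (a *: (v - x)) <= 2 * c * b (v - x) (v - x).
  have Di : D ('i%C *: (v - x)) by exact: subspaceZ.
  rewrite (complex_ReIm a (v - x)).
  apply: le_trans (sf_sqrD_le fb _ _) _; try exact: subspaceZ.
  rewrite !(sf_sqrZ fb) //.
  have -> : b ('i%C *: (v - x)) ('i%C *: (v - x)) = b (v - x) (v - x).
    by rewrite /b ripi ti.
  by rewrite /c; lra.
have : 2 * c * b (v - x) (v - x) <= e / 4.
  apply: le_trans (ler_wpM2l _ hv) _; first by rewrite mulr_ge0.
  rewrite mulrA ler_pdivrMr; last by rewrite ltr_wpDl // mulr_ge0.
  by rewrite -subr_ge0 (_ : e / 4 * (8 * c + 4) - 2 * c * e = e); [exact: ltW|field].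
by move: hw; lra.
Qed.

Let riesz_form f : exists w, W w /\ forall x, W x -> rip x f = b x w.
Proof.
have [|||w [Vw wc wf]] := @riesz_seq R X V b fbV (fun x => rip x f) (n2 f).
- by split => [x y _ _|r x _]; rewrite ?ripDl ?ripZl.
- exact: rip_ge0.
- move=> x Vx; apply: le_trans (rip_CS _ _) _; rewrite mulrC ler_wpM2l ?rip_ge0 //.
  by rewrite /b lerDl (sf_ge0 ft) //; exact: VD.
have wcau (e : R) : 0 < e -> exists N, forall m n, (N <= m)%N -> (N <= n)%N ->
    b (w m - w n) (w m - w n) <= e.
  move=> e0; have e4 : 0 < e / 4 by rewrite divr_gt0.
  have [N hN] := @small_inv R _ e4; exists N => m n /hN hm /hN hn.
  apply: le_trans (wc m n) _; move: hm hn.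
  move: (m.+1%:R^-1) (n.+1%:R^-1) => d d'; lra.
have [|x wx] := @cauchy_n2 R X w.
  move=> e /wcau[N hN]; exists N => m n hm hn; apply: le_trans (hN _ _ hm hn).
  by rewrite /b lerDl (sf_ge0 ft) //; apply: (subspaceB sD); exact: VD.
have Dw n : D (w n) by exact: VD.
have [|Dx tx] := t_closed Dw wx.
  move=> e /wcau[N hN]; exists N => m n hm hn; apply: le_trans (hN _ _ hm hn).
  by rewrite /b lerDr rip_ge0.
have bx : small (fun n => b (w n - x) (w n - x)).
  by apply: smallD => //; exact/cvg_n2P.
have Wx : W x.
  split => // e /bx[N hN]; exists (w N) => //; exact: hN.
exists x; split => //.
have hV v : V v -> rip v f = b v x.
  move=> Vv; have b0 := sf_ge0 fbV Vv.
  have h1 := sqr_cvg b0 (fun n => wf v n Vv).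
  have h2 := sf_small_ripl fb Dw Dx (VD Vv) bx.
  by rewrite -(sf_sym fb Dx (VD Vv)); exact: (cvg_unique _ h1 h2).
(* Both sides are continuous for the form norm, so the identity passes from [V] to [W]. *)
move=> y [Dy hy].
have b0 := sf_ge0 fb Dx.
apply/eqP; rewrite -subr_eq0 -sqrf_eq0 eq_le sqr_ge0 andbT.
apply: (@small0 R _ (fun n => (2 * n2 f + 2 * b x x) * n.+1%:R^-1)).
  by apply: smallZ; [rewrite addr_ge0 ?mulr_ge0 ?rip_ge0|exact: small_inv].
move=> n; have [|v Vv hv] := hy n.+1%:R^-1; first by rewrite invr_gt0.
have Dv := VD Vv; have Dvy := subspaceB sD Dv Dy.
have -> : rip y f - b y x = b (v - y) x - rip (v - y) f.
  have e : b (v - y) x = b v x - b y x.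
    have DNy := subspaceN sD Dy.
    by rewrite (sf_add fb) // (sf_opp fb).
  by rewrite e ripBl (hV v) //; ring.
have h1 := sf_CS fb Dvy Dx.
have h2 := rip_CS (v - y) f.
have h3 : n2 (v - y) <= b (v - y) (v - y) by rewrite /b lerDl (sf_ge0 ft).
have h4 := ler_wpM2r (rip_ge0 f) h3.
have h5 := ler_wpM2l b0 hv.
have h6 := ler_wpM2l (rip_ge0 f) hv.
have := sqr_ge0 (b (v - y) x + rip (v - y) f).
move: h1 h2 h4 h5 h6; move: (n.+1%:R^-1) => d.
lra.
Qed.


(** The representation theorem for closed forms. Riesz for [b = rip + t] on [W] gives a contraction
    [T], which is to be [(1 + S^2)^-1]; with [Q = T^(1/2)] and [G = (1 - T)^(1/2)] the operator is
    [S = G Q^-1]. Its domain is the range of [Q], and the proof identifies this range with [W]. *)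
Lemma form_operator : exists S, [/\ selfadjoint S, nonneg_op S,
    forall x, V x -> dom S x, forall x s, S (x, s) -> D x /\ n2 s = t x x
  & forall x s (e : R), S (x, s) -> 0 < e -> exists v r, [/\ V v, S (v, r),
      n2 (v - x) <= e & n2 (r - s) <= e]].
Proof.
have [T hT] := choice riesz_form.
have TW f : W (T f) by have [] := hT f.
have TD f : D (T f) by exact: WD.
have Tb f x : W x -> rip x f = b x (T f) by have [_ h] := hT f; exact: h.
have Wuniq f w : W w -> (forall x, W x -> rip x f = b x w) -> w = T f.
  move=> Ww h; apply/eqP; rewrite -subr_eq0 -rip_eq0 eq_le rip_ge0 andbT.
  have Wd : W (w - T f) by exact: (subspaceB sW).
  have : b (w - T f) (w - T f) = 0.
    have WN : W (- T f) by exact: (subspaceN sW).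
    rewrite (sf_addr fb (WD Ww) (WD WN) (WD Wd)) (sf_oppr fb (WD Wd) (TD f)).
    by rewrite -Tb // -h // subrr.
  by move=> <-; rewrite /b lerDl (sf_ge0 ft) //; exact: WD.
(* Invariance of [t] under ['i] enters here; it makes [T] complex linear although the forms are
   real. *)
have bi x w : D x -> D w -> b x ('i%C *: w) = - b ('i%C *: x) w.
  move=> Dx Dw; have Dix : D ('i%C *: x) by exact: (subspaceZ sD).
  have Diw : D ('i%C *: w) by exact: (subspaceZ sD).
  rewrite /b ripil -(ti Dix Dw) scaleii (sf_opp ft) //; ring.
have lT : linear T.
  move=> a f g; apply/esym; apply: Wuniq; first exact: sW.2.
  move=> x Wx; have Dx := WD Wx.
  have Wix : W ('i%C *: x) by exact: (subspaceZ sW).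
  have Dif : D ('i%C *: T f) by exact: (subspaceZ sD).
  rewrite !(complex_ReIm a) !ripDr !ripZr !(sf_addr fb) ?(sf_scaler fb) //;
    try by repeat first [apply: (subspaceD sD)|apply: (subspaceZ sD)|exact: TD].
  rewrite bi // -!Tb // ripil opprK //.
have sT : symop T.
  by move=> f g; rewrite (Tb g) // (ripC f) (Tb f) // (sf_sym fb).
have Tff f : rip (T f) f = n2 (T f) + t (T f) (T f) by rewrite Tb.
have T0 f : 0 <= rip (T f) f.
  by rewrite Tff addr_ge0 ?rip_ge0 // (sf_ge0 ft).
have T1 f : rip (T f) f <= n2 f.
  by have := rip_le (T f) f; have := sf_ge0 ft (TD f); have := Tff f; lra.
have iT f : T f = 0 -> f = 0.
  move=> Tf0; apply: (dense_perp0 dV) => v Vv.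
  rewrite Tb ?Tf0; last exact: VW.
  by rewrite -(scale0r (0 : X)) (sf_scaler fb 0 (VD Vv) sD.1) mul0r.
have [Q [lQ sQ Q01 QQ Qc]] := bounded_sqrt lT sT T0 T1.
have lU : linear (fun x => x - T x).
  by move=> a x y; rewrite lT scalerBr opprD addrACA.
have sU : symop (fun x => x - T x) by move=> x y; rewrite ripBl ripBr sT.
have U0 x : 0 <= rip (x - T x) x by rewrite ripBl subr_ge0.
have U1 x : rip (x - T x) x <= n2 x by rewrite ripBl gerBl.
have [G [lG sG G01 GG Gc]] := bounded_sqrt lU sU U0 U1.
have Qn x : n2 (Q x) = rip (T x) x by rewrite sQ QQ ripC.
have Gn x : n2 (G x) = n2 x - rip (T x) x by rewrite sG GG ripBr (ripC x (T x)).
have Q1 x : n2 (Q x) <= 1 * n2 x by rewrite Qn mul1r.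
have G1 x : n2 (G x) <= 1 * n2 x by rewrite Gn mul1r gerBl.
have QT x : Q (T x) = T (Q x) by rewrite -!QQ.
have QG x : Q (G x) = G (Q x).
  by apply: (Gc Q 1) => // z; rewrite linopB // QT.
have iQ x : Q x = 0 -> x = 0 by move=> h; apply: iT; rewrite -QQ h linop0.
have QQGG x : Q (Q x) + G (G x) = x by rewrite QQ GG addrC subrK.
have Qle x : rip (Q x) x <= n2 x by have /andP[] := Q01 x.
have Qge x : 0 <= rip (Q x) x by have /andP[] := Q01 x.
(* With [Q = P P] and [P] commuting with [G], [rip (G x) (Q x)] equals [rip (G (P x)) (P x)]; this
   is the positivity of [S]. *)
have [P [lP sP P01 PP Pc]] := bounded_sqrt lQ sQ Qge Qle.
have PG x : G (P x) = P (G x) by apply: (Pc G 1) => // z; rewrite QG.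
have GQ0 x : 0 <= rip (G x) (Q x).
  by rewrite -PP -sP -PG; have /andP[h _] := G01 (P x).
pose S := [set p | exists x, p = (Q x, G x)].
have sS : selfadjoint S by exact: sa_normalized.
have tT f : t (T f) (T f) = n2 (G (Q f)).
  by rewrite Gn Qn -QT [rip (Q (T f)) _]sQ QQ Tff; ring.
(* Approximate [g] by vectors [Q (f n)]: then [T (f n)] tends to [Q g], and it is Cauchy for [t]
   because [t (T f) (T f) = |G (Q f)|^2]. *)
have Qdom g : W (Q g) /\ t (Q g) (Q g) = n2 (G g).
  have /dense_closure/(_ g)/dense_seq[u hu ug] := sym_ran_dense lQ sQ iQ.
  have [f fu] : exists f : nat -> X, forall n, u n = Q (f n).
    have h n : exists y, u n = Q y by have [y _ <-] := hu n; exists y.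
    by have [f hf] := choice h; exists f.
  have xg : (fun n => T (f n)) @ \oo --> Q g.
    have := bop_cvg lQ Q1 ug; rewrite (_ : Q \o u = fun n => T (f n)) //.
    by apply/funext => n; rewrite /= fu QQ.
  have Gg : (fun n => G (u n)) @ \oo --> G g by exact: (bop_cvg lG G1 ug).
  have [||Dg tg] := @t_closed (fun n => T (f n)) (Q g) _ xg.
  - by move=> n; exact: TD.
  - move=> e e0; have e4 : 0 < e / 4 by rewrite divr_gt0.
    have /cvg_n2P/(_ _ e4)[N hN] := ug.
    exists N => m n /hN hm /hN hn.
    rewrite -linopB // tT linopB // -!fu; apply: le_trans (G1 _) _; rewrite mul1r.
    apply: le_trans (n2_tri _ g _) _; rewrite (n2BC g).
    by move: hm hn; lra.
  split.
    split => // e e0; have e4 : 0 < e / 4 by rewrite divr_gt0.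
    have : small (fun n => b (T (f n) - Q g) (T (f n) - Q g)).
      by apply: smallD => //; exact/cvg_n2P.
    move=> /(_ _ e4)[n /(_ n (leqnn _)) hn].
    have [_ /(_ _ e4)[v Vv hv]] := TW (f n); exists v => //.
    apply: le_trans (sf_sqrB_le fb (VD Vv) (TD (f n)) Dg) _.
    by move: hn hv; lra.
  have h1 := sf_small_sqr (fun n => TD (f n)) Dg tg.
  have h2 := cvg_n2 Gg.
  have e : (fun n => t (T (f n)) (T (f n))) = (fun n => n2 (G (u n))).
    by apply/funext => n; rewrite tT fu.
  by rewrite e in h1; exact: (cvg_unique _ h1 h2).
(* Conversely [rip x f = b x (T f)] and [b (T f) (T f) = |Q f|^2], so Riesz on the range of [Q]
   writes [x] as [Q g]. *)
have Wran x : W x -> exists g, x = Q g.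
  move=> Wx.
  have [|||||g [_ hg _]] := @riesz_range R X X setT Q (fun f => rip x f) (b x x).
  - by [].
  - by move=> a y z _ _; exact: lQ.
  - by split => [y z _ _|r y _]; rewrite ?ripDr ?ripZr.
  - exact: sf_ge0 fb _ (WD Wx).
  - move=> f _; rewrite Tb // Qn (Tb f) //.
    exact: (sf_CS fb (WD Wx) (TD f)).
  by exists g; apply: eq_rip => f; rewrite ripC hg // sQ.
exists S; split => //.
- by apply: sa_nonneg => // _ _ [x [-> ->]].
- by move=> x /VW /Wran[g ->]; exists (G g), g.
- by move=> _ _ [g [-> ->]]; have [/WD ? ->] := Qdom g.
- move=> _ _ e [g [-> ->]] e0; have [[Dg hg] tg] := Qdom g.
  have [v Vv hv] := hg _ e0; have [h vh] := Wran _ (VW Vv).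
  have Dvg := subspaceB sD (VD Vv) Dg.
  exists v, (G h); split => //; first by exists h; rewrite vh.
    by apply: le_trans hv; rewrite /b lerDl (sf_ge0 ft).
  have [_] := Qdom (h - g); rewrite !(linopB lG) !(linopB lQ) -vh => <-.
  by apply: le_trans hv; rewrite /b lerDr rip_ge0.
Qed.

End FormOperator.
End SelfAdjoint.

(** * Squares of selfadjoint operators and comparison of their forms *)

Section Squares.
Variables (R : realType) (X : hilbertType R).
Implicit Types (S : set (X * X)) (x y s : X).

Definition gip (p q : X * X) : R := rip p.1 q.1 + rip p.2 q.2.

Lemma sform_gip (P : set (X * X)) : subspace P -> sform P gip.
Proof.
move=> sP; split => //.
- by move=> p q _ _; rewrite /gip ripC (ripC p.2).
- by move=> p q r _ _ _; rewrite /gip /= !ripDl; ring.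
- by move=> r p q _ _; rewrite /gip /= !ripZl; ring.
- by move=> p _; rewrite addr_ge0 ?rip_ge0.
Qed.

Section OneOperator.
Variable S : set (X * X).
Hypothesis sS : selfadjoint S.
Let oS := sa_op sS.

(** [(w, r)] is the orthogonal projection of [(x, s)] on the closure of [P], for the scalar product
    [gip] of [X * X]. *)
Lemma graph_riesz (P : set (X * X)) (x s : X) : subspace P -> P `<=` S ->
  exists u v w r, [/\ forall n : nat, P (u n, v n), u @ \oo --> w, v @ \oo --> r,
    S (w, r)
  & forall y t, P (y, t) -> rip y x + rip t s = rip y w + rip t r].
Proof.
move=> sP PS; have fb := sform_gip sP.
have [|||p [Pp pc pf]] := @riesz_seq R _ P gip fb (fun q => gip q (x, s)) (gip (x, s) (x, s)).
- by split => [q q' _ _|r q _]; rewrite /gip /= ?ripDl ?ripZl; ring.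
- by rewrite addr_ge0 ?rip_ge0.
- have fT : sform setT gip by apply: sform_gip.
  by move=> q _; rewrite mulrC; apply: (sf_CS fT).
have pcau (e : R) : 0 < e -> exists N, forall m n, (N <= m)%N -> (N <= n)%N ->
    gip (p m - p n) (p m - p n) <= e.
  move=> e0; have e4 : 0 < e / 4 by rewrite divr_gt0.
  have [N hN] := @small_inv R _ e4; exists N => m n /hN hm /hN hn.
  apply: le_trans (pc m n) _; move: hm hn.
  move: (m.+1%:R^-1) (n.+1%:R^-1) => d d'; lra.
have [|w hw] := @cauchy_n2 R X (fun n => (p n).1).
  move=> e /pcau[N hN]; exists N => m n hm hn; apply: le_trans (hN _ _ hm hn).
  by rewrite /gip /= lerDl rip_ge0.
have [|r hr] := @cauchy_n2 R X (fun n => (p n).2).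
  move=> e /pcau[N hN]; exists N => m n hm hn; apply: le_trans (hN _ _ hm hn).
  by rewrite /gip /= lerDr rip_ge0.
have Pp' n : P ((p n).1, (p n).2) by rewrite -surjective_pairing.
exists (fun n => (p n).1), (fun n => (p n).2), w, r; split => //.
  by apply: (sa_closed sS _ hw hr) => n; exact/PS.
move=> y t Pyt.
have h1 := sqr_cvg (sf_ge0 fb Pyt) (fun n => pf _ n Pyt).
have h2 : (fun n => gip (p n) (y, t)) @ \oo --> rip w y + rip r t.
  by apply: cvgD; exact: cvg_ripl.
by rewrite (ripC y w) (ripC t r) -(cvg_unique _ h1 h2).
Qed.

(** That is, [1 + S^2] is onto. Projecting [(f, 0)] on the graph gives [(w, r)], and orthogonality
    of the remainder [(f - w, - r)] to the graph says that [S r = f - w]. *)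
Lemma sa_onto f : exists w r q, [/\ S (w, r), S (r, q) & f = w + q].
Proof.
have [_ [_ [w [r [_ _ _ Swr h]]]]] := graph_riesz f 0 (op_subspace oS) (fun p h => h).
exists w, r, (f - w); split => //; last by rewrite addrC subrK.
apply: (sa_intro sS) => y t /h.
by rewrite rip0r addr0 ripBr => ->; ring.
Qed.

(** The domain of [S^2] is a core: if a point of the graph is orthogonal to the part over that
    domain, its first component is orthogonal to the range of [1 + S^2], which is everything. *)
Lemma sa_core x s (e : R) : S (x, s) -> 0 < e -> exists w r q,
  [/\ S (w, r), S (r, q), n2 (w - x) <= e & n2 (r - s) <= e].
Proof.
move=> Sxs e0; pose P := [set p | S p /\ exists q, S (p.2, q)].
have sP : subspace P.
  split; first by split; [exact: op0 oS|exists 0; exact: op0 oS].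
  move=> a p q [Sp [p' hp]] [Sq [q' hq]]; split; first exact: (op_subspace oS).2.
  by exists (a *: p' + q'); exact: (opL oS).
have [u [v [w [r [Puv uw vr Swr h]]]]] := graph_riesz x s sP (fun p h => h.1).
have xw : x = w.
  apply/subr0_eq; apply: eq_rip => f; rewrite rip0r.
  have [w' [r' [q' [S1 S2 ->]]]] := sa_onto f.
  have := h w' r' (conj S1 (ex_intro _ q' S2)).
  by rewrite (ripDl w') !ripBr -(sa_rip sS S2 Sxs) -(sa_rip sS S2 Swr); lra.
rewrite -{}xw in uw Swr; rewrite -(op_fun oS Sxs Swr) in vr.
have /(_ e e0)[N hN] := (cvg_n2P _ _).1 uw; have /(_ e e0)[M hM] := (cvg_n2P _ _).1 vr.
have [S1 [q S2]] := Puv (maxn N M).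
exists (u (maxn N M)), (v (maxn N M)), q; split => //.
  exact/hN/leq_maxl.
exact/hM/leq_maxr.
Qed.

(** Symmetry is immediate. Maximality comes from [sa_onto]: if [(y, t)] satisfies the adjoint
    relation and [y + t = w + S^2 w], then [y - w] is orthogonal to the range of [1 + S^2]. *)
Lemma sa_square : selfadjoint (op_comp S S).
Proof.
have sq w r q : S (w, r) -> S (r, q) -> op_comp S S (w, q) by move=> h1 h2; exists r.
apply/selfadjointP; split.
- split.
  + by exists 0; exact: op0 oS.
  + by move=> a p q [r h1 h2] [r' h3 h4]; exists (a *: r + r'); exact: (opL oS).
  + move=> x y y' [r h1 h2] [r' h3 h4].
    by move: h4; rewrite -(op_fun oS h1 h3); exact: (op_fun oS h2).
- apply/dense_n2P => x e e0; have /dense_n2P dS := sa_dense sS.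
  have e4 : 0 < e / 4 by rewrite divr_gt0.
  have [y [s Sys] hy] := dS x _ e4.
  have [w [r [q [h1 h2 h3 _]]]] := sa_core Sys e4.
  exists w; first by exists q; exists r.
  by apply: le_trans (n2_tri _ y _) _; move: hy h3; lra.
- move=> y t; split=> [[r h1 h2] x s [r' h3 h4]|h].
    by rewrite (sa_rip sS h4 h1) (sa_rip sS h3 h2).
  have [w [r [q [h1 h2 e]]]] := sa_onto (y + t).
  suff yw : y = w.
    by rewrite yw (_ : t = q); [exists r|apply: (addrI w); rewrite -e yw].
  apply/subr0_eq; apply: eq_rip => f; rewrite rip0r.
  have [w' [r' [q' [h3 h4 ->]]]] := sa_onto f.
  have := h _ _ (sq _ _ _ h3 h4); have := congr1 (rip w') e.
  have := etrans (sa_rip sS h4 h1) (sa_rip sS h3 h2).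
  by rewrite !ripBr !ripDl !ripDr; lra.
Qed.

Lemma sa_square_pos : (forall x, S (x, 0) -> x = 0) -> positive_op (op_comp S S).
Proof.
move=> inj x y [s h1 h2] x0.
have e : rip y x = n2 s by rewrite (sa_rip sS h2 h1).
have hx : inner y x = (n2 s)%:C%C.
  have h z t : op_comp S S (z, t) -> 0 <= rip t z.
    by move=> [r a b]; rewrite (sa_rip sS b a) rip_ge0.
  have := sa_nonneg sa_square h (ex_intro2 _ _ s h1 h2 : op_comp S S (x, y)).
  by rewrite innerE lecE /= => /andP[/eqP -> _]; rewrite e.
rewrite hx ltcR lt_neqAle rip_ge0 eq_sym rip_eq0 andbT.
by apply: contra_neq x0 => s0; apply: inj; rewrite -s0.
Qed.

End OneOperator.

(** Inclusion of the quadratic forms [|S x|^2]. Different selfadjoint operators can have the same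
    form, and the root picked by [op_sqrt] is compared with other roots only at this level. *)
Definition form_sub S1 S2 : Prop := forall x s, S1 (x, s) ->
  exists2 s', S2 (x, s') & n2 s' = n2 s.

Lemma form_sub_core S1 S2 (W : set X) : selfadjoint S1 -> selfadjoint S2 ->
  subspace W ->
  (forall v r, W v -> S1 (v, r) -> exists2 r', S2 (v, r') & n2 r' = n2 r) ->
  (forall x s (e : R), S1 (x, s) -> 0 < e -> exists v r, [/\ W v, S1 (v, r),
     n2 (v - x) <= e & n2 (r - s) <= e]) ->
  form_sub S1 S2.
Proof.
move=> sS1 sS2 sW hW hcore x s Sxs.
have o1 := sa_op sS1; have o2 := sa_op sS2.
have hP n : exists p : X * X * X, [/\ W p.1.1, S1 p.1, S2 (p.1.1, p.2) &
    n2 (p.1.1 - x) <= n.+1%:R^-1 /\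
    n2 (p.1.2 - s) <= n.+1%:R^-1].
  have n0 : (0 : R) < n.+1%:R^-1 by rewrite invr_gt0.
  have [v [r [Wv S1v h1 h2]]] := hcore _ _ _ Sxs n0.
  by have [r' S2v _] := hW _ _ Wv S1v; exists (v, r, r').
have [p hp] := choice hP.
have wx : (fun n => (p n).1.1) @ \oo --> x.
  by apply/cvg_n2P; apply: small_le (@small_inv R) => n; have [_ _ _ []] := hp n.
have rs : (fun n => (p n).1.2) @ \oo --> s.
  by apply/cvg_n2P; apply: small_le (@small_inv R) => n; have [_ _ _ []] := hp n.
pose r n := (p n).2.
have S1p n : S1 ((p n).1.1, (p n).1.2) by have [_ + _ _] := hp n; rewrite -surjective_pairing.
have S2p n : S2 ((p n).1.1, r n) by have [] := hp n.
have nr n : n2 (r n) = n2 (p n).1.2.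
  have [Wn _ _ _] := hp n; have [r' S2r <-] := hW _ _ Wn (S1p n).
  by rewrite (op_fun o2 S2r (S2p n)).
have nrr m n : n2 (r m - r n) =
    n2 ((p m).1.2 - (p n).1.2).
  have [Wn _ _ _] := hp n; have [Wm _ _ _] := hp m.
  have [r' S2r <-] := hW _ _ (subspaceB sW Wm Wn) (opB o1 (S1p m) (S1p n)).
  by rewrite (op_fun o2 S2r (opB o2 (S2p m) (S2p n))).
have [|s' rs'] := @cauchy_n2 R X r.
  move=> d d0; have d4 : 0 < d / 4 by rewrite divr_gt0.
  have /(_ _ d4)[N hN] := (cvg_n2P _ _).1 rs; exists N => m n /hN hm /hN hn.
  rewrite nrr; apply: le_trans (n2_tri _ s _) _; rewrite (n2BC s).
  by move: hm hn; lra.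
exists s'; first exact: (sa_closed sS2 S2p wx rs').
have h1 := cvg_n2 rs'; have h2 := cvg_n2 rs.
have er : (fun n => n2 (r n)) = (fun n => n2 (p n).1.2) by exact/funext.
by rewrite er in h1; exact: (cvg_unique _ h1 h2).
Qed.

(** [|S x|^2 = <S^2 x, x>] on the domain of [S^2], which is a core of [S1] by [sa_core]. *)
Lemma square_form_sub S1 S2 : selfadjoint S1 -> selfadjoint S2 ->
  op_comp S1 S1 = op_comp S2 S2 -> form_sub S1 S2.
Proof.
move=> sS1 sS2 e; have o1 := sa_op sS1.
apply: (@form_sub_core _ _ (dom (op_comp S1 S1))) => //.
- exact: dom_subspace (sa_op (sa_square sS1)).
- move=> v r [q [r1 h1 h2]] h3.
  have {h3}-> : r = r1 by exact: (op_fun o1 h3 h1).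
  have : op_comp S1 S1 (v, q) by exists r1.
  rewrite e => -[r' h4 h5]; exists r' => //.
  by rewrite (sa_rip sS2 h4 h5) (sa_rip sS1 h1 h2).
- move=> x s d Sxs d0; have [w [r [q [h1 h2 h3 h4]]]] := sa_core sS1 Sxs d0.
  by exists w, r; split => //; exists q; exists r.
Qed.

(** By polarization equal norms give equal pairings [<S x, S v>], and these characterize [S^2 x]. *)
Lemma form_sub_square S1 S2 : selfadjoint S1 -> selfadjoint S2 ->
  form_sub S1 S2 -> form_sub S2 S1 -> op_comp S1 S1 `<=` op_comp S2 S2.
Proof.
move=> sS1 sS2 h12 h21 [x y] /= [s Sxs Ssy].
have o1 := sa_op sS1; have o2 := sa_op sS2.
have [s' Sxs' ns] := h12 _ _ Sxs; exists s' => //=.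
apply: (sa_intro sS2) => v r' Svr'.
have [r Svr nr] := h21 _ _ Svr'.
have [z Sz nz] := h12 _ _ (opD o1 Sxs Svr).
have ez := op_fun o2 Sz (opD o2 Sxs' Svr').
have e : rip s' r' = rip s r by move: nz; rewrite ez !n2D ns nr; lra.
by rewrite -(sa_rip sS1 Svr Ssy) (ripC r') (ripC r).
Qed.

End Squares.

Section UniformBoundedness.
Variables (R : realType) (U X : hilbertType R) (f : U -> X) (V : set X).
Hypotheses (lf : linear f) (dV : dense V).
Hypothesis fV : forall s, V s -> exists v, forall u, rip (f u) s = rip u v.

(* Gliding hump: [4 * 16 ^ n] beats the loss [16 ^- n] at step [n]. *)
Lemma weak_bounded : bounded_op f.
Proof.
apply/bounded_opP; split => //; apply: contrapT => unb.
have big (K : R) : 0 <= K -> exists p : X * U, [/\ 0 < n2 p.1, 0 < n2 p.2,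
    K * n2 p.1 <= n2 p.2 & forall u, rip (f u) p.1 = rip u p.2].
  move=> K0; have [u hu] : exists u, 4 * (K + 1) * n2 u < n2 (f u).
    apply: contrapT => nu; apply: unb; exists (4 * (K + 1)); first by lra.
    by move=> u; rewrite leNgt; apply/negP => h; apply: nu; exists u.
  have u0 : 0 <= 4 * (K + 1) * n2 u by rewrite !mulr_ge0 ?rip_ge0 //; lra.
  have fu0 : 0 < n2 (f u) by exact: le_lt_trans hu.
  (* A squared distance of at most [|f u|^2 / 16] keeps [|f u| |s| <= 2 <f u, s>], so [v] inherits
     the size of [f u]. *)
  have [|s Vs hs] := (dense_n2P _).1 dV (f u) (n2 (f u) / 16).
    by rewrite divr_gt0.
  have [v hv] := fV Vs.
  have h1 := rip_CS u v; rewrite -hv in h1.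
  move: hs; rewrite n2B (ripC s) => hs.
  have s0 := rip_ge0 s.
  have s1 : 0 < n2 s.
    rewrite lt_neqAle s0 eq_sym rip_eq0 andbT; apply/eqP => sE.
    by move: hs; rewrite sE rip0l rip0r; lra.
  have h2 : n2 (f u) * n2 s <= 4 * rip (f u) s ^+ 2.
    move: (rip (f u) s) (n2 s) (n2 (f u)) hs fu0 s0 => p q r hs r0 q0.
    have hp : 15 / 16 * (q + r) <= 2 * p by lra.
    have : (15 / 16 * (q + r)) ^+ 2 <= (2 * p) ^+ 2.
      by rewrite ler_pXn2r ?nnegrE //; [rewrite mulr_ge0 //; lra|lra].
    by have := sqr_ge0 (q - r); have : 0 <= r * q; [rewrite mulr_ge0 // ltW|]; lra.
  have h3 : 4 * (K + 1) * n2 u * n2 s < n2 (f u) * n2 s by rewrite ltr_pM2r.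
  have h4 : (K + 1) * n2 s * n2 u < n2 v * n2 u.
    by move: h1 h2 h3; lra.
  have u1 : 0 < n2 u.
    rewrite lt_neqAle rip_ge0 eq_sym rip_eq0 andbT; apply/eqP => uE.
    by move: h4; rewrite uE rip0l !mulr0 ltxx.
  move: h4; rewrite ltr_pM2r // => h4.
  have Ks : 0 <= K * n2 s by exact: mulr_ge0.
  by exists (s, v); split => //=; lra.
pose r n : R := 16^-1 ^+ n.
have r0 n : 0 < r n by rewrite exprn_gt0 // invr_gt0.
have rS n : r n.+1 = 16^-1 * r n by rewrite /r exprS.
have hK n : exists p : X * U, [/\ 0 < n2 p.1, 0 < n2 p.2,
    4 * (r n.+1)^-1 * n.+1%:R * n2 p.1 <= n2 p.2
    & forall u, rip (f u) p.1 = rip u p.2].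
  by apply: big; rewrite !mulr_ge0 ?invr_ge0 // ltW.
have [p hp] := choice hK.
have hnext (q : nat * U) : exists y, n2 (y - q.2) <= r q.1.+1 /\
    r q.1.+1 * n2 (p q.1).2 <= rip y (p q.1).2 ^+ 2.
  case: q => n x /=; have [_ v0 _ _] := hp n.
  pose v := (p n).2; rewrite -/v in v0 *.
  pose c := Num.sqrt (r n.+1 / n2 v).
  have c2 : c ^+ 2 = r n.+1 / n2 v by rewrite sqr_sqrtr // divr_ge0 ?rip_ge0 // ltW.
  have c2v : c ^+ 2 * n2 v = r n.+1 by rewrite c2 divfK // gt_eqF.
  have c0 : 0 <= c by exact: sqrtr_ge0.
  (* The hump is [v] or [- v] scaled to squared norm [r n.+1]; the sign is chosen so that its
     pairing with [v] reinforces that of [x]. *)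
  have [xv|xv] := leP 0 (rip x v).
    exists (x + c%:C%C *: v); rewrite addrAC subrr add0r ripZl ripZr mulrA -expr2 c2v.
    split => //; rewrite ripDl ripZl -c2v.
    have : 0 <= rip x v * (c * n2 v) by rewrite !mulr_ge0 // ltW.
    by have := sqr_ge0 (rip x v); lra.
  exists (x - c%:C%C *: v); rewrite addrAC subrr add0r n2N ripZl ripZr mulrA -expr2 c2v.
  split => //; rewrite ripBl ripZl -c2v.
  have : 0 <= - rip x v * (c * n2 v) by rewrite !mulr_ge0 // ?ltW // oppr_gt0.
  by have := sqr_ge0 (rip x v); lra.
have [nxt hn] := choice hnext.
pose x := fix x n := if n is m.+1 then nxt (m, x m) else (0 : U).
have xd n : n2 (x n.+1 - x n) <= r n.+1 by have [] := hn (n, x n).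
have xv n : r n.+1 * n2 (p n).2 <= rip (x n.+1) (p n).2 ^+ 2 by have [] := hn (n, x n).
have xk k n : n2 (x (n + k)%N - x n) <= 4^-1 * r n.
  elim: k n => [|k IH] n.
    by rewrite addn0 subrr rip0l mulr_ge0 // ltW.
  apply: le_trans (n2_tri _ (x n.+1) _) _.
  have := IH n.+1; rewrite addSnnS; have := xd n; have := r0 n; rewrite rS; lra.
have rs : small r.
  apply: small_le (@small_inv R) => n; rewrite /r exprVn lef_pV2 ?posrE ?exprn_gt0 //.
  rewrite -natrX ler_nat; exact: ltn_expl.
have [|y xy] := @cauchy_n2 R U x.
  move=> e e0; have [N hN] := rs _ e0; exists N => m n hm hn'.
  rewrite -(subnKC hm) -(subnKC hn').
  have h1 := xk (m - N)%N N; have h2 := xk (n - N)%N N.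
  apply: le_trans (n2_tri _ (x N) _) _; rewrite (n2BC (x N)).
  by have := hN N (leqnn _); move: h1 h2; lra.
have yn n : n2 (y - x n) <= 4^-1 * r n.
  have h1 : (fun k => x (n + k)%N - x n) @ \oo --> y - x n.
    apply: cvgB; last exact: cvg_cst.
    have -> : (fun k => x (n + k)%N) = (fun k => x (k + n)%N).
      by apply/funext => k; rewrite addnC.
    by rewrite cvg_shiftn.
  have h2 : (fun _ : nat => 4^-1 * r n) @ \oo --> 4^-1 * r n by exact: cvg_cst.
  by apply: (ler_cvg_to (cvg_n2 h1) h2); near=> k; exact: xk.
have fy n : n.+1%:R <= n2 (f y).
  have [s0 v0 hs hf] := hp n; pose v := (p n).2; pose s := (p n).1.
  have h1 : r n.+1 * n2 v <= rip (x n.+1) v ^+ 2 by exact: xv.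
  have h2 : rip (y - x n.+1) v ^+ 2 <= 4^-1 * r n.+1 * n2 v.
    by apply: le_trans (rip_CS _ _) _; rewrite ler_wpM2r ?rip_ge0.
  have h3 : 4^-1 * r n.+1 * n2 v <= rip y v ^+ 2.
    move: h1 h2; rewrite ripBl; have := sqr_ge0 (2 * rip y v - rip (x n.+1) v); lra.
  have h4 : rip y v ^+ 2 <= n2 (f y) * n2 s by rewrite -hf; exact: rip_CS.
  have h5 : n.+1%:R * n2 s <= 4^-1 * r n.+1 * n2 v.
    have := ler_wpM2l (ltW (r0 n.+1)) hs; rewrite -/s -/v.
    rewrite !mulrA (mulrC (r n.+1) 4) mulfK ?gt_eqF //; lra.
  by have := le_trans h5 (le_trans h3 h4); rewrite ler_pM2r.
have := fy (Num.trunc (n2 (f y))).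
by rewrite leNgt truncnS_gt.
Unshelve. all: by end_near.
Qed.

End UniformBoundedness.

(** * The inequality defining RI *)

Section Systems.
Variables (R : realType) (X U Y : hilbertType R).
Implicit Types (Sg : system X U Y) (S : set (X * X)).

Lemma bop_lin (Z T : hilbertType R) (f : Z -> T) : bounded_op f -> linear f.
Proof. by case. Qed.

Lemma adj_bounded (Z T : hilbertType R) (f : Z -> T) : bounded_op f -> bounded_op (adj f).
Proof.
move=> bf; apply/bounded_opP; split; first exact: adj_linear.
have [lf [M M0 hM]] := (bounded_opP f).1 bf; exists M => // y.
have h1 := adj_rip bf (adj f y) y; have h2 := rip_CS (f (adj f y)) y.
rewrite h1 in h2; have h3 := hM (adj f y).
have a0 := rip_ge0 (adj f y); have y0 := rip_ge0 y.
have [->|a1] := eqVneq (n2 (adj f y)) 0; first exact: mulr_ge0.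
have {}a1 : 0 < n2 (adj f y) by rewrite lt_neqAle eq_sym a1.
rewrite -(ler_pM2r a1) -expr2; apply: le_trans h2 _.
by rewrite mulrAC; apply: ler_wpM2r.
Qed.

Lemma iter_linear (Z : hilbertType R) (f : Z -> Z) n : linear f -> linear (iter n f).
Proof. by move=> lf; elim: n => [//|n IH] a x y /=; rewrite IH lf. Qed.

Lemma iter_adj (f : X -> X) n x y : bounded_op f ->
  rip (iter n f x) y = rip x (iter n (adj f) y).
Proof.
move=> bf; elim: n y => [//|n IH] y.
by rewrite iterS adj_rip // IH -iterSr.
Qed.

Lemma lspan_sub (Z : hilbertType R) (G P : set Z) : subspace P -> G `<=` P -> lspan G `<=` P.
Proof.
move=> sP GP _ [n [c [v [hv ->]]]]; apply: subspace_sum => // i.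
by apply: subspaceZ => //; exact/GP.
Qed.

Lemma lspan_gen (Z : hilbertType R) (G : set Z) : G `<=` lspan G.
Proof.
move=> x Gx; exists 1%N, (fun=> 1), (fun=> x); split => //.
by rewrite big_ord1 scale1r.
Qed.

Lemma lspan_subspace (Z : hilbertType R) (G : set Z) : subspace (lspan G).
Proof.
split; first by exists 0%N, (fun=> 0), (fun=> 0); split => [[]//|]; rewrite big_ord0.
move=> a _ _ [n [c [v [hv ->]]]] [m [d [w [hw ->]]]].
exists (n + m)%N, (fun i => match fintype.split i with inl j => a * c j | inr j => d j end),
  (fun i => match fintype.split i with inl j => v j | inr j => w j end).
split; first by move=> i; case: (fintype.split i).
rewrite big_split_ord /= scaler_sumr; congr (_ + _); apply: eq_bigr => i _.
  by rewrite (unsplitK (inl _ i)) scalerA.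
by rewrite (unsplitK (inr _ i)).
Qed.

Section Reach.
Variables (Z T : hilbertType R) (A : Z -> Z) (B : T -> Z).
Hypotheses (lA : linear A) (lB : linear B).

(** The states reached from 0 in [n] steps. Unlike the generators of [lspan], this increasing chain
    supports an induction along trajectories, [span_iter_ind]. *)
Fixpoint states n : set Z :=
  if n is m.+1 then [set z | exists x u, states m x /\ z = A x + B u] else [set 0].

Lemma states_subspace n : subspace (states n).
Proof.
elim: n => [|n [IH0 IH]] /=.
  by split => // a x y -> ->; rewrite scaler0 addr0.
split; first by exists 0, 0; rewrite (linop0 lA) (linop0 lB) addr0.
move=> a _ _ [x [u [hx ->]]] [y [v [hy ->]]]; exists (a *: x + y), (a *: u + v).
by split; [exact: IH|rewrite lA lB scalerDr addrACA].
Qed.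

Lemma statesS n : states n `<=` states n.+1.
Proof.
elim: n => [|n IH] x; last by move=> [y [u [/IH hy ->]]]; exists y, u.
by move=> ->; exists 0, 0; rewrite (linop0 lA) (linop0 lB) addr0.
Qed.

Lemma states_le m n : (m <= n)%N -> states m `<=` states n.
Proof.
by move=> /subnK <-; elim: (n - m)%N => [//|k IH] x /IH; rewrite addSn; exact: statesS.
Qed.

Definition span_iter : set Z := lspan [set x | exists n u, x = iter n A (B u)].

Lemma states_span n : states n `<=` span_iter.
Proof.
have sS := lspan_subspace [set x | exists n u, x = iter n A (B u)].
elim: n => [|n IH] x; first by move=> ->; exact: sS.1.
move=> [y [u [/IH hy ->]]]; apply: subspaceD => //; last first.
  by apply: lspan_gen; exists 0%N, u.
move: hy; apply: (@lspan_sub _ _ [set y | span_iter (A y)]).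
  split; first by rewrite /= linop0 //; exact: sS.1.
  by move=> a z z' h h' /=; rewrite lA; exact: sS.2.
by move=> _ [k [v ->]]; apply: lspan_gen; exists k.+1, v.
Qed.

Lemma span_states x : span_iter x -> exists n, states n x.
Proof.
apply: (@lspan_sub _ _ [set x | exists n, states n x]).
  split; first by exists 0%N.
  move=> a y z [n hy] [m hz]; exists (maxn n m).
  by apply: (states_subspace _).2; [apply: states_le hy|apply: states_le hz];
    rewrite leq_max leqnn ?orbT.
move=> _ [k [u ->]]; exists k.+1; elim: k => [|k IH].
  by exists 0, u; rewrite linop0 // add0r.
by exists (iter k A (B u)), 0; rewrite (linop0 lB) addr0.
Qed.

Lemma span_iter_ind (P : Z -> Prop) : P 0 ->
  (forall x u, span_iter x -> P x -> P (A x + B u)) -> forall x, span_iter x -> P x.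
Proof.
move=> P0 PS x /span_states[n]; elim: n x => [x -> //|n IH x [y [u [hy ->]]]].
by apply: PS; [exact: states_span hy|exact: IH].
Qed.

Lemma span_iterS x u : span_iter x -> span_iter (A x + B u).
Proof. by move=> /span_states[n h]; apply: (@states_span n.+1); exists x, u. Qed.

End Reach.

Section PseudoInverse.
Variable Q : set (U * U).
Hypothesis sQ : selfadjoint Q.
Let oQ := sa_op sQ.

Lemma ker_ran_perp z : Q (z, 0) -> forall y, closure (ran Q) y -> rip y z = 0.
Proof.
move=> kz y cy; apply: perp_closure cy _ => s [x Qxs].
by rewrite (sa_rip sQ Qxs kz) rip0r.
Qed.

(** The kernel is orthogonal to the closure of the range, so a preimage in that closure is unique
    and the component [k] in [pinv] vanishes. *)
Lemma pinv_fun y w : closure (ran Q) w -> Q (w, y) -> app (pinv Q) y = w.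
Proof.
move=> cw Qwy; rewrite /app; case: xgetP => [v _ /= [cv [k kk Qvk]]|/(_ w) []]; last first.
  by split => //; exists 0; [exact: op0 oQ|rewrite subr0].
have k0 : k = 0.
  apply/eqP; rewrite -rip_eq0; apply/eqP/(ker_ran_perp kk).
  have /= := opB oQ Qwy Qvk; rewrite subKr => h.
  by apply: subset_closure; exists (w - v).
rewrite k0 subr0 in Qvk.
have Qz : Q (v - w, 0) by have := opB oQ Qvk Qwy; rewrite subrr.
apply/subr0_eq/eqP; rewrite -rip_eq0 ripBl.
by rewrite (ker_ran_perp Qz cv) (ker_ran_perp Qz cw) subrr.
Qed.

Lemma pinv_app y : ran Q y -> Q (app (pinv Q) y, y).
Proof.
move=> [v Qvy].
have [|||||w [cw hw _]] := @riesz_range R U (U * U)%type Q snd (fun p => rip p.2 v) (n2 v).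
- exact: op_subspace oQ.
- by [].
- by split => [p q _ _|r p _] /=; rewrite ?ripDl ?ripZl.
- exact: rip_ge0.
- by move=> p _; rewrite mulrC; exact: rip_CS.
have {}cw : closure (ran Q) w.
  move: cw; apply: closure_subset => _ [[x s] Qxs <-]; by exists x.
have Qw : Q (v - w, 0).
  by apply: (sa_intro sQ) => x s Qxs; rewrite rip0r ripBr -(hw (x, s)) // subrr.
have Qwy : Q (w, y) by have := opB oQ Qvy Qw; rewrite subr0 subKr.
by rewrite (pinv_fun cw Qwy).
Qed.

End PseudoInverse.

(** The default of [op_sqrt] is the empty graph, so one point in its domain certifies a genuine
    square root; this is how the domain clauses of [RI] are exploited. *)
Lemma op_sqrt_good (Z : hilbertType R) (H : set (Z * Z)) :
  (exists x, dom (op_sqrt H) x) \/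
    (exists S : set (Z * Z), [/\ selfadjoint S, nonneg_op S & op_comp S S = H]) ->
  [/\ selfadjoint (op_sqrt H), nonneg_op (op_sqrt H) & op_comp (op_sqrt H) (op_sqrt H) = H].
Proof.
rewrite /op_sqrt; case: xgetP => [S _ //|hn].
by move=> [[x [y //]]|[S /hn]].
Qed.

(** The term with the pseudo-inverse in [RI] is the supremum over [u] of [2 <c, u> - <delta u, u>],
    with [c] the vector [crossRI]; keeping [u] free removes the pseudo-inverse. The existence of
    [s'] carries the invariance of the domain. *)
Definition kyp Sg S : Prop := forall x s u, S (x, s) ->
  exists s', S (sysA Sg x + sysB Sg u, s') /\
    n2 s' + n2 (sysC Sg x + sysD Sg u) <= n2 s + n2 u.

Section KYP.
Variables (Sg : system X U Y) (H : set (X * X)).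
Hypothesis bSg : bounded_system Sg.
Let bA : bounded_op (sysA Sg). Proof. by case: bSg. Qed.
Let bB : bounded_op (sysB Sg). Proof. by case: bSg. Qed.
Let bC : bounded_op (sysC Sg). Proof. by case: bSg. Qed.
Let bD : bounded_op (sysD Sg). Proof. by case: bSg. Qed.
Let lA := bop_lin bA.
Let lB := bop_lin bB.
Let lC := bop_lin bC.
Let lD := bop_lin bD.
Let S := op_sqrt H.

Section Square.
Hypotheses (sS : selfadjoint S) (BS : forall u, dom S (sysB Sg u)).
Let oS := sa_op sS.

Lemma sqrtBE u : S (sysB Sg u, sqrtB Sg H u).
Proof. exact: appP. Qed.

Lemma sqrtB_linear : linear (sqrtB Sg H).
Proof.
move=> a u v; apply: (op_fun oS (sqrtBE _)); rewrite lB.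
by apply: (opL oS); exact: sqrtBE.
Qed.

(** An everywhere defined operator that has an adjoint on the dense domain of [S] is bounded, by the
    uniform boundedness principle. *)
Lemma sqrtB_bounded : bounded_op (sqrtB Sg H).
Proof.
apply: (weak_bounded sqrtB_linear (sa_dense sS)) => s [s' Sss'].
exists (adj (sysB Sg) s') => u.
by rewrite (sa_rip sS (sqrtBE u) Sss') adj_rip.
Qed.

Lemma delta_rip u v : rip (delta Sg H u) v =
  rip u v - rip (sysD Sg u) (sysD Sg v) - rip (sqrtB Sg H u) (sqrtB Sg H v).
Proof.
rewrite /delta !ripBl (ripC (adj _ _)) -(adj_rip bD) (ripC (sysD _ _)).
by rewrite (ripC (adj _ _)) -(adj_rip sqrtB_bounded) (ripC (sqrtB _ _ _)).
Qed.

Lemma cross_rip x s u : S (sysA Sg x, s) -> rip (crossRI Sg H x) u =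
  rip (sysC Sg x) (sysD Sg u) + rip s (sqrtB Sg H u).
Proof.
move=> h; rewrite /crossRI (appE oS h) ripDl (ripC (adj _ _)) -(adj_rip bD) (ripC (sysD _ _)).
by rewrite (ripC (adj _ _)) -(adj_rip sqrtB_bounded) (ripC (sqrtB _ _ _)).
Qed.

Lemma step_sqr x s u : S (sysA Sg x, s) ->
  n2 (s + sqrtB Sg H u) +
    n2 (sysC Sg x + sysD Sg u) =
  n2 s + n2 (sysC Sg x) + 2 * rip (crossRI Sg H x) u
    + n2 u - rip (delta Sg H u) u.
Proof. by move=> h; rewrite !n2D (cross_rip u h) delta_rip; ring. Qed.

End Square.

(** With [w] the pseudo-inverse image of the cross term and [q = delta^(1/2) u], the term linear in
    [u] is [2 <w, q> <= |w|^2 + |q|^2], and [|q|^2 = <delta u, u>] cancels. *)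
Lemma RI_kyp : RI Sg H -> [/\ selfadjoint S, nonneg_op S, op_comp S S = H,
  forall x, S (x, 0) -> x = 0 & kyp Sg S].
Proof.
move=> [sH pH [AS BS] [bdelta _ hcross] hineq].
have [sS nS SS] : [/\ selfadjoint S, nonneg_op S & op_comp S S = H].
  by apply: op_sqrt_good; left; exists (sysB Sg 0); exact: BS.
have oS := sa_op sS.
split => //.
  move=> x Sx0; apply/eqP; apply: contraT => x0.
  have Hx : H (x, 0) by rewrite -SS; exists 0 => //; exact: op0 oS.
  by have := pH _ _ Hx x0; rewrite linear0l ltxx.
move=> x s u Sxs.
have dx : dom S x by exists s.
have [s1 hs1] := AS x dx.
have [r hr] := hcross x dx.
have [sQ nQ QQ] : [/\ selfadjoint (sqrt_delta Sg H), nonneg_op (sqrt_delta Sg H)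
    & op_comp (sqrt_delta Sg H) (sqrt_delta Sg H) = graph (delta Sg H)].
  by apply: op_sqrt_good; left; exists r; exists (crossRI Sg H x).
have hw := pinv_app sQ (hcross x dx).
have := hineq x dx; rewrite !sqr_normr (appE oS Sxs) (appE oS hs1).
rewrite -!rmorphB lecR => hi.
exists (s1 + sqrtB Sg H u); split.
  exact: (opD oS hs1 (sqrtBE sS BS u)).
rewrite (step_sqr sS BS u hs1).
have [q hq1 hq2] : op_comp (sqrt_delta Sg H) (sqrt_delta Sg H) (u, delta Sg H u) by rewrite QQ.
have e1 : rip (delta Sg H u) u = n2 q by rewrite (sa_rip sQ hq2 hq1).
have e2 : rip (crossRI Sg H x) u = rip (app (pinv (sqrt_delta Sg H)) (crossRI Sg H x)) q.
  by rewrite (sa_rip sQ hw hq1).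
rewrite e1 e2; have := rip_le (app (pinv (sqrt_delta Sg H)) (crossRI Sg H x)) q.
move: hi; lra.
Qed.

Lemma kyp_RI : selfadjoint H -> positive_op H -> selfadjoint S ->
  (forall u, dom S (sysB Sg u)) -> kyp Sg S -> RI Sg H.
Proof.
move=> sH pH sS BS kS; have oS := sa_op sS.
have lD' : linear (delta Sg H).
  move=> a u v; rewrite /delta lD (sqrtB_linear sS BS).
  rewrite (adj_linear bD) (adj_linear (sqrtB_bounded sS BS)).
  by rewrite !scalerBr !opprD (addrACA (a *: u)) (addrACA (a *: u - _)).
have symD : symop (delta Sg H).
  by move=> u v; rewrite delta_rip // [RHS]ripC delta_rip // ripC (ripC (sysD Sg u))
    (ripC (sqrtB Sg H u)).
have S00 := op0 oS.
(* The inequality at [x = 0] says [delta >= 0], and [delta <= 1] by its formula, so [bounded_sqrt]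
   will provide its root. *)
have D0 u : 0 <= rip (delta Sg H u) u.
  have [s' [h1 h2]] := kS 0 0 u S00; rewrite delta_rip //.
  rewrite (linop0 lA) (linop0 lC) !add0r rip0l add0r in h1 h2.
  by rewrite (op_fun oS (sqrtBE sS BS u) h1); lra.
have D1 u : rip (delta Sg H u) u <= n2 u.
  by rewrite delta_rip //; have := rip_ge0 (sysD Sg u); have := rip_ge0 (sqrtB Sg H u); lra.
have sG := sa_graph lD' symD.
have nG : nonneg_op (graph (delta Sg H)).
  by apply: (sa_nonneg sG) => x s e; rewrite (e : s = delta Sg H x).
have AS x : dom S x -> dom S (sysA Sg x).
  move=> [s hs]; have [s' [h _]] := kS x s 0 hs; exists s'.
  by move: h; rewrite (linop0 lB) addr0.
have [sQ nQ QQ] : [/\ selfadjoint (sqrt_delta Sg H), nonneg_op (sqrt_delta Sg H)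
    & op_comp (sqrt_delta Sg H) (sqrt_delta Sg H) = graph (delta Sg H)].
  apply: op_sqrt_good; right.
  have [P [lP sP P01 PP _]] := bounded_sqrt lD' symD D0 D1.
  have sP' := sa_graph lP sP.
  exists (graph P); split => //.
    by apply: (sa_nonneg sP') => x s e; rewrite (e : s = P x); have /andP[] := P01 x.
  apply/seteqP; split=> [[x z] [y e1 e2]|[x z] e].
    by move: e1 e2; rewrite /graph /= => -> ->; rewrite PP.
  by move: e; rewrite /graph /= => ->; exists (P x) => //=; rewrite PP.
have key x s : S (x, s) -> exists w, [/\ closure (ran (sqrt_delta Sg H)) w,
    sqrt_delta Sg H (w, crossRI Sg H x)
  & n2 w <= n2 s - n2 (app S (sysA Sg x))
       - n2 (sysC Sg x)].
  move=> Sxs; have dx : dom S x by exists s.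
  have hA := appP oS (AS x dx).
  set a := (_ - _ - _).
  have hk u : 2 * rip (crossRI Sg H x) u <= a + rip (delta Sg H u) u.
    have [s' [h1 h2]] := kS x s u Sxs.
    have e := op_fun oS h1 (opD oS hA (sqrtBE sS BS u)).
    rewrite e (step_sqr sS BS u hA) in h2.
    by rewrite /a; lra.
  have a0 : 0 <= a by have := hk 0; rewrite rip0r (linop0 lD') rip0r; lra.
  have hdom u : exists2 q, sqrt_delta Sg H (u, q) & sqrt_delta Sg H (q, delta Sg H u).
    by have : graph (delta Sg H) (u, delta Sg H u) by []; rewrite -QQ.
  (* Scaling [u] in [hk] bounds [<c, u>^2] by [a |delta^(1/2) u|^2], for [c] the cross term; Riesz
     on the range of [delta^(1/2)] returns a preimage of [c] with squared norm at most [a]. *)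
  have [|||||w [cw hw nw]] := @riesz_range R U (U * U)%type (sqrt_delta Sg H) snd
      (fun p => rip (crossRI Sg H x) p.1) a.
  - exact: op_subspace (sa_op sQ).
  - by [].
  - by split => [p q _ _|r p _] /=; rewrite ?ripDr ?ripZr.
  - exact: a0.
  - move=> [u q] hq /=.
    have [q' hq1 hq2] := hdom u.
    have qE := op_fun (sa_op sQ) hq hq1; rewrite -qE {q' qE hq1} in hq2.
    have e : n2 q = rip (delta Sg H u) u by rewrite (sa_rip sQ hq2 hq).
    apply: discr_le; rewrite ?rip_ge0 // => r.
    have := hk ((- r)%:C%C *: u); rewrite (linopZ lD') ripZl !ripZr -e; lra.
  have Qw : sqrt_delta Sg H (w, crossRI Sg H x).
    by apply: (sa_intro sQ) => u q hq; rewrite -(hw (u, q)) // ripC.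
  exists w; split => //.
  by move: cw; apply: closure_subset => _ [[u q] hq <-]; exists u.
split => //.
- split => //.
    apply/bounded_opP; split => //; exists 1 => [//|u]; rewrite mul1r.
    exact: symop_contr.
  by move=> x [s /key[w [_ hw _]]]; exists w.
- move=> x [s hs]; have [w [cw Qw nw]] := key _ _ hs.
  rewrite -/S (appE oS hs) (pinv_fun sQ cw Qw) !sqr_normr -!rmorphB lecR.
  exact: nw.
Qed.

End KYP.
End Systems.

(** * Energy conservation and the operator H *)

Section ObservabilityForm.
Variables (R : realType) (X U Y : hilbertType R) (Sg : system X U Y).
Hypothesis bSg : bounded_system Sg.

Let A := sysA Sg.
Let As := adj (sysA Sg).
Let Bs := adj (sysB Sg).
Let Cs := adj (sysC Sg).
Let Ds := adj (sysD Sg).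

Let bA : bounded_op A. Proof. by case: bSg. Qed.
Let bB : bounded_op (sysB Sg). Proof. by case: bSg. Qed.
Let bC : bounded_op (sysC Sg). Proof. by case: bSg. Qed.
Let bD : bounded_op (sysD Sg). Proof. by case: bSg. Qed.
Let lAs : linear As. Proof. exact: adj_linear. Qed.
Let lBs : linear Bs. Proof. exact: adj_linear. Qed.
Let lCs : linear Cs. Proof. exact: adj_linear. Qed.
Let lDs : linear Ds. Proof. exact: adj_linear. Qed.

Definition obs n (z : X) : U := Bs (iter n As z).

(* The adjoint of the n-th Taylor coefficient of the transfer function. *)
Definition impulse n (y : Y) : U := if n is m.+1 then obs m (Cs y) else Ds y.

Definition orthonormal_impulses : Prop := forall y y' k,
  (fun N => \sum_(n < N) rip (impulse n y) (impulse (n + k) y')) @ \oo -->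
    (if k == 0%N then rip y y' else 0).

Lemma obs_linear n : linear (obs n).
Proof. by move=> a x y; rewrite /obs iter_linear // lBs. Qed.

Lemma impulse_linear n : linear (impulse n).
Proof. by case: n => [|n] a x y /=; rewrite ?lDs // lCs obs_linear. Qed.

Lemma obsS n z : obs n.+1 z = obs n (As z).
Proof. by rewrite /obs iterSr. Qed.

Lemma obs_rip n z u : rip (iter n A (sysB Sg u)) z = rip u (obs n z).
Proof. by rewrite iter_adj // adj_rip. Qed.

Lemma obs_cvg n (u : nat -> X) z : u @ \oo --> z -> (obs n \o u) @ \oo --> obs n z.
Proof.
move=> uz; have /bounded_opP[_ [M _ hM]] := adj_bounded bB.
have /bounded_opP[_ [K K0 hK]] := adj_bounded bA.
have hn k x : n2 (iter k As x) <= K ^+ k * n2 x.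
  elim: k => [|k IH] /=; first by rewrite mul1r.
  apply: le_trans (hK _) _; rewrite exprS -mulrA; exact: ler_wpM2l.
have h1 : (iter n As \o u) @ \oo --> iter n As z.
  exact: (bop_cvg (iter_linear n lAs) (hn n) uz).
exact: (bop_cvg lBs hM h1).
Qed.

Definition qsum N (z z' : X) : R := \sum_(n < N) rip (obs n z) (obs n z').
Definition qdom : set X := [set z | exists M, forall N, qsum N z z <= M].
Definition qform (z z' : X) : R := lim ((fun N => qsum N z z') @ \oo).

Lemma qsumC N z z' : qsum N z z' = qsum N z' z.
Proof. by apply: eq_bigr => n _; rewrite ripC. Qed.

Lemma qsumD N x y z : qsum N (x + y) z = qsum N x z + qsum N y z.
Proof.
rewrite /qsum -big_split /=; apply: eq_bigr => n _.
by rewrite (linopD (obs_linear n)) ripDl.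
Qed.

Lemma qsumZ N (r : R) x z : qsum N (r%:C%C *: x) z = r * qsum N x z.
Proof.
rewrite /qsum mulr_sumr; apply: eq_bigr => n _.
by rewrite (linopZ (obs_linear n)) ripZl.
Qed.

Lemma qsum_ge0 N z : 0 <= qsum N z z.
Proof. by apply: sumr_ge0 => n _; exact: rip_ge0. Qed.

Lemma qsum_form N : sform setT (qsum N).
Proof.
split => //.
- by move=> x y _ _; exact: qsumC.
- by move=> x y z _ _ _; exact: qsumD.
- by move=> r x y _ _; exact: qsumZ.
- by move=> x _; exact: qsum_ge0.
Qed.

Lemma qsumi N x y : qsum N ('i%C *: x) ('i%C *: y) = qsum N x y.
Proof.
by apply: eq_bigr => n _; rewrite !(linopZ (obs_linear n)) ripi.
Qed.

Lemma qdom_subspace : subspace qdom.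
Proof.
have q0 N : qsum N 0 0 = 0 by exact: sf_00 (qsum_form N).
split; first by exists 0 => N; rewrite q0.
move=> a x y [M hM] [K hK].
exists (2 * ((complex.Re a ^+ 2 + complex.Im a ^+ 2) * M) + 2 * K) => N.
apply: le_trans (sf_sqrD_le (qsum_form N) I I) _; apply: lerD; apply: ler_wpM2l => //.
have -> : qsum N (a *: x) (a *: x) =
    (complex.Re a ^+ 2 + complex.Im a ^+ 2) * qsum N x x.
  rewrite /qsum mulr_sumr; apply: eq_bigr => n _.
  by rewrite (linopZ (obs_linear n)) n2Z.
by apply: ler_wpM2l => //; rewrite addr_ge0 ?sqr_ge0.
Qed.

Lemma qsum_homo z : {homo (fun N => qsum N z z) : m n / (m <= n)%N >-> m <= n}.
Proof.
apply: homo_leq => //; first exact: le_trans.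
by move=> n; rewrite /qsum big_ord_recr /= lerDl rip_ge0.
Qed.

Lemma qsum_cvg_sqr z : qdom z -> (fun N => qsum N z z) @ \oo --> qform z z.
Proof.
move=> [M hM]; apply: nondecreasing_is_cvgn; first exact: qsum_homo.
by exists M => _ [N _ <-].
Qed.

(** The partial sums are monotone only on the diagonal; off it they converge by polarization. *)
Lemma qsum_cvg z z' : qdom z -> qdom z' -> (fun N => qsum N z z') @ \oo --> qform z z'.
Proof.
move=> Dz Dz'; pose l := (qform (z + z') (z + z') - qform z z - qform z' z') * 2^-1.
suff h : (fun N => qsum N z z') @ \oo --> l by exact: (cvgP _ h).
have -> : (fun N => qsum N z z') =
    (fun N => (qsum N (z + z') (z + z') - qsum N z z - qsum N z' z') * 2^-1).
  by apply/funext => N; rewrite (sf_sqrD (qsum_form N)) //; field.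
apply: cvgM; last exact: cvg_cst.
apply: cvgB; last exact: qsum_cvg_sqr.
apply: cvgB; last exact: qsum_cvg_sqr.
by apply: qsum_cvg_sqr; apply: (subspaceD qdom_subspace).
Qed.

Lemma qform_lim z z' (l : R) : qdom z -> qdom z' ->
  (fun N => qsum N z z') @ \oo --> l -> qform z z' = l.
Proof. by move=> Dz Dz' h; exact: (cvg_unique _ (qsum_cvg Dz Dz') h). Qed.

Lemma qform_form : sform qdom qform.
Proof.
have sq := qdom_subspace; split => //.
- move=> x y Dx Dy; apply: qform_lim => //.
  rewrite (_ : (fun N => _) = (fun N => qsum N y x)); first exact: qsum_cvg.
  by apply/funext => N; exact: qsumC.
- move=> x y z Dx Dy Dz; apply: qform_lim => //; first exact: subspaceD.
  rewrite (_ : (fun N => _) = (fun N => qsum N x z + qsum N y z)).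
    by apply: cvgD; exact: qsum_cvg.
  by apply/funext => N; exact: qsumD.
- move=> r x y Dx Dy; apply: qform_lim => //; first exact: subspaceZ.
  rewrite (_ : (fun N => _) = (fun N => r * qsum N x y)).
    by apply: cvgM; [exact: cvg_cst|exact: qsum_cvg].
  by apply/funext => N; exact: qsumZ.
- move=> x Dx; have h := qsum_cvg_sqr Dx.
  have h0 : (fun _ : nat => 0 : R) @ \oo --> (0 : R) by exact: cvg_cst.
  by apply: (ler_cvg_to h0 h); near=> N; exact: qsum_ge0.
Unshelve. all: by end_near.
Qed.

Lemma qformi x y : qdom x -> qdom y -> qform ('i%C *: x) ('i%C *: y) = qform x y.
Proof.
move=> Dx Dy; have sq := qdom_subspace; apply: qform_lim; try exact: subspaceZ.
rewrite (_ : (fun N => _) = (fun N => qsum N x y)); first exact: qsum_cvg.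
by apply/funext => N; exact: qsumi.
Qed.

Lemma qsum_le N z : qdom z -> qsum N z z <= qform z z.
Proof.
move=> Dz; apply: (ler_cvg_to _ (qsum_cvg_sqr Dz)); first exact: cvg_cst.
by near=> M; apply: qsum_homo; near: M; exact: nbhs_infty_ge.
Unshelve. all: by end_near.
Qed.

Lemma qform_le z (M : R) : (forall N, qsum N z z <= M) -> qdom z /\ qform z z <= M.
Proof.
move=> h; have Dz : qdom z by exists M.
split => //; apply: (ler_cvg_to (qsum_cvg_sqr Dz)); first exact: cvg_cst.
by near=> N; exact: h.
Unshelve. all: by end_near.
Qed.

(** Each partial sum is continuous on [X], so a bound on the form at [u n - u m] survives the limit
    in [m]. *)
Lemma qform_closed (u : nat -> X) z : (forall n, qdom (u n)) -> u @ \oo --> z ->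
  (forall e : R, 0 < e -> exists N, forall m n, (N <= m)%N -> (N <= n)%N ->
     qform (u m - u n) (u m - u n) <= e) ->
  qdom z /\ small (fun n => qform (u n - z) (u n - z)).
Proof.
move=> Du uz cau; have sq := qdom_subspace.
have key e N n : (forall m, (N <= m)%N -> qform (u n - u m) (u n - u m) <= e) ->
    qdom (u n - z) /\ qform (u n - z) (u n - z) <= e.
  move=> h; apply: qform_le => M.
  have hl : (fun m => qsum M (u n - u m) (u n - u m)) @ \oo --> qsum M (u n - z) (u n - z).
    apply: cvg_big => [|i _]; first exact: add_continuous.
    apply: cvg_n2.
    have -> : (fun m => obs i (u n - u m)) = (fun m => obs i (u n) - (obs i \o u) m).
      by apply/funext => m; rewrite (linopB (obs_linear i)).
    rewrite (linopB (obs_linear i)); apply: cvgB; first exact: cvg_cst.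
    exact: obs_cvg.
  apply: (ler_cvg_to hl); first exact: cvg_cst.
  near=> m; apply: le_trans (h m _).
    by apply: qsum_le; exact: subspaceB.
  by near: m; exact: nbhs_infty_ge.
split.
  have [N hN] := cau 1 ltr01.
  have [|Dz _] := key 1 N N; first by move=> m hm; exact: hN.
  by have := subspaceB sq (Du N) Dz; rewrite subKr.
move=> e /cau[N hN]; exists N => n hn.
by have [|_ //] := key e N n; first by move=> m hm; exact: hN.
Unshelve. all: by end_near.
Qed.

Definition dual_reach : set X := span_iter As Cs.

Lemma dual_reach_subspace : subspace dual_reach.
Proof. exact: lspan_subspace. Qed.

Lemma dual_reachS z y : dual_reach z -> dual_reach (As z + Cs y).
Proof. exact: span_iterS. Qed.

Section Conservation.
Hypothesis orth : orthonormal_impulses.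

Lemma obs_iter n k y : obs n (iter k As (Cs y)) = impulse (n + k).+1 y.
Proof. by rewrite /= /obs -iterD. Qed.

Lemma impulse_sum_le N y : \sum_(n < N) n2 (impulse n y) <= n2 y.
Proof.
have h := @orth y y 0%N; rewrite eqxx in h.
have h' : (fun N => \sum_(n < N) n2 (impulse n y)) @ \oo --> n2 y.
  rewrite (_ : (fun N => _) = (fun N => \sum_(n < N) rip (impulse n y) (impulse (n + 0) y))) //.
  by apply/funext => M; apply: eq_bigr => n _; rewrite addn0.
apply: (ler_cvg_to _ h'); first exact: cvg_cst.
have hom : {homo (fun N => \sum_(n < N) n2 (impulse n y)) :
    m n / (m <= n)%N >-> m <= n}.
  apply: homo_leq => //; first exact: le_trans.
  by move=> n; rewrite big_ord_recr /= lerDl rip_ge0.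
by near=> M; apply: hom; near: M; exact: nbhs_infty_ge.
Unshelve. all: by end_near.
Qed.

(** The outputs started at [As^k (Cs y)] are the impulses of [y] with the first [k + 1] terms
    dropped. *)
Lemma dual_reach_qdom : dual_reach `<=` qdom.
Proof.
apply: lspan_sub; first exact: qdom_subspace.
move=> _ [k [y ->]]; exists (n2 y) => N.
apply: le_trans (impulse_sum_le (N + k.+1) y).
rewrite /qsum addnC big_split_ord.
rewrite [X in _ <= _ + X](_ : _ = \sum_(n < N) n2 (obs n (iter k As (Cs y)))).
  by rewrite lerDr; apply: sumr_ge0 => n _; exact: rip_ge0.
apply: eq_bigr => n _; rewrite obs_iter.
have -> : (rshift k.+1 n : nat) = (n + k).+1 by rewrite /= addSn addnC.
by [].
Qed.

(** On a generator this is orthogonality with shift [k + 1]. The argument on the span keeps [y]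
    quantified because an imaginary coefficient of [z] is moved to [y]. *)
Lemma dual_reach_cross z y : dual_reach z ->
  (fun N => \sum_(n < N) rip (obs n z) (impulse n y)) @ \oo --> (0 : R).
Proof.
move=> Rz; move: y.
apply: (@lspan_sub _ _ _ [set z | forall y,
  (fun N => \sum_(n < N) rip (obs n z) (impulse n y)) @ \oo --> (0 : R)]) Rz.
  split=> [y|a x x' hx hx' y].
    rewrite (_ : (fun N => _) = (fun=> 0)); first exact: cvg_cst.
    by apply/funext => N; apply: big1 => n _; rewrite (linop0 (obs_linear n)) rip0l.
  have h : (fun N => complex.Re a * (\sum_(n < N) rip (obs n x) (impulse n y))
    + (- complex.Im a) * (\sum_(n < N) rip (obs n x) (impulse n ('i%C *: y)))
    + \sum_(n < N) rip (obs n x') (impulse n y)) @ \oo -->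
      complex.Re a * 0 + (- complex.Im a) * 0 + 0.
    by apply: cvgD => //; apply: cvgD; apply: cvgM => //; exact: cvg_cst.
  rewrite !mulr0 !addr0 in h; apply: cvg_trans h; apply: near_eq_cvg.
  apply: nearW => N; rewrite !mulr_sumr -!big_split /=; apply: eq_bigr => n _.
  rewrite obs_linear (complex_ReIm a) !ripDl !ripZl ripil (linopZ (impulse_linear n)).
  by rewrite mulrN mulNr.
move=> _ [k [y' ->]] y.
have := @orth y y' k.+1; rewrite /=.
rewrite (_ : (fun N => _) = (fun N => \sum_(n < N) rip (obs n (iter k As (Cs y'))) (impulse n y))) //.
by apply/funext => N; apply: eq_bigr => n _; rewrite obs_iter addnS ripC.
Qed.

(* [qform z z] is the energy of the output of the adjoint system started at [z]. *)
Lemma conservation z y : dual_reach z ->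
  qform (As z + Cs y) (As z + Cs y) + n2 (Bs z + Ds y) =
  qform z z + n2 y.
Proof.
move=> Rz; have Dz := dual_reach_qdom Rz.
have Dz' := dual_reach_qdom (dual_reachS y Rz).
set z' := As z + Cs y in Dz' *.
have h1 : (fun N => qsum N z' z' + n2 (Bs z + Ds y)) @ \oo -->
    qform z' z' + n2 (Bs z + Ds y).
  by apply: cvgD; [exact: qsum_cvg_sqr|exact: cvg_cst].
have h2 : (fun N => qsum N z z + \sum_(n < N) rip (impulse n y) (impulse (n + 0) y) +
    2 * (\sum_(n < N) rip (obs n z) (impulse n y))) @ \oo --> qform z z + n2 y + 2 * 0.
  apply: cvgD; first by apply: cvgD; [exact: qsum_cvg_sqr|exact: (@orth y y 0%N)].
  by apply: cvgM; [exact: cvg_cst|exact: dual_reach_cross].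
rewrite mulr0 addr0 in h2.
move: h2; rewrite -(cvg_shiftS (fun N => qsum N z z +
  \sum_(n < N) rip (impulse n y) (impulse (n + 0) y) +
  2 * (\sum_(n < N) rip (obs n z) (impulse n y)))) => h2.
(* The combined output of [(z, y)] at time 0 is [Bs z + Ds y], and from time 1 on it is the output
   started at [z']; hence the sums to [N.+1]. *)
suff e : (fun N => qsum N z' z' + n2 (Bs z + Ds y)) =
    (fun N => qsum N.+1 z z + \sum_(n < N.+1) rip (impulse n y) (impulse (n + 0) y) +
    2 * (\sum_(n < N.+1) rip (obs n z) (impulse n y))).
  by rewrite e in h1; exact: (cvg_unique _ h1 h2).
apply/funext => N; rewrite /qsum mulr_sumr -!big_split /= big_ord_recl /= [LHS]addrC.
congr (_ + _); first by rewrite n2D.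
apply: eq_bigr => i _; rewrite addn0 -n2D /= /bump /= add1n /z'.
by rewrite (linopD (obs_linear i)) obsS.
Qed.

End Conservation.
End ObservabilityForm.

(** * Uniqueness and construction of the element of RIcirc *)

Section Assembly.
Variables (R : realType) (X U Y : hilbertType R) (Sg : system X U Y).
Hypotheses (bSg : bounded_system Sg) (mSg : minimal Sg).
Hypothesis orth : orthonormal_impulses Sg.

Let A := sysA Sg.
Let B := sysB Sg.
Let C := sysC Sg.
Let D := sysD Sg.
Let As := adj (sysA Sg).
Let Bs := adj (sysB Sg).
Let Cs := adj (sysC Sg).
Let Ds := adj (sysD Sg).
Let Rs := dual_reach Sg.

Let bA : bounded_op A. Proof. by case: bSg. Qed.
Let bB : bounded_op B. Proof. by case: bSg. Qed.
Let bC : bounded_op C. Proof. by case: bSg. Qed.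
Let bD : bounded_op D. Proof. by case: bSg. Qed.
Let lA : linear A. Proof. by case: bA. Qed.
Let lB : linear B. Proof. by case: bB. Qed.
Let lC : linear C. Proof. by case: bC. Qed.
Let lD : linear D. Proof. by case: bD. Qed.
Let lAs : linear As. Proof. exact: adj_linear. Qed.
Let lBs : linear Bs. Proof. exact: adj_linear. Qed.
Let lCs : linear Cs. Proof. exact: adj_linear. Qed.
Let lDs : linear Ds. Proof. exact: adj_linear. Qed.

Let sreach : subspace (reach Sg). Proof. exact: lspan_subspace. Qed.

Lemma reachS x u : reach Sg x -> reach Sg (A x + B u).
Proof. exact: (@span_iterS _ _ _ A B). Qed.

Lemma reachB u : reach Sg (B u).
Proof. by apply: lspan_gen; exists 0%N, u. Qed.

Lemma obs_inj z : (forall n, obs Sg n z = 0) -> z = 0.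
Proof.
move=> h; have [dr _] := mSg; apply: (dense_perp0 dr) => v rv.
suff [] : rip v z = 0 /\ rip v ('i%C *: z) = 0 by [].
apply: (@lspan_sub _ _ _ [set v | rip v z = 0 /\ rip v ('i%C *: z) = 0]) rv.
  split; first by rewrite /= !rip0l.
  move=> a x y /= [hx hx'] [hy hy']; rewrite !(complex_ReIm a) !ripDl !ripZl ripi.
  by rewrite ripil hx hx' hy hy' oppr0 !mulr0 !addr0.
move=> _ [n [u ->]]; rewrite /= !obs_rip // h rip0r.
by rewrite (linopZ (obs_linear bSg n)) h scaler0 rip0r.
Qed.

Lemma rip2_CS (Z T : hilbertType R) (a b : Z) (c d : T) :
  (rip a b + rip c d) ^+ 2 <= (n2 a + n2 c) * (n2 b + n2 d).
Proof.
rewrite mulrC; apply: discr_le; rewrite ?addr_ge0 ?rip_ge0 // => s.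
have := rip_ge0 (s%:C%C *: a + b); have := rip_ge0 (s%:C%C *: c + d).
by rewrite !n2D !(ripZl, ripZr); lra.
Qed.

Lemma le_of_sqr_le (a K : R) : 0 <= K -> 0 <= a -> a ^+ 2 <= K * a -> a <= K.
Proof.
move=> K0 a0; have [->//|a1] := eqVneq a 0.
have {}a1 : 0 < a by rewrite lt_neqAle eq_sym a1.
by rewrite expr2 ler_pM2r.
Qed.

(** Pairing the result of a step from [(x, u)] with [(g, y)] shows that [<x, As z + Cs y> + <u, b>]
    is at most [M^(1/2)] times the norm of [(S x, u)]. Riesz at [u = 0] gives [g']. *)
Lemma kyp_dual S g z y : selfadjoint S -> kyp Sg S -> S (g, z) ->
  exists g', S (g', As z + Cs y) /\
    n2 g' + n2 (Bs z + Ds y) <= n2 g + n2 y.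
Proof.
move=> sS kS Sgz; set b := Bs z + Ds y; set M := n2 g + n2 y.
have M0 : 0 <= M by rewrite addr_ge0 ?rip_ge0.
have oS := sa_op sS.
have bound x s u : S (x, s) ->
    (rip x (As z + Cs y) + rip u b) ^+ 2 <= M * (n2 s + n2 u).
  move=> Sxs; have [s' [hs' hle]] := kS x s u Sxs.
  have -> : rip x (As z + Cs y) + rip u b = rip s' g + rip (C x + D u) y.
    rewrite !ripDr -!adj_rip // (sa_rip sS hs' Sgz) !ripDl; ring.
  apply: le_trans (rip2_CS _ _ _ _) _; rewrite mulrC; exact: ler_wpM2l.
have [|||||g' [cg hg ng]] := @riesz_range R X (X * X)%type S snd
    (fun p => rip p.1 (As z + Cs y)) M.
- exact: op_subspace oS.
- by [].
- by split => [p q _ _|r p _] /=; rewrite ?ripDl ?ripZl.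
- exact: M0.
- move=> [x s] Sxs /=; have := bound x s 0 Sxs.
  by rewrite !rip0l !addr0.
exists g'; split.
  by apply: (sa_intro sS) => x s Sxs; rewrite -(hg (x, s)).
apply: le_of_sqr_le => //; first by rewrite addr_ge0 ?rip_ge0.
(* Taking [u = b] and letting [S x] tend to [g'] gives
   [(|g'|^2 + |b|^2)^2 <= M (|g'|^2 + |b|^2)]. *)
have [v Vv vg] := dense_seq cg.
have h1 : (fun n => (rip (v n) g' + n2 b) * (rip (v n) g' + n2 b)) @ \oo -->
    (n2 g' + n2 b) ^+ 2.
  by rewrite expr2; apply: cvgM; apply: cvgD; try exact: cvg_cst; exact: cvg_ripl.
have h2 : (fun n => M * (n2 (v n) + n2 b)) @ \oo --> M * (n2 g' + n2 b).
  by apply: cvgM; [exact: cvg_cst|apply: cvgD; [exact: cvg_n2|exact: cvg_cst]].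
apply: (ler_cvg_to h1 h2); near=> n.
have [[x s] Sxs /= <-] := Vv n.
by rewrite -(hg (x, s)) // -expr2; exact: bound.
Unshelve. all: by end_near.
Qed.

Lemma dual_reach_ran S z : selfadjoint S -> kyp Sg S -> Rs z ->
  exists g, S (g, z) /\ n2 g = qform Sg z z.
Proof.
move=> sS kS Rz; have oS := sa_op sS.
have h1 : exists g, S (g, z) /\ n2 g <= qform Sg z z.
  have : forall x, Rs x -> Rs x -> exists g, S (g, x) /\ n2 g <= qform Sg x x.
    apply: (@span_iter_ind _ _ _ As Cs) => // [_|x y Rx IH _].
      exists 0; split; first exact: op0 oS.
      by rewrite rip0l (sf_ge0 (qform_form bSg)) //; exact: (qdom_subspace bSg).1.
    have [g [Sgx ng]] := IH Rx.
    have [g' [Sg' ng']] := kyp_dual y sS kS Sgx.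
    exists g'; split => //; have := conservation bSg orth y Rx.
    by move: ng ng'; rewrite -/As -/Bs -/Cs -/Ds; lra.
  by move=> h; exact: h.
have h2 N : forall z g, S (g, z) -> qsum Sg N z z <= n2 g.
  elim: N => [|N IH] x g Sgx; first by rewrite /qsum big_ord0 rip_ge0.
  have [g' [Sg' ng']] := kyp_dual 0 sS kS Sgx.
  rewrite (linop0 lCs) (linop0 lDs) !addr0 rip0l addr0 in Sg' ng'.
  rewrite /qsum big_ord_recl; apply: le_trans ng'; rewrite addrC lerD2r.
  apply: le_trans (IH _ _ Sg'); rewrite /qsum ler_sum // => i _.
  by rewrite /= /bump /= add1n obsS.
have [g [Sgz ng]] := h1; exists g; split => //; apply/eqP; rewrite eq_le ng /=.
by apply: (qform_le _).2 => N; exact: h2.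
Qed.

Definition reach_core (S : set (X * X)) := forall x s (e : R), S (x, s) -> 0 < e ->
  exists v r, [/\ reach Sg v, S (v, r), n2 (v - x) <= e & n2 (r - s) <= e].

Definition dual_dense (S : set (X * X)) := dense [set g | exists2 z, Rs z & S (g, z)].

(** By [dual_dense] for [S], the norm [|S v|] is the supremum of [<v, z> / q(z)^(1/2)], and the same
    quotients bound [|S' v|] from below; this is [key]. Exchanging the operators gives equality on
    the reachable space, and the core extends it. *)
Lemma kyp_form_sub S1 S2 : selfadjoint S1 -> selfadjoint S2 ->
  (forall x, S1 (x, 0) -> x = 0) -> (forall x, S2 (x, 0) -> x = 0) ->
  kyp Sg S1 -> kyp Sg S2 -> (forall x, reach Sg x -> dom S2 x) ->
  dual_dense S1 -> dual_dense S2 -> reach_core S1 -> form_sub S1 S2.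
Proof.
move=> s1 s2 i1 i2 k1 k2 d2 dd1 dd2 c1.
have key S S' : selfadjoint S -> selfadjoint S' -> (forall x, S (x, 0) -> x = 0) ->
    kyp Sg S -> kyp Sg S' ->
    dual_dense S -> forall v r r', S (v, r) -> S' (v, r') -> n2 r <= n2 r'.
  move=> sS sS' iS kS kS' dS v r r' Svr Svr'.
  apply: le_of_sqr_le; rewrite ?rip_ge0 //.
  have /dense_closure/(_ r)/dense_seq[g hg gr] := dS.
  have h1 : (fun n => rip (g n) r * rip (g n) r) @ \oo --> n2 r ^+ 2.
    by rewrite expr2; apply: cvgM; exact: cvg_ripl.
  have h2 : (fun n => n2 r' * n2 (g n)) @ \oo --> n2 r' * n2 r.
    by apply: cvgM; [exact: cvg_cst|exact: cvg_n2].
  apply: (ler_cvg_to h1 h2); near=> n.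
  have [z Rz Sgz] := hg n.
  have [g1 [Sg1 n1]] := dual_reach_ran sS kS Rz.
  have [g2 [Sg2 nn2]] := dual_reach_ran sS' kS' Rz.
  have gg1 : g n = g1.
    by apply/subr0_eq/iS; rewrite -(subrr z); exact: (opB (sa_op sS)).
  have -> : rip (g n) r = rip r' g2.
    by rewrite ripC (sa_rip sS Svr Sgz) (sa_rip sS' Svr' Sg2).
  by rewrite gg1 n1 -nn2 -expr2; exact: rip_CS.
apply: (form_sub_core s1 s2 sreach _ c1) => v r rv S1v.
have [r' S2v] := d2 v rv; exists r' => //; apply/eqP; rewrite eq_le.
by rewrite (key S2 S1 s2 s1 i2 k2 k1 dd2 v r' r) // (key S1 S2 s1 s2 i1 k1 k2 dd1 v r r').
Unshelve. all: by end_near.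
Qed.

Lemma kyp_dom_reach S : selfadjoint S -> kyp Sg S -> forall x, reach Sg x -> dom S x.
Proof.
move=> sS kS; apply: (@span_iter_ind _ _ _ A B) => //.
  by exists 0; exact: op0 (sa_op sS).
by move=> x u _ [s Sxs]; have [s' [h _]] := kS x s u Sxs; exists s'.
Qed.

Lemma RIcirc_props H : RIcirc Sg H -> let S := op_sqrt H in
  [/\ [/\ selfadjoint S, op_comp S S = H & forall x, S (x, 0) -> x = 0],
      kyp Sg S, dual_dense S & reach_core S].
Proof.
move=> [rH d1 d2 [_ hc]] S; have [sS nS SS iS kS] := RI_kyp bSg rH.
split => // x s e Sxs e0.
have /hc hcl := Sxs.
have s0 : (0 : R[i]) < (Num.sqrt e)%:C%C by rewrite ltcR sqrtr_gt0.
have [[v r] [[Svr rv] [hx hy]]] := hcl _ (nbhsx_ballx (x, s) _ s0).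
exists v, r; split => //.
  move: hx; rewrite -ball_normE /= norm_ltP ?sqrtr_ge0 // sqr_sqrtr ?(ltW e0) // n2BC.
  exact: ltW.
move: hy; rewrite -ball_normE /= norm_ltP ?sqrtr_ge0 // sqr_sqrtr ?(ltW e0) // n2BC.
exact: ltW.
Qed.

(** Density of the image of the reachable space under [S] comes from approximating the vectors of
    the dense range of [S] through the core. *)
Lemma RIcirc_intro H : selfadjoint H -> positive_op H -> let S := op_sqrt H in
  selfadjoint S -> (forall x, S (x, 0) -> x = 0) -> kyp Sg S -> dual_dense S ->
  reach_core S -> RIcirc Sg H.
Proof.
move=> sH pH S sS iS kS dS cS.
have dr := kyp_dom_reach sS kS.
split.
- by apply: kyp_RI => // u; apply: dr; exact: reachB.
- apply/dense_n2P => y e e0; have e4 : 0 < e / 4 by rewrite divr_gt0.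
  have [s [x Sxs] hs] := (dense_n2P _).1 (sa_ran_dense sS iS) y _ e4.
  have [v [r [rv Svr _ hr]]] := cS _ _ _ Sxs e4.
  exists r; first by exists v.
  by apply: le_trans (n2_tri _ s _) _; move: hs hr; lra.
- have -> : op_image (op_inv S) (reach (adj_system Sg)) = [set g | exists2 z, Rs z & S (g, z)] by [].
  exact: dS.
- split; first exact: dr.
  move=> [x s] Sxs W /nbhs_ballP[e /= e0 hW].
  have ee : e = (complex.Re e)%:C%C by rewrite RRe_real // gtr0_real.
  have e1 : 0 < complex.Re e by rewrite -ltcR -ee.
  have e4 : 0 < (complex.Re e / 2) ^+ 2 by rewrite exprn_gt0 // divr_gt0.
  have e5 : (complex.Re e / 2) ^+ 2 < complex.Re e ^+ 2.
    by rewrite ltr_pXn2r ?nnegrE ?divr_ge0 ?(ltW e1) // ltr_pdivrMr //; lra.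
  have [v [r [rv Svr h1 h2]]] := cS _ _ _ Sxs e4.
  exists (v, r); split => //; apply: hW.
  by split; rewrite -ball_normE /= ee norm_ltP ?(ltW e1) // n2BC;
    [apply: le_lt_trans h1 e5|apply: le_lt_trans h2 e5].
Qed.

Section Existence.

(** [N] stands for [H^(-1/2)]. Density of [Rs] is observability of the system, and injectivity of
    [N] is its controllability, through [obs_inj]. *)
Lemma observability_operator : exists N, [/\ selfadjoint N,
  forall z, Rs z -> dom N z,
  forall z r, N (z, r) -> qdom Sg z /\ n2 r = qform Sg z z,
  forall z, N (z, 0) -> z = 0
  & dense [set r | exists2 z, Rs z & N (z, r)]].
Proof.
have dRs : dense Rs.
  apply: dense_subspaceP; first exact: lspan_subspace.
  move=> z hz; have [_ uz] := mSg.
  suff : unobs Sg z by rewrite uz.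
  move=> n _ /=; apply: eq_rip => y; rewrite rip0r ripC adj_rip // iter_adj //.
  by rewrite ripC hz //; apply: lspan_gen; exists n, y.
have [N [sN nN RN qN cN]] := form_operator (qform_form bSg) (@qformi _ _ _ _ _ bSg)
  (@qform_closed _ _ _ _ _ bSg) (lspan_subspace _) (dual_reach_qdom bSg orth) dRs.
have iN z : N (z, 0) -> z = 0.
  move=> /qN[Dz]; rewrite rip0l => /esym qz; apply: obs_inj => n.
  have := qsum_le n.+1 Dz; rewrite qz /qsum big_ord_recr /=.
  have := qsum_ge0 Sg n z; rewrite /qsum => h1 h2.
  by apply/eqP; rewrite -rip_eq0 eq_le rip_ge0 andbT; move: h1 h2; lra.
exists N; split => //.
apply/dense_n2P => y e e0; have e4 : 0 < e / 4 by rewrite divr_gt0.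
have [s [x Nxs] hs] := (dense_n2P _).1 (sa_ran_dense sN iN) y _ e4.
have [v [r [rv Nvr _ hr]]] := cN _ _ _ Nxs e4.
exists r; first by exists v.
by apply: le_trans (n2_tri _ s _) _; move: hs hr; lra.
Qed.

(** [S] comes from the form [|N^-1 x|^2], closed again from the reachable space. The density clause
    is stated for every [S'] whose form is contained in that of [S], because it will be needed for
    the root that [op_sqrt] selects. *)
Lemma storage_operator : exists S, [/\ selfadjoint S, nonneg_op S,
  forall x, S (x, 0) -> x = 0, kyp Sg S & reach_core S /\
  forall S', selfadjoint S' -> (forall x, S' (x, 0) -> x = 0) ->
    kyp Sg S' -> form_sub S' S -> dual_dense S'].
Proof.
have [N [sN RN qN iN dN]] := observability_operator.
have oN := sa_op sN.
have sNi := sa_inv sN iN; have oNi := sa_op sNi.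
pose t x x' := rip (app (op_inv N) x) (app (op_inv N) x').
have sran : subspace (ran N) by exact: ran_subspace.
have appN g x : N (g, x) -> app (op_inv N) x = g by move=> h; apply: appE.
have ft : sform (ran N) t.
  apply: sform_rip => // a x y [g Ngx] [h Nhy].
  by rewrite (appN _ _ Ngx) (appN _ _ Nhy) (appN (a *: g + h)) //; exact: opL.
have ti x y : ran N x -> ran N y -> t ('i%C *: x) ('i%C *: y) = t x y.
  move=> [g Ngx] [h Nhy]; rewrite /t (appN _ _ Ngx) (appN _ _ Nhy).
  by rewrite (appN _ _ (opZ oN 'i%C Ngx)) (appN _ _ (opZ oN 'i%C Nhy)) ripi.
have tcl (u : nat -> X) x : (forall n, ran N (u n)) -> u @ \oo --> x ->
    (forall e : R, 0 < e -> exists M, forall m n, (M <= m)%N -> (M <= n)%N ->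
      t (u m - u n) (u m - u n) <= e) ->
    ran N x /\ small (fun n => t (u n - x) (u n - x)).
  move=> Nu ux cau.
  have [g Ng] := choice Nu.
  have [|h gh] := @cauchy_n2 R X g.
    move=> e /cau[M hM]; exists M => m n hm hn; apply: le_trans (hM _ _ hm hn).
    by rewrite /t (appN _ _ (opB oN (Ng m) (Ng n))).
  have Nhx : N (h, x) by exact: (sa_closed sN Ng gh ux).
  split; first by exists h.
  apply: small_le ((cvg_n2P _ _).1 gh) => n.
  by rewrite /t (appN _ _ (opB oN (Ng n) Nhx)).
(* Pairing [z] with [A^n B u] gives [<obs n z, u>], at most [|u| |N z|], so Riesz on the graph of
   [N] finds a preimage. *)
have rran : reach Sg `<=` ran N.
  apply: lspan_sub => // _ [n [u ->]].
  have [|||||g [_ hg _]] := @riesz_range R X (X * X)%type N snd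
      (fun p => rip p.1 (iter n A (B u))) (n2 u).
  - exact: op_subspace oN.
  - by [].
  - by split => [p q _ _|r p _] /=; rewrite ?ripDl ?ripZl.
  - exact: rip_ge0.
  - move=> [z r] Nzr /=; have [Dz ->] := qN _ _ Nzr.
    rewrite ripC obs_rip //; apply: le_trans (rip_CS _ _) _.
    apply: ler_wpM2l; first exact: rip_ge0.
    apply: le_trans (qsum_le n.+1 Dz).
    by rewrite /qsum big_ord_recr /= lerDr; exact: qsum_ge0.
  by exists g; apply: (sa_intro sN) => z r Nzr; rewrite -(hg (z, r)).
have [dr _] := mSg.
have [S [sS nS rS tS cS]] := form_operator ft ti tcl sreach rran dr.
have oS := sa_op sS.
have SN x s : S (x, s) -> exists g, N (g, x) /\ n2 g = n2 s.
  by move=> /tS[[g Ng] ->]; exists g; rewrite /t (appN _ _ Ng).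
have kr x s u : reach Sg x -> S (x, s) -> exists s', S (A x + B u, s') /\
    n2 s' + n2 (C x + D u) <= n2 s + n2 u.
  move=> rx Sxs; have [s' Ss'] := rS _ (reachS u rx).
  exists s'; split => //.
  have [g [Ng <-]] := SN _ _ Sxs; have [g' [Ng' <-]] := SN _ _ Ss'.
  (* The output [w] is fed into the adjoint system: [<N z, g'> + |w|^2 = <g, N (As z + Cs w)> + <u,
     Bs z + Ds w>], and after Cauchy-Schwarz [conservation] evaluates the factor that contains [z].
     Then [N z] tends to [g']. *)
  set w := C x + D u; have wE : w = C x + D u by [].
  clearbody w; apply: le_of_sqr_le; rewrite ?addr_ge0 ?rip_ge0 //.
  have /dense_closure/(_ g')/dense_seq[r hr rg] := dN.
  have h1 : (fun n => (rip (r n) g' + n2 w) * (rip (r n) g' + n2 w)) @ \oo -->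
      (n2 g' + n2 w) ^+ 2.
    by rewrite expr2; apply: cvgM; apply: cvgD; try exact: cvg_cst; exact: cvg_ripl.
  have h2 : (fun n => (n2 g + n2 u) * (n2 (r n) + n2 w)) @ \oo -->
      (n2 g + n2 u) * (n2 g' + n2 w).
    by apply: cvgM; [exact: cvg_cst|apply: cvgD; [exact: cvg_n2|exact: cvg_cst]].
  apply: (ler_cvg_to h1 h2); near=> n.
  have [z Rz Nz] := hr n.
  have [r' Nr'] := RN _ (dual_reachS bSg w Rz).
  have -> : rip (r n) g' + n2 w = rip g r' + rip u (Bs z + Ds w).
    have ew : n2 w = rip (C x) w + rip (D u) w by rewrite {1}wE ripDl.
    rewrite (sa_rip sN Nz Ng') -(sa_rip sN Ng Nr') (ripC z) ew ripDl !ripDr.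
    by rewrite -!adj_rip // -/A -/B -/C -/D; ring.
  rewrite -expr2; apply: le_trans (rip2_CS _ _ _ _) _.
  apply: ler_wpM2l; first by rewrite addr_ge0 ?rip_ge0.
  have [_ ->] := qN _ _ Nr'; have [_ ->] := qN _ _ Nz.
  by rewrite conservation.
have iS x : S (x, 0) -> x = 0.
  move=> /SN[g [Ng /eqP]]; rewrite rip0l rip_eq0 => /eqP g0.
  by rewrite -(op_fun oN Ng (_ : N (g, 0))) // g0; exact: op0 oN.
have kS : kyp Sg S.
  move=> x s u Sxs.
  have hP n : exists p : X * X, [/\ reach Sg p.1, S (p.1, p.2),
      n2 (p.1 - x) <= n.+1%:R^-1 & n2 (p.2 - s) <= n.+1%:R^-1].
    have n0 : (0 : R) < n.+1%:R^-1 by rewrite invr_gt0.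
    by have [v [r h]] := cS _ _ _ Sxs n0; exists (v, r).
  have [p hp] := choice hP.
  have vx : (fun n => (p n).1) @ \oo --> x.
    by apply/cvg_n2P; apply: small_le (@small_inv R) => n; have [] := hp n.
  have rs : (fun n => (p n).2) @ \oo --> s.
    by apply/cvg_n2P; apply: small_le (@small_inv R) => n; have [] := hp n.
  have hq n : exists s', S (A (p n).1 + B u, s') /\
      n2 s' + n2 (C (p n).1 + D u) <= n2 (p n).2 + n2 u.
    by have [h1 h2 _ _] := hp n; exact: kr.
  have [q Hq] := choice hq.
  (* The step with [u = 0] does not increase [|S x|] and governs differences, so the images of the
     approximating sequence are Cauchy. *)
  have [|s' qs'] := @cauchy_n2 R X q.
    move=> d d0; have d4 : 0 < d / 4 by rewrite divr_gt0.
    have /(_ _ d4)[M hM] := (cvg_n2P _ _).1 rs; exists M => m n /hM hm /hM hn.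
    have [rm Sm _ _] := hp m; have [rn Sn _ _] := hp n.
    have [r [Sr nr]] := kr _ _ 0 (subspaceB sreach rm rn) (opB oS Sm Sn).
    have [Sqm _] := Hq m; have [Sqn _] := Hq n.
    have := opB oS Sqm Sqn; rewrite opprD addrACA subrr addr0 -linopB // => Sq.
    rewrite (linop0 lB) addr0 in Sr; rewrite (op_fun oS Sq Sr).
    have : n2 r <= n2 ((p m).2 - (p n).2).
      by move: nr; rewrite rip0l addr0; have := rip_ge0 (C ((p m).1 - (p n).1) + D 0); lra.
    move=> /le_trans; apply; apply: le_trans (n2_tri _ s _) _; rewrite (n2BC s).
    by move: hm hn; lra.
  have lim (Z : hilbertType R) (f : X -> Z) (c : Z) : bounded_op f ->
      (fun n => f (p n).1 + c) @ \oo --> f x + c.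
    move=> bf; have [lf [M _ hM]] := (bounded_opP f).1 bf.
    by apply: cvgD; [exact: (bop_cvg lf hM vx)|exact: cvg_cst].
  exists s'; split.
    by apply: (sa_closed sS _ (lim _ _ _ bA) qs') => n; have [] := Hq n.
  have h1 : (fun n => n2 (q n) + n2 (C (p n).1 + D u)) @ \oo -->
      n2 s' + n2 (C x + D u).
    by apply: cvgD; [exact: cvg_n2|exact: (cvg_n2 (lim _ _ (D u) bC))].
  have h2 : (fun n => n2 (p n).2 + n2 u) @ \oo --> n2 s + n2 u.
    by apply: cvgD; [exact: cvg_n2|exact: cvg_cst].
  by apply: (ler_cvg_to h1 h2); near=> n; have [] := Hq n.
exists S; split => //; split => //.
move=> S' sS' iS' kS' S'S; have oS' := sa_op sS'.
apply: dense_subspaceP.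
  split; first by exists 0; [exact: (dual_reach_subspace Sg).1|exact: op0 oS'].
  move=> a x y [z Rz h1] [z' Rz' h2]; exists (a *: z + z'); last exact: opL.
  exact: (dual_reach_subspace Sg).2.
move=> y hy.
(* The map from [S' x] to [N^-1 x] is isometric. If [y], a limit of [S' (x n)], is orthogonal to all
   [S'^-1 z], then the limit [g] of [N^-1 (x n)] is orthogonal to all [N z]; so [g = 0], while
   [|y| = |g|]. *)
have /dense_closure/(_ y)/dense_seq[s hs sy] := sa_ran_dense sS' iS'.
have [x Sx] := choice hs.
have hh n : exists h, N (h, x n).
  by have [s' /SN[g [Ng _]] _] := S'S _ _ (Sx n); exists g.
have [h Nh] := choice hh.
have nh v r g : S' (v, r) -> N (g, v) -> n2 g = n2 r.
  move=> Svr Ngv; have [s' /SN[g' [Ng' e]] <-] := S'S _ _ Svr.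
  by rewrite -e (op_fun oNi Ngv Ng').
have [|g hg] := @cauchy_n2 R X h.
  move=> d d0; have d4 : 0 < d / 4 by rewrite divr_gt0.
  have /(_ _ d4)[M hM] := (cvg_n2P _ _).1 sy; exists M => m n /hM hm /hM hn.
  rewrite (nh _ _ _ (opB oS' (Sx m) (Sx n)) (opB oN (Nh m) (Nh n))).
  apply: le_trans (n2_tri _ y _) _; rewrite (n2BC y).
  by move: hm hn; lra.
have g0 : g = 0.
  apply: (dense_perp0 dN) => r [z Rz Nzr].
  have [f [Sf _]] := dual_reach_ran sS' kS' Rz.
  have h1 := cvg_ripl (y := f) sy; have h2 := cvg_ripl (y := r) hg.
  have e : (fun n => rip (s n) f) = (fun n => rip (h n) r).
    by apply/funext => n; rewrite (sa_rip sS' (Sx n) Sf) -(sa_rip sN (Nh n) Nzr).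
  rewrite e in h1; rewrite ripC.
  have -> : rip g r = rip y f by exact: (cvg_unique _ h2 h1).
  by rewrite ripC; apply: hy; exists z.
have h1 := cvg_n2 hg; have h2 := cvg_n2 sy.
have e : (fun n => n2 (h n)) = (fun n => n2 (s n)).
  by apply/funext => n; exact: (nh _ _ _ (Sx n) (Nh n)).
rewrite e in h1; apply/eqP; rewrite -rip_eq0.
have -> : n2 y = n2 g by exact: (cvg_unique _ h2 h1).
by rewrite g0 rip0l.
Unshelve. all: by end_near.
Qed.

End Existence.

Lemma kyp_transfer S S' : selfadjoint S -> selfadjoint S' ->
  form_sub S S' -> form_sub S' S -> kyp Sg S -> kyp Sg S'.
Proof.
move=> sS sS' h h' kS x s' u S'xs'; have [s Sxs ns] := h' _ _ S'xs'.
have [r [Sr nr]] := kS x s u Sxs; have [r' Sr' nr'] := h _ _ Sr.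
by exists r'; rewrite nr' -ns.
Qed.

Lemma core_transfer S S' : selfadjoint S -> selfadjoint S' ->
  form_sub S S' -> form_sub S' S -> reach_core S -> reach_core S'.
Proof.
move=> sS sS' h h' cS x s' e S'xs' e0; have [s Sxs ns] := h' _ _ S'xs'.
have [v [r [rv Svr h1 h2]]] := cS _ _ _ Sxs e0.
have [r' Sr' nr'] := h _ _ Svr; exists v, r'; split => //.
have [q Sq <-] := h' _ _ (opB (sa_op sS') Sr' S'xs').
by rewrite (op_fun (sa_op sS) Sq (opB (sa_op sS) Svr Sxs)).
Qed.

Theorem RIcirc_unique : exists H, RIcirc Sg = [set H] /\
  forall y, delta (adj_system Sg) (op_inv H) y = 0.
Proof.
have [S [sS nS iS kS [cS dS]]] := storage_operator.
pose H := op_comp S S.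
have sH : selfadjoint H by exact: sa_square.
have pH : positive_op H by exact: sa_square_pos.
have [sS' nS' SS'] : [/\ selfadjoint (op_sqrt H), nonneg_op (op_sqrt H)
    & op_comp (op_sqrt H) (op_sqrt H) = H].
  by apply: op_sqrt_good; right; exists S.
(* [op_sqrt H] is a root of [H] not known to be [S]; the properties of [S] are carried over through
   equality of the forms. *)
set S' := op_sqrt H in sS' nS' SS'.
have f1 : form_sub S S' by exact: square_form_sub.
have f2 : form_sub S' S by exact: square_form_sub.
have iS' x : S' (x, 0) -> x = 0.
  move=> /f2[s Sxs /eqP]; rewrite rip0l rip_eq0 => /eqP s0.
  by apply: iS; rewrite -s0.
have kS' := kyp_transfer sS sS' f1 f2 kS.
have cS' := core_transfer sS sS' f1 f2 cS.
have dS' := dS S' sS' iS' kS' f2.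
have RH : RIcirc Sg H by exact: RIcirc_intro.
exists H; split.
  apply/seteqP; split=> [H' RH'|_ ->//] /=.
  have [[s1 SS1 i1] k1 d1 c1] := RIcirc_props RH'.
  have g1 : form_sub (op_sqrt H') S'.
    by apply: kyp_form_sub => //; exact: kyp_dom_reach.
  have g2 : form_sub S' (op_sqrt H').
    by apply: kyp_form_sub => //; exact: kyp_dom_reach.
  by rewrite -SS1 -SS'; apply/seteqP; split; exact: form_sub_square.
(* Likewise [K] is compared with the root [S'^-1] of [H^-1] only through the forms. *)
pose K := op_sqrt (op_inv H).
have sSi := sa_inv sS' iS'.
have KK : op_comp (op_inv S') (op_inv S') = op_inv H.
  by rewrite -SS'; apply/seteqP; split=> -[x y] [z h1 h2]; exists z.
have nSi : nonneg_op (op_inv S').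
  apply: sa_nonneg => // x s h; rewrite ripC.
  exact: (nonneg_rip nS').
have [sK nK KKK] : [/\ selfadjoint K, nonneg_op K & op_comp K K = op_inv H].
  by apply: op_sqrt_good; right; exists (op_inv S').
have fK : form_sub (op_inv S') K by apply: square_form_sub => //; rewrite KK.
have bSg' : bounded_system (adj_system Sg) by split; exact: adj_bounded.
have hK y : exists k, K (Cs y, k) /\ n2 k + n2 (Ds y) = n2 y.
  have R0 : Rs 0 by exact: (dual_reach_subspace Sg).1.
  have RC : Rs (Cs y) by have := dual_reachS bSg y R0; rewrite -/As -/Cs linop0 // add0r.
  have [g [Sg1 n1]] := dual_reach_ran sS' kS' RC.
  have [k Kk nk] := fK (Cs y) g Sg1.
  exists k; split => //; rewrite nk n1.
  have := conservation bSg orth y R0; rewrite -/As -/Bs -/Cs -/Ds.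
  by rewrite (linop0 lAs) (linop0 lBs) !add0r (sf_00 (qform_form bSg)) add0r.
have CK y : dom K (Cs y) by have [k [h _]] := hK y; exists k.
have nd y : rip (delta (adj_system Sg) (op_inv H) y) y = 0.
  have [k [h e]] := hK y.
  rewrite (delta_rip bSg' sK CK).
  have -> : sqrtB (adj_system Sg) (op_inv H) y = k by exact: (appE (sa_op sK) h).
  by rewrite /= -/Ds; move: e; lra.
move=> y; apply: eq_rip => y'; rewrite rip0r ripC.
have bK := sqrtB_bounded bSg' sK CK.
have lK := bop_lin bK.
(* The quadratic form of the defect vanishes, hence by polarization its bilinear form. *)
have := nd (y + y'); have := nd y; have := nd y'.
rewrite !(delta_rip bSg' sK CK) /= -/Ds !(linopD lDs) !(linopD lK) !n2D; lra.
Qed.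

End Assembly.

(** * Cauchy estimates on the disc *)

Section ComplexDifferentiability.
Variable R : realType.
Local Notation C := R[i].
Local Notation nc := (@Normc.normc R).
Implicit Types (f g : C -> C) (z w : C).

Lemma normrcE z : `|z| = (nc z)%:C%C.
Proof. by []. Qed.

Lemma nc_ge0 z : 0 <= nc z.
Proof. by rewrite -ler0c -normrcE. Qed.

Lemma ncM z w : nc (z * w) = nc z * nc w.
Proof. exact: Normc.normcM. Qed.

Lemma ncV z : nc z^-1 = (nc z)^-1.
Proof. exact: Normc.normcV. Qed.

Lemma ncN z : nc (- z) = nc z.
Proof. by apply: complexI; rewrite -!normrcE normrN. Qed.

Lemma ncB z w : nc (z - w) = nc (w - z).
Proof. by rewrite -ncN opprB. Qed.

Lemma ncD_le z w : nc (z + w) <= nc z + nc w.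
Proof. by rewrite -lecR rmorphD -!normrcE ler_normD. Qed.

Lemma ncB_le z w : nc z - nc w <= nc (z - w).
Proof. by rewrite lerBlDr -{1}(subrK w z) ncD_le. Qed.

Lemma nc0 : nc 0 = 0.
Proof. exact: Normc.normc0. Qed.

Lemma nc1 : nc 1 = 1.
Proof. exact: Normc.normc1. Qed.

Lemma nc_eq0 z : (nc z == 0) = (z == 0).
Proof. by apply/eqP/eqP => [/Normc.eq0_normc//|->]; exact: nc0. Qed.

Lemma nc_gt0 z : (0 < nc z) = (z != 0).
Proof. by rewrite lt_neqAle nc_ge0 andbT eq_sym nc_eq0. Qed.

Lemma nc_real (a : R) : nc a%:C%C = `|a|.
Proof. by rewrite /= expr0n /= addr0 sqrtr_sqr. Qed.

Lemma ncX z n : nc (z ^+ n) = nc z ^+ n.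
Proof. by elim: n => [|n IH]; rewrite ?expr0 ?nc1 // !exprS ncM IH. Qed.

Lemma sqr_nc z : nc z ^+ 2 = complex.Re z ^+ 2 + complex.Im z ^+ 2.
Proof. by case: z => a b /=; rewrite sqr_sqrtr // addr_ge0 ?sqr_ge0. Qed.

Lemma Re_le_nc z : `|complex.Re z| <= nc z.
Proof.
rewrite -(@ler_pXn2r _ 2) ?nnegrE ?nc_ge0 // sqr_nc real_normK ?num_real //.
by rewrite lerDl sqr_ge0.
Qed.

Lemma Im_le_nc z : `|complex.Im z| <= nc z.
Proof.
rewrite -(@ler_pXn2r _ 2) ?nnegrE ?nc_ge0 // sqr_nc real_normK ?num_real //.
by rewrite lerDr sqr_ge0.
Qed.

Lemma nc_le_ReIm z : nc z <= `|complex.Re z| + `|complex.Im z|.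
Proof.
rewrite -(@ler_pXn2r _ 2) ?nnegrE ?nc_ge0 ?addr_ge0 // sqr_nc.
rewrite -(real_normK (num_real (complex.Re z))) -(real_normK (num_real (complex.Im z))).
by have := mulr_ge0 (normr_ge0 (complex.Re z)) (normr_ge0 (complex.Im z)); nra.
Qed.

Definition ccont f z : Prop := forall e : R, 0 < e ->
  exists2 d : R, 0 < d & forall w, nc (w - z) < d -> nc (f w - f z) <= e.

(* Caratheodory's form of complex differentiability. *)
Definition cdiff f z : Prop := exists2 psi, ccont psi z &
  exists2 d : R, 0 < d & forall w, nc (w - z) < d -> f w = f z + psi w * (w - z).

Lemma ccont_cst (c : C) z : ccont (fun=> c) z.
Proof. by move=> e e0; exists 1 => // w _; rewrite subrr nc0 ltW. Qed.

Lemma ccont_id z : ccont id z.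
Proof. by move=> e e0; exists e => // w; exact: ltW. Qed.

Lemma ccontD f g z : ccont f z -> ccont g z -> ccont (fun w => f w + g w) z.
Proof.
move=> hf hg e e0; have e2 : 0 < e / 2 by rewrite divr_gt0.
have [d1 d10 h1] := hf _ e2; have [d2 d20 h2] := hg _ e2.
exists (Num.min d1 d2); first by rewrite lt_min d10.
move=> w; rewrite lt_min => /andP[/h1 k1 /h2 k2].
rewrite opprD addrACA; apply: le_trans (ncD_le _ _) _; lra.
Qed.

Lemma ccontM f g z : ccont f z -> ccont g z -> ccont (fun w => f w * g w) z.
Proof.
move=> hf hg e e0.
pose M := nc (f z) + nc (g z) + 1.
have M0 : 0 < M by have := nc_ge0 (f z); have := nc_ge0 (g z); rewrite /M; lra.
have e2 : 0 < e / (2 * M) by rewrite divr_gt0 // mulr_gt0.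
have [d1 d10 h1] := hf _ e2; have [d2 d20 h2] := hg _ e2.
have [d3 d30 h3] := hg 1 ltr01.
exists (Num.min d1 (Num.min d2 d3)); first by rewrite !lt_min d10 d20.
move=> w; rewrite !lt_min => /and3P[/h1 k1 /h2 k2 /h3 k3].
have -> : f w * g w - f z * g z = (f w - f z) * g w + f z * (g w - g z) by ring.
apply: le_trans (ncD_le _ _) _; rewrite !ncM.
have gw : nc (g w) <= M.
  by have := ncB_le (g w) (g z); have := nc_ge0 (f z); rewrite /M; lra.
have fz : nc (f z) <= M by have := nc_ge0 (g z); rewrite /M; lra.
have := ler_pM (nc_ge0 _) (nc_ge0 _) k1 gw.
have := ler_pM (nc_ge0 _) (nc_ge0 _) fz k2.
have -> : e / (2 * M) * M = e / 2 by field; rewrite gt_eqF.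
have -> : M * (e / (2 * M)) = e / 2 by field; rewrite gt_eqF.
lra.
Qed.

Lemma ccontN f z : ccont f z -> ccont (fun w => - f w) z.
Proof.
by move=> hf e /hf[d d0 h]; exists d => // w /h; rewrite -opprD ncN.
Qed.

Lemma ccont_neq0 f z : ccont f z -> f z != 0 ->
  exists2 d : R, 0 < d & forall w, nc (w - z) < d -> nc (f z) / 2 <= nc (f w).
Proof.
move=> hf fz0; have h0 : 0 < nc (f z) / 2 by rewrite divr_gt0 // nc_gt0.
have [d d0 hd] := hf _ h0; exists d => // w /hd.
by have := ncB_le (f z) (f w); rewrite ncB; lra.
Qed.

Lemma ccontV f z : ccont f z -> f z != 0 -> ccont (fun w => (f w)^-1) z.
Proof.
move=> hf fz0 e e0.
have a0 : 0 < nc (f z) by rewrite nc_gt0.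
have [d1 d10 h1] := ccont_neq0 hf fz0.
have e2 : 0 < e * (nc (f z) ^+ 2 / 2) by rewrite mulr_gt0 // divr_gt0 // exprn_gt0.
have [d2 d20 h2] := hf _ e2.
exists (Num.min d1 d2); first by rewrite lt_min d10.
move=> w; rewrite lt_min => /andP[/h1 k1 /h2 k2].
have fw : 0 < nc (f w) by lra.
have fw0 : f w != 0 by rewrite -nc_gt0.
have -> : (f w)^-1 - (f z)^-1 = - (f w - f z) / (f w * f z).
  by field; rewrite fw0 fz0.
rewrite ncM ncN ncV ncM ler_pdivrMr ?mulr_gt0 //.
apply: le_trans k2 _; rewrite ler_wpM2l ?(ltW e0) // expr2 mulrAC.
by rewrite ler_wpM2r // ltW.
Qed.

Lemma ccont_comp f g z : ccont g z -> ccont f (g z) -> ccont (f \o g) z.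
Proof.
move=> hg hf e /hf[d d0 h1]; have d2 : 0 < d / 2 by rewrite divr_gt0.
have [d' d'0 h2] := hg _ d2; exists d' => // w /h2 h; apply: h1; lra.
Qed.

Lemma ccont_near f g z (d : R) : 0 < d ->
  (forall w, nc (w - z) < d -> f w = g w) -> ccont f z -> ccont g z.
Proof.
move=> d0 fg hf e /hf[d' d'0 h]; exists (Num.min d d'); first by rewrite lt_min d0.
move=> w; rewrite lt_min => /andP[k1 k2].
by rewrite -!fg ?h // subrr nc0.
Qed.

Lemma cdiff_cont f z : cdiff f z -> ccont f z.
Proof.
move=> [psi hp [d d0 h]].
apply: (@ccont_near (fun w => f z + psi w * (w - z)) f z d d0).
  by move=> w /h.
apply: ccontD; first exact: ccont_cst.
apply: ccontM => //; apply: ccontD; [exact: ccont_id|exact: ccont_cst].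
Qed.

Lemma cdiff_cst (c : C) z : cdiff (fun=> c) z.
Proof.
exists (fun=> 0); first exact: ccont_cst.
by exists 1 => // w _; rewrite mul0r addr0.
Qed.

Lemma cdiff_id z : cdiff id z.
Proof.
exists (fun=> 1); first exact: ccont_cst.
by exists 1 => // w _; rewrite mul1r addrC subrK.
Qed.

Lemma cdiffD f g z : cdiff f z -> cdiff g z -> cdiff (fun w => f w + g w) z.
Proof.
move=> [p hp [d d0 h]] [q hq [d' d'0 h']].
exists (fun w => p w + q w); first exact: ccontD.
exists (Num.min d d'); first by rewrite lt_min d0.
by move=> w; rewrite lt_min => /andP[/h -> /h' ->]; ring.
Qed.

Lemma cdiffM f g z : cdiff f z -> cdiff g z -> cdiff (fun w => f w * g w) z.
Proof.
move=> df dg; have cg := cdiff_cont dg.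
move: df dg => [p hp [d d0 h]] [q hq [d' d'0 h']].
exists (fun w => p w * g w + f z * q w).
  by apply: ccontD; apply: ccontM => //; exact: ccont_cst.
exists (Num.min d d'); first by rewrite lt_min d0.
by move=> w; rewrite lt_min => /andP[/h -> /h' ->]; ring.
Qed.

Lemma cdiffN f z : cdiff f z -> cdiff (fun w => - f w) z.
Proof.
move=> [p hp [d d0 h]]; exists (fun w => - p w); first exact: ccontN.
by exists d => // w /h ->; ring.
Qed.

Lemma cdiffX f n z : cdiff f z -> cdiff (fun w => f w ^+ n) z.
Proof.
move=> df; elim: n => [|n IH].
  rewrite (_ : (fun w => _) = (fun=> 1)); first exact: cdiff_cst.
  by apply/funext => w; rewrite expr0.
rewrite (_ : (fun w => _) = (fun w => f w * f w ^+ n)); first exact: cdiffM.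
by apply/funext => w; rewrite exprS.
Qed.

Lemma cdiff_sum n (F : 'I_n -> C -> C) z : (forall i, cdiff (F i) z) ->
  cdiff (fun w => \sum_(i < n) F i w) z.
Proof.
elim: n F => [|n IH] F hF.
  rewrite (_ : (fun w => _) = (fun=> 0)); first exact: cdiff_cst.
  by apply/funext => w; rewrite big_ord0.
rewrite (_ : (fun w => _) = (fun w => F ord0 w + \sum_(i < n) F (lift ord0 i) w)).
  by apply: cdiffD => //; exact: IH.
by apply/funext => w; rewrite big_ord_recl.
Qed.

Lemma cdiffV f z : cdiff f z -> f z != 0 -> cdiff (fun w => (f w)^-1) z.
Proof.
move=> df fz0; have cf := cdiff_cont df.
have [d1 d10 h1] := ccont_neq0 cf fz0.
move: df => [p hp [d d0 h]].
exists (fun w => - p w * ((f w)^-1 * (f z)^-1)).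
  apply: ccontM; first exact: ccontN.
  by apply: ccontM; [exact: ccontV|exact: ccont_cst].
exists (Num.min d d1); first by rewrite lt_min d0.
move=> w; rewrite lt_min => /andP[/h e /h1 k].
have fw0 : f w != 0.
  by rewrite -nc_gt0; apply: lt_le_trans k; rewrite divr_gt0 // nc_gt0.
have -> : - p w * ((f w)^-1 * (f z)^-1) * (w - z) =
    - (p w * (w - z)) * ((f w)^-1 * (f z)^-1) by ring.
have -> : p w * (w - z) = f w - f z by rewrite e addrAC subrr add0r.
by field; rewrite fw0 fz0.
Qed.

Lemma cdiff_comp f g z : cdiff g z -> cdiff f (g z) -> cdiff (f \o g) z.
Proof.
move=> dg; have cg := cdiff_cont dg.
move: dg => [q hq [d' d'0 h']] [p hp [d d0 h]].
exists (fun w => p (g w) * q w).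
  by apply: ccontM => //; exact: (ccont_comp cg hp).
have d2 : 0 < d / 2 by rewrite divr_gt0.
have [d3 d30 h3] := cg _ d2.
exists (Num.min d' d3); first by rewrite lt_min d'0.
move=> w; rewrite lt_min => /andP[k1 /h3 k2] /=.
have gw : g w - g z = q w * (w - z) by rewrite (h' _ k1) addrAC subrr add0r.
have k3 : nc (g w - g z) < d by lra.
by rewrite (h _ k3) gw mulrA.
Qed.

End ComplexDifferentiability.

Section RealAnalysis.
Variable R : realType.
Implicit Types (f F G : R -> R) (x y a b k : R).

Definition rcont f : Prop := forall x (e : R), 0 < e ->
  exists2 d : R, 0 < d & forall y, `|y - x| < d -> `|f y - f x| <= e.

Lemma rcont_continuous f : rcont f -> continuous f.
Proof.
move=> h x; apply/cvgrPdist_le => e /(h x)[d d0 hd].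
apply/nbhs_ballP; exists d => //= y xy.
by rewrite distrC; apply: hd; rewrite distrC; exact: xy.
Qed.

Lemma is_derive_eps f x (a : R) : is_derive x 1 f a -> forall e : R, 0 < e ->
  exists2 d : R, 0 < d & forall h, `|h| < d -> `|f (x + h) - f x - a * h| <= e * `|h|.
Proof.
move=> [df fa] e e0.
have /cvgrPdist_le/(_ _ e0) : h^-1 *: ((f \o shift x) (h *: 1) - f x) @[h --> 0^'] --> a.
  by rewrite -fa.
move=> [d /= d0 hd]; exists d => // h hh.
have [->|h0] := eqVneq h 0; first by rewrite addr0 subrr mulr0 subr0 normr0 mulr0.
have := hd h; rewrite /ball_ /= sub0r normrN => /(_ hh h0).
rewrite /GRing.scale /= mulr1 (addrC h) => k.
have -> : f (x + h) - f x - a * h = - (a - h^-1 * (f (x + h) - f x)) * h.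
  by field; rewrite h0.
by rewrite normrM normrN ler_wpM2r.
Qed.

Lemma mv_bound F f a b (K : R) : a <= b ->
  (forall x, a <= x <= b -> is_derive x 1 F (f x)) ->
  (forall x, a <= x <= b -> `|f x| <= K) -> `|F b - F a| <= K * (b - a).
Proof.
rewrite le_eqVlt => /orP[/eqP <-|ab] dF fK; first by rewrite !subrr normr0 mulr0.
have [c cab ->] : exists2 c, c \in `]a, b[ & F b - F a = f c * (b - a).
  apply: MVT => //.
    by move=> x; rewrite in_itv /= => /andP[/ltW h1 /ltW h2]; apply: dF; rewrite h1.
  apply: derivable_within_continuous => x; rewrite in_itv /= => h.
  by have [] := dF x h.
rewrite normrM (ger0_norm (_ : 0 <= b - a)); last by rewrite subr_ge0 ltW.
apply: ler_wpM2r; first by rewrite subr_ge0 ltW.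
by apply: fK; move: cab; rewrite in_itv /= => /andP[/ltW -> /ltW ->].
Qed.

(** In the Cauchy estimates a contour integral is the increment of a primitive; integration enters
    only to produce one. *)
Lemma primitive_exists f a b : a < b -> rcont f ->
  exists F, forall x, a < x < b -> is_derive x 1 F (f x).
Proof.
move=> ab /rcont_continuous cf.
exists (fun x => \int[lebesgue_measure]_(t in [set` `[a, x]]) f t) => x /andP[ax xb].
have fi : lebesgue_measure.-integrable `[a, b] (EFin \o f).
  apply: continuous_compact_integrable; first exact: segment_compact.
  exact: continuous_subspaceT.
have [d1 d2] := continuous_FTC1_closed xb fi ax (cf x).
by split; [exact: d1|rewrite -derive1E; exact: d2].
Qed.

Lemma is_derive_congr F x (a b : R) : a = b -> is_derive x 1 F a -> is_derive x 1 F b.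
Proof. by move=> ->. Qed.

Lemma is_derive_sub F G x (a b : R) : is_derive x 1 F a -> is_derive x 1 G b ->
  is_derive x 1 (fun y => F y - G y) (a - b).
Proof. by move=> h1 h2; exact: (is_deriveB h1 h2). Qed.

Lemma is_derive_add F G x (a b : R) : is_derive x 1 F a -> is_derive x 1 G b ->
  is_derive x 1 (fun y => F y + G y) (a + b).
Proof. by move=> h1 h2; exact: (is_deriveD h1 h2). Qed.

Lemma is_derive_scale F x (k a : R) : is_derive x 1 F a ->
  is_derive x 1 (fun y => k * F y) (k * a).
Proof. by move=> h1; exact: (is_deriveZ k h1). Qed.

Lemma is_derive_quad (p q s x : R) :
  is_derive x 1 (fun y => p * y + q * (y - s) ^+ 2 / 2) (p + q * (x - s)).
Proof.
have h1 : is_derive x 1 (fun y : R => y) (1 : R) by exact: is_derive_id.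
have h2 : is_derive x 1 (fun y => y - s) (1 : R).
  by have := is_derive_sub h1 (is_derive_cst s x 1); rewrite subr0.
have h3 := is_derive_scale (q / 2) (is_deriveM h2 h2).
have h4 := is_derive_add (is_derive_scale p h1) h3.
have e : (fun y => p * y + q * (y - s) ^+ 2 / 2) =
    (fun y => p * y + q / 2 * ((fun y0 => y0 - s) * (fun y0 => y0 - s)) y).
  by apply/funext => y; rewrite fctE; field.
rewrite e; apply: is_derive_congr h4; rewrite /GRing.scale /=.
by field.
Qed.

Lemma is_derive_uniq_diff F G f a b : a <= b ->
  (forall x, a <= x <= b -> is_derive x 1 F (f x)) ->
  (forall x, a <= x <= b -> is_derive x 1 G (f x)) -> F b - F a = G b - G a.
Proof.
move=> ab dF dG.
have h x : a <= x <= b -> is_derive x 1 (fun y => F y - G y) (f x - f x).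
  by move=> hx; apply: is_derive_sub; [exact: dF|exact: dG].
have := mv_bound ab h (K := 0); rewrite mul0r normr_le0 => /(_ _)/eqP k.
have : F b - G b - (F a - G a) = 0 by apply: k => x _; rewrite subrr normr0.
lra.
Qed.

End RealAnalysis.

(** * Cauchy's theorem on rectangles *)

Section Goursat.
Variable R : realType.
Local Notation nc := (@Normc.normc R).
Variables (G : R[i] -> R[i]) (s0 s1 t0 t1 : R) (U V : R -> R -> R).
Hypotheses (s01 : s0 <= s1) (t01 : t0 <= t1).
Hypothesis dU : forall s t, s0 <= s <= s1 -> t0 <= t <= t1 ->
  is_derive s 1 (fun s' => U s' t) (complex.Re (G (s +i* t)%C)).
Hypothesis dV : forall s t, s0 <= s <= s1 -> t0 <= t <= t1 ->
  is_derive t 1 (V s) (complex.Im (G (s +i* t)%C)).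
Hypothesis dG : forall s t, s0 <= s <= s1 -> t0 <= t <= t1 -> cdiff G (s +i* t)%C.

(* The real part of the integral of [G] along the boundary of a rectangle. *)
Definition bdry a b c d : R :=
  (U b c - U a c) - (U b d - U a d) - (V b d - V b c) + (V a d - V a c).

(** The affine approximation of [G] at [s + i t] contributes nothing to the boundary term, and the
    deviation from it is at most [e l] on a perimeter of length [2 l]. *)
Lemma bdry_local (s t e : R) : s0 <= s <= s1 -> t0 <= t <= t1 -> 0 < e ->
  exists2 r : R, 0 < r & forall a b c d, s0 <= a -> a <= s <= b -> b <= s1 ->
    t0 <= c -> c <= t <= d -> d <= t1 -> (b - a) + (d - c) < r ->
    `|bdry a b c d| <= 2 * e * ((b - a) + (d - c)) ^+ 2.
Proof.
move=> hs ht e0; have [psi cpsi [r1 r10 hr1]] := dG hs ht.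
have [r2 r20 hr2] := cpsi _ e0.
exists (Num.min r1 r2); first by rewrite lt_min r10.
move=> a b c d a0 /andP[as_ sb] b1 c0 /andP[ct td] d1; rewrite lt_min => /andP[l1 l2].
set l := (b - a) + (d - c) in l1 l2 *.
set w0 := (s +i* t)%C in hr1 hr2 *.
case EL : (psi w0) => [p q]; case EG : (G w0) => [u v].
have approx x y : a <= x <= b -> c <= y <= d ->
    `|complex.Re (G (x +i* y)%C) - (u - q * (y - t) + p * (x - s))| <= e * l /\
    `|complex.Im (G (x +i* y)%C) - (v + q * (x - s) + p * (y - t))| <= e * l.
  move=> /andP[ax xb] /andP[cy yd].
  have hw : nc ((x +i* y)%C - w0) <= l.
    apply: le_trans (nc_le_ReIm _) _; rewrite /w0 /=.
    have h1 : `|x - s| <= b - a by rewrite ler_norml; apply/andP; split; lra.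
    have h2 : `|y - t| <= d - c by rewrite ler_norml; apply/andP; split; lra.
    by rewrite /l; lra.
  have eG := hr1 _ (le_lt_trans hw l1).
  have hp := hr2 _ (le_lt_trans hw l2).
  set z := (x +i* y)%C in hw eG hp *.
  have hr : nc ((psi z - psi w0) * (z - w0)) <= e * l.
    by rewrite ncM; apply: ler_pM; rewrite ?nc_ge0.
  have eq : (psi z - psi w0) * (z - w0) = G z - (G w0 + psi w0 * (z - w0)).
    by rewrite eG; ring.
  rewrite {}eq EL EG in hr.
  have := le_trans (Re_le_nc _) hr; have := le_trans (Im_le_nc _) hr.
  rewrite /z /w0; case: (G _) => gu gv /= h2 h1; split.
    by rewrite (_ : _ - _ = gu - (u + (p * (x - s) - q * (y - t)))) //; ring.
  by rewrite (_ : _ - _ = gv - (v + (p * (y - t) + q * (x - s)))) //; ring.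
have ab : a <= b by lra.
have cd : c <= d by lra.
have l0 : 0 <= e * l by apply: mulr_ge0; rewrite /l; lra.
have boundU y : c <= y <= d ->
    `|U b y - U a y - ((u - q * (y - t)) * b + p * (b - s) ^+ 2 / 2 -
       ((u - q * (y - t)) * a + p * (a - s) ^+ 2 / 2))| <= e * l * (b - a).
  move=> hy; have /andP[cy yd] := hy; pose k := u - q * (y - t).
  have h x : a <= x <= b -> is_derive x 1
      (fun x => U x y - (k * x + p * (x - s) ^+ 2 / 2))
      (complex.Re (G (x +i* y)%C) - (k + p * (x - s))).
    move=> /andP[ax xb]; apply: is_derive_sub; last exact: is_derive_quad.
    by apply: dU; apply/andP; split; lra.
  rewrite -/k [X in `|X|](_ : _ = U b y - (k * b + p * (b - s) ^+ 2 / 2) -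
    (U a y - (k * a + p * (a - s) ^+ 2 / 2))); last by ring.
  apply: (mv_bound ab h) => x hx; have [+ _] := approx x y hx hy; apply.
have boundV x : a <= x <= b ->
    `|V x d - V x c - ((v + q * (x - s)) * d + p * (d - t) ^+ 2 / 2 -
       ((v + q * (x - s)) * c + p * (c - t) ^+ 2 / 2))| <= e * l * (d - c).
  move=> hx; have /andP[ax xb] := hx; pose k := v + q * (x - s).
  have h y : c <= y <= d -> is_derive y 1
      (fun y => V x y - (k * y + p * (y - t) ^+ 2 / 2))
      (complex.Im (G (x +i* y)%C) - (k + p * (y - t))).
    move=> /andP[cy yd]; apply: is_derive_sub; last exact: is_derive_quad.
    by apply: dV; apply/andP; split; lra.
  rewrite -/k [X in `|X|](_ : _ = V x d - (k * d + p * (d - t) ^+ 2 / 2) -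
    (V x c - (k * c + p * (c - t) ^+ 2 / 2))); last by ring.
  apply: (mv_bound cd h) => y hy; have [_] := approx x y hx hy; apply.
have hc : c <= c <= d by rewrite lexx.
have hd : c <= d <= d by rewrite lexx andbT.
have ha : a <= a <= b by rewrite lexx.
have hb : a <= b <= b by rewrite lexx andbT.
have := boundU c hc; have := boundU d hd; have := boundV a ha; have := boundV b hb.
set e1 := (X in `|X| <= _); set e2 := (X in _ -> `|X| <= _ -> _).
set e3 := (X in _ -> _ -> `|X| <= _ -> _); set e4 := (X in _ -> _ -> _ -> `|X| <= _ -> _).
have -> : bdry a b c d = e4 - e3 - e1 + e2.
  by rewrite /bdry /e1 /e2 /e3 /e4; field.
move=> k1 k2 k3 k4.
have -> : 2 * e * l ^+ 2 = 2 * (e * l * (b - a)) + 2 * (e * l * (d - c)) by rewrite /l; ring.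
apply: le_trans (ler_normD _ _) _.
have := ler_normB (e4 - e3) e1; have := ler_normB e4 e3; lra.
Qed.

Let W := s1 - s0.
Let H := t1 - t0.
Let h n : R := 2^-1 ^+ n.

Let hS n : h n = 2 * h n.+1.
Proof. by rewrite /h exprS mulrA mulfV ?mul1r. Qed.

Let h0 n : 0 < h n.
Proof. by rewrite exprn_gt0 // invr_gt0. Qed.

Let q n (p : R * R) := bdry p.1 (p.1 + W * h n) p.2 (p.2 + H * h n).

Lemma bdry_step n (p : R * R) : exists p' : R * R,
  [/\ p'.1 = p.1 \/ p'.1 = p.1 + W * h n.+1, p'.2 = p.2 \/ p'.2 = p.2 + H * h n.+1
    & `|q n p| <= 4 * `|q n.+1 p'|].
Proof.
case: p => a c; pose w := W * h n.+1; pose k := H * h n.+1.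
have e : q n (a, c) = q n.+1 (a, c) + q n.+1 (a + w, c) + q n.+1 (a, c + k) + q n.+1 (a + w, c + k).
  rewrite /q /= (_ : a + W * h n = a + w + w); last by rewrite hS /w; ring.
  by rewrite (_ : c + H * h n = c + k + k) /bdry -/w -/k; [ring|rewrite hS /k; ring].
have := ler_normD (q n.+1 (a, c) + q n.+1 (a + w, c) + q n.+1 (a, c + k)) (q n.+1 (a + w, c + k)).
have := ler_normD (q n.+1 (a, c) + q n.+1 (a + w, c)) (q n.+1 (a, c + k)).
have := ler_normD (q n.+1 (a, c)) (q n.+1 (a + w, c)).
rewrite -e => k1 k2 k3.
have [h1|h1] := leP `|q n (a, c)| (4 * `|q n.+1 (a, c)|).
  by exists (a, c); split; [left|left|].
have [h2|h2] := leP `|q n (a, c)| (4 * `|q n.+1 (a + w, c)|).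
  by exists (a + w, c); split; [right|left|].
have [h3|h3] := leP `|q n (a, c)| (4 * `|q n.+1 (a, c + k)|).
  by exists (a, c + k); split; [left|right|].
by exists (a + w, c + k); split; [right|right|lra].
Qed.

Lemma dyadic_limit (L x0 : R) (x : nat -> R) : 0 <= L -> x 0%N = x0 ->
  (forall n, x n.+1 = x n \/ x n.+1 = x n + L * h n.+1) ->
  exists y, forall n, [/\ x0 <= x n, x n + L * h n <= x0 + L & x n <= y <= x n + L * h n].
Proof.
move=> L0 xx0 xS.
have Lh n : 0 <= L * h n.+1 by rewrite mulr_ge0 // ltW.
have up : {homo x : m n / (m <= n)%N >-> m <= n}.
  apply: homo_leq => //; first exact: le_trans.
  by move=> n; have [->//|->] := xS n; rewrite lerDl.
have dn m n : (m <= n)%N -> x n + L * h n <= x m + L * h m.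
  move=> /subnK <-; elim: (n - m)%N => [//|k IH]; apply: le_trans IH.
  have := Lh (k + m)%N; have := xS (k + m)%N; rewrite addSn (hS (k + m)).
  by move=> [->|->]; lra.
have ub m n : x m <= x n + L * h n.
  have [mn|/ltnW nm] := leqP m n.
    by apply: le_trans (up _ _ mn) _; rewrite lerDl mulr_ge0 // ltW.
  by apply: le_trans (dn _ _ nm); rewrite lerDl mulr_ge0 // ltW.
have hs : has_sup (range x).
  by split; [exists (x 0%N), 0%N|exists (x 0%N + L * h 0) => _ [m _ <-]; exact: ub].
exists (sup (range x)) => n; split.
- by rewrite -xx0; exact: up.
- by have := dn 0%N n (leq0n n); rewrite xx0 /h expr0 mulr1.
- apply/andP; split; first by apply: ub_le_sup; [exact: hs.2|exists n].
  by apply: ge_sup; [exact: hs.1|move=> _ [m _ <-]; exact: ub].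
Qed.

Lemma goursat : bdry s0 s1 t0 t1 = 0.
Proof.
have [nxt hn] := choice (fun np : nat * (R * R) => bdry_step np.1 np.2).
pose p := fix p n := if n is m.+1 then nxt (m, p m) else (s0, t0).
have W0 : 0 <= W by rewrite subr_ge0.
have H0 : 0 <= H by rewrite subr_ge0.
have [s hs] : exists y, forall n, [/\ s0 <= (p n).1, (p n).1 + W * h n <= s0 + W
    & (p n).1 <= y <= (p n).1 + W * h n].
  apply: (@dyadic_limit W s0 (fun n => (p n).1)) => // n.
  by have [] := hn (n, p n).
have [t ht] : exists y, forall n, [/\ t0 <= (p n).2, (p n).2 + H * h n <= t0 + H
    & (p n).2 <= y <= (p n).2 + H * h n].
  apply: (@dyadic_limit H t0 (fun n => (p n).2)) => // n.
  by have [] := hn (n, p n).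
have W1 : s0 + W = s1 by rewrite /W; ring.
have H1 : t0 + H = t1 by rewrite /H; ring.
have q0 : q 0 (p 0%N) = bdry s0 s1 t0 t1.
  by rewrite /q /h expr0 !mulr1 /= W1 H1.
have qn n : `|bdry s0 s1 t0 t1| * (h n * h n) <= `|q n (p n)|.
  rewrite -q0; elim: n => [|n IH]; first by rewrite /h expr0 !mulr1.
  have [_ _ /=] := hn (n, p n) => hle.
  by move: IH; rewrite (hS n); move: hle; change (p n.+1) with (nxt (n, p n)); lra.
have hsr : s0 <= s <= s1.
  by have [h1 h2 /andP[h3 h4]] := hs 0%N; rewrite -W1; apply/andP; split; lra.
have htr : t0 <= t <= t1.
  by have [h1 h2 /andP[h3 h4]] := ht 0%N; rewrite -H1; apply/andP; split; lra.
apply/eqP; rewrite -normr_le0; apply/ler_addgt0Pr => e e0; rewrite add0r.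
(* At level [n] the local bound is [2 (W + H)^2 h(n)^2] times the tolerance, and the quarter carries
   at least [h(n)^2] times the whole; the tolerance [e / M] absorbs the constant. *)
pose M := 2 * (W + H) ^+ 2 + 1.
have M0 : 0 < M by rewrite /M; have := sqr_ge0 (W + H); lra.
have e1 : 0 < e / M by rewrite divr_gt0.
have [r r0 hr] := bdry_local hsr htr e1.
have hsm : small h.
  apply: small_le (@small_inv R) => n; rewrite /h exprVn lef_pV2 ?posrE ?exprn_gt0 //.
  by rewrite -natrX ler_nat; exact: ltn_expl.
have r1 : 0 < r / (W + H + 1) by rewrite divr_gt0 //; lra.
have [n /(_ n (leqnn _)) hnr] := hsm _ r1.
have [a1 a2 a3] := hs n; have [c1 c2 c3] := ht n.
have := hr (p n).1 ((p n).1 + W * h n) (p n).2 ((p n).2 + H * h n) a1 a3 _ c1 c3 _ _.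
rewrite W1 in a2; rewrite H1 in c2 => /(_ a2 c2).
have -> : (p n).1 + W * h n - (p n).1 + ((p n).2 + H * h n - (p n).2) = (W + H) * h n by ring.
have small_r : (W + H) * h n < r.
  apply: le_lt_trans (_ : (W + H) * (r / (W + H + 1)) < r); first by apply: ler_wpM2l => //; lra.
  by rewrite mulrA ltr_pdivrMr; [rewrite mulrC ltr_pM2l //; lra|lra].
move=> /(_ small_r) hq.
have hh : 0 < h n * h n by rewrite mulr_gt0.
rewrite -(ler_pM2r hh); apply: le_trans (qn n) _; apply: le_trans hq _.
have -> : 2 * (e / M) * ((W + H) * h n) ^+ 2 = e * (h n * h n) * ((2 * (W + H) ^+ 2) / M).
  by field; rewrite gt_eqF.
have eh : 0 <= e * (h n * h n) by rewrite mulr_ge0 // ltW.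
rewrite -[leRHS]mulr1; apply: ler_wpM2l => //.
by rewrite ler_pdivrMr // mul1r /M lerDl.
Qed.

End Goursat.

(** * The mean value property on the disc *)

Section MeanValue.
Variable R : realType.
Local Notation nc := (@Normc.normc R).
Local Notation C := R[i].

Definition cexp (z : C) : C :=
  (expR (complex.Re z) * cos (complex.Im z) +i* (expR (complex.Re z) * sin (complex.Im z)))%C.

Lemma cexpD z w : cexp (z + w) = cexp z * cexp w.
Proof.
case: z => a b; case: w => c d; rewrite /cexp /= expRD cosD sinD.
by congr Complex; ring.
Qed.

Lemma nc_cexp z : nc (cexp z) = expR (complex.Re z).
Proof.
have e : nc (cexp z) ^+ 2 = expR (complex.Re z) ^+ 2.
  rewrite sqr_nc /= !exprMn -mulrDr cos2Dsin2 mulr1 //.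
by apply/eqP; rewrite -(@eqrXn2 _ 2) ?nc_ge0 ?expR_ge0 //; exact/eqP.
Qed.

Lemma cexp_small (e : R) : 0 < e -> exists2 d : R, 0 < d & forall h : C,
  nc h < d -> nc (cexp h - 1 - h) <= e * nc h.
Proof.
(* Here [9 = 1 + 3 + 3 + 2] collects the errors of the exponential, the cosine, the sine and the
   mixed product. *)
move=> e0; pose k := Num.min 1 (e / 9).
have k0 : 0 < k by rewrite lt_min ltr01 divr_gt0.
have k1 : k <= 1 by rewrite ge_min lexx.
have ke : 9 * k <= e.
  have : k <= e / 9 by rewrite ge_min lexx orbT.
  lra.
clearbody k; have [d1 d10 h1] := is_derive_eps (is_derive_expR (0 : R)) k0.
have [d2 d20 h2] := is_derive_eps (is_derive_cos (0 : R)) k0.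
have [d3 d30 h3] := is_derive_eps (is_derive_sin (0 : R)) k0.
exists (Num.min (Num.min d1 d2) (Num.min d3 (Num.min 1 k))).
  by rewrite !lt_min d10 d20 d30 ltr01 k0.
move=> z; rewrite !lt_min => /andP[/andP[z1 z2] /andP[z3 /andP[z4 z5]]].
have hp := Re_le_nc z; have hq := Im_le_nc z.
set p := complex.Re z in hp *; set q := complex.Im z in hq *.
have := h1 p (le_lt_trans hp z1); have := h2 q (le_lt_trans hq z2).
have := h3 q (le_lt_trans hq z3).
rewrite !add0r expR0 cos0 sin0 subr0 oppr0 mul0r subr0 !mul1r => b3 b2 b1.
have n0 := nc_ge0 z.
have p3 : expR p <= 3.
  have : expR p - 1 - p <= k * `|p| by apply: le_trans (ler_norm _) b1.
  have : p <= `|p| by exact: ler_norm.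
  have : k * `|p| <= 1 * 1 by apply: ler_pM => //; [exact: ltW|lra].
  by lra.
have p1 : `|expR p - 1| <= 2 * nc z.
  have -> : expR p - 1 = (expR p - 1 - p) + p by ring.
  apply: le_trans (ler_normD _ _) _.
  have : k * `|p| <= 1 * `|p| by apply: ler_wpM2r.
  lra.
have e3 := expR_gt0 p.
apply: le_trans (nc_le_ReIm _) _.
have -> : complex.Re (cexp z - 1 - z) = (expR p - 1 - p) + expR p * (cos q - 1).
  by rewrite /cexp -/p -/q /p; case: (z) => a b /=; ring.
have -> : complex.Im (cexp z - 1 - z) = expR p * (sin q - q) + (expR p - 1) * q.
  by rewrite /cexp -/p -/q /q; case: (z) => a b /=; ring.
have kz : k * `|q| <= k * nc z by apply: ler_wpM2l => //; exact: ltW.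
have kz' : k * `|p| <= k * nc z by apply: ler_wpM2l => //; exact: ltW.
have c1 : `|expR p * (cos q - 1)| <= 3 * (k * nc z).
  rewrite normrM gtr0_norm //; apply: ler_pM; rewrite ?normr_ge0 ?(ltW e3) //.
  exact: le_trans b2 kz.
have c2 : `|expR p * (sin q - q)| <= 3 * (k * nc z).
  rewrite normrM gtr0_norm //; apply: ler_pM; rewrite ?normr_ge0 ?(ltW e3) //.
  exact: le_trans b3 kz.
have c3 : `|(expR p - 1) * q| <= k * nc z * 2.
  have h : `|expR p - 1| * `|q| <= 2 * nc z * nc z.
    apply: ler_pM; [exact: normr_ge0|exact: normr_ge0|exact: p1|exact: hq].
  rewrite normrM; apply: le_trans h _.
  have : nc z * nc z <= nc z * k by apply: ler_wpM2l => //; exact: ltW.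
  lra.
have := ler_normD (expR p - 1 - p) (expR p * (cos q - 1)).
have := ler_normD (expR p * (sin q - q)) ((expR p - 1) * q).
have : 9 * k * nc z <= e * nc z by apply: ler_wpM2r.
lra.
Qed.

Lemma cdiff_cexp z : cdiff cexp z.
Proof.
have ce0 : cexp 0 = 1 by rewrite /cexp /= expR0 cos0 sin0 mulr1 mulr0.
pose psi h := if h == 0 then 1 else (cexp h - 1) / h : C.
have cpsi : ccont psi 0.
  move=> e e0; have [d d0 hd] := cexp_small e0; exists d => // w; rewrite subr0 => /hd h.
  rewrite /psi eqxx; case: eqVneq => [_|w0]; first by rewrite subrr nc0 ltW.
  have -> : (cexp w - 1) / w - 1 = (cexp w - 1 - w) / w by field.
  by rewrite ncM ncV ler_pdivrMr // nc_gt0.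
exists (fun w => cexp z * psi (w - z)).
  apply: ccontM; first exact: ccont_cst.
  have cs : ccont (fun w => w - z) z.
    by apply: ccontD; [exact: ccont_id|exact: ccont_cst].
  by apply: (ccont_comp cs); rewrite subrr.
exists 1 => // w _; rewrite -[in LHS](subrK z w) cexpD /psi; case: eqVneq => [->|w0].
  by rewrite ce0 mulr0 addr0 mul1r.
by field; rewrite w0.
Qed.

Lemma rcont_path (G : C -> C) (gam : R -> C) :
  (forall x y, nc (gam x - gam y) <= `|x - y|) -> (forall x, ccont G (gam x)) ->
  rcont (fun x => complex.Re (G (gam x))) /\ rcont (fun x => complex.Im (G (gam x))).
Proof.
move=> lip cG; split=> x e e0; have [d d0 hd] := cG x e e0; exists d => // y hy.
  rewrite -raddfB; apply: le_trans (Re_le_nc _) _; apply: hd.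
  exact: le_lt_trans (lip _ _) hy.
rewrite -raddfB; apply: le_trans (Im_le_nc _) _; apply: hd.
exact: le_lt_trans (lip _ _) hy.
Qed.

Definition cis (t : R) : C := (cos t +i* sin t)%C.

Lemma nc_cis t : nc (cis t) = 1.
Proof. by rewrite /cis /= cos2Dsin2 sqrtr1. Qed.

Lemma cis_2pi : cis (2 * pi) = cis 0.
Proof. by rewrite mulr_natl /cis cos2pi sin2pi cos0 sin0. Qed.

Lemma cexpE s t : cexp (s +i* t)%C = (expR s)%:C%C * cis t.
Proof. by rewrite /cexp /cis /=; congr Complex; ring. Qed.

Section Disc.
Variable f : C -> C.
Hypothesis df : forall z, nc z < 1 -> cdiff f z.

(** Logarithmic coordinates: the circle of radius [expR s] is the vertical segment at [s], and the
    factor ['i] turns [Re f] along it into the [Im G] that [bdry] integrates vertically. *)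
Let G w := 'i%C * f (cexp w).

Let ImG w : complex.Im (G w) = complex.Re (f (cexp w)).
Proof. by rewrite /G; case: (f _) => a b /=; ring. Qed.

Let dG w : complex.Re w < 0 -> cdiff G w.
Proof.
move=> w0; apply: cdiffM; first exact: cdiff_cst.
apply: (cdiff_comp (cdiff_cexp w)); apply: df.
by rewrite nc_cexp -expR0 ltr_expR.
Qed.

Let pi2 : (0 : R) < 2 * pi.
Proof. by rewrite mulr_gt0 // pi_gt0. Qed.

Lemma path_t s x y : nc ((s +i* x)%C - (s +i* y)%C) <= `|x - y|.
Proof. by apply: le_trans (nc_le_ReIm _) _; rewrite /= subrr normr0 add0r. Qed.

Lemma circle_primitive s : s < 0 -> exists F, forall t, 0 <= t <= 2 * pi ->
  is_derive t 1 F (complex.Re (f (cexp (s +i* t)%C))).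
Proof.
move=> s0; have [|_ c] := @rcont_path G (fun t => (s +i* t)%C) (path_t s).
  by move=> t; apply: cdiff_cont; exact: dG.
(* The interval is enlarged so that the primitive is differentiable at both ends of [[0, 2 pi]]. *)
have lt1 : (- 1 : R) < 2 * pi + 1 by have := pi2; lra.
have [F hF] := primitive_exists lt1 c.
exists F => t /andP[t0 t1]; rewrite -ImG; apply: hF.
by apply/andP; split; lra.
Qed.

(** Goursat on the rectangle between the two segments; the horizontal sides cancel by periodicity of
    [cexp]. *)
Lemma circle_const s0 s1 F0 F1 : s0 < s1 -> s1 < 0 ->
  (forall t, 0 <= t <= 2 * pi -> is_derive t 1 F0 (complex.Re (f (cexp (s0 +i* t)%C)))) ->
  (forall t, 0 <= t <= 2 * pi -> is_derive t 1 F1 (complex.Re (f (cexp (s1 +i* t)%C)))) ->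
  F1 (2 * pi) - F1 0 = F0 (2 * pi) - F0 0.
Proof.
move=> s01 s10 d0 d1.
have hV s : exists F, s0 <= s <= s1 -> forall t, 0 <= t <= 2 * pi ->
    is_derive t 1 F (complex.Im (G (s +i* t)%C)).
  have [/andP[a b]|n] := boolP (s0 <= s <= s1); last by exists (fun=> 0).
  have [F hF] := circle_primitive (le_lt_trans b s10).
  by exists F => _ t ht; rewrite ImG; exact: hF.
have [V dV] := choice hV.
have sl : s0 - 1 < s1 + 1 by lra.
(* The primitive is chosen as a function of the integrand, so the equal integrands at heights 0 and
   [2 pi] get the same one and cancel exactly. *)
have hP (g : R -> R) : exists F, rcont g -> forall x, s0 - 1 < x < s1 + 1 -> is_derive x 1 F (g x).
  have [c|n] := pselect (rcont g); last by exists (fun=> 0).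
  by have [F hF] := primitive_exists sl c; exists F.
have [P dP] := choice hP.
(* Capping [s] at [s1] keeps the argument in the left half-plane, which makes the integrand
   continuous on the whole line. *)
pose u t s := complex.Re (G (Num.min s s1 +i* t)%C).
have cu t : rcont (u t).
  have [||c _] := @rcont_path G (fun s => (Num.min s s1 +i* t)%C).
  - move=> x y; apply: le_trans (nc_le_ReIm _) _; rewrite /= subrr normr0 addr0.
    rewrite /Num.min; case: ltP => h1; case: ltP => h2 //.
    + have := ler_norm (x - y); have := ler_norm (- (x - y)); rewrite normrN.
      by move=> k1 k2; rewrite ler_norml; apply/andP; split; lra.
    + have := ler_norm (x - y); have := ler_norm (- (x - y)); rewrite normrN.
      by move=> k1 k2; rewrite ler_norml; apply/andP; split; lra.
    + by rewrite subrr normr0.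
  - move=> x; apply: cdiff_cont; apply: dG => /=; apply: le_lt_trans s10.
    by rewrite ge_min lexx orbT.
  - exact: c.
have uE t s : s <= s1 -> u t s = complex.Re (G (s +i* t)%C).
  by move=> h; rewrite /u min_l.
have per : u 0 = u (2 * pi).
  by apply/funext => s; rewrite /u /G !cexpE cis_2pi.
have := @goursat _ G s0 s1 0 (2 * pi) (fun s t => P (u t) s) V (ltW s01) (ltW pi2).
have -> : bdry (fun s t => P (u t) s) V s0 s1 0 (2 * pi) =
    - (V s1 (2 * pi) - V s1 0) + (V s0 (2 * pi) - V s0 0).
  by rewrite /bdry per; ring.
have hs0 : s0 <= s0 <= s1 by rewrite lexx ltW.
have hs1 : s0 <= s1 <= s1 by rewrite lexx ltW.
have e0 : V s0 (2 * pi) - V s0 0 = F0 (2 * pi) - F0 0.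
  by apply: is_derive_uniq_diff (ltW pi2) (dV _ hs0) _ => t ht; rewrite ImG; exact: d0.
have e1 : V s1 (2 * pi) - V s1 0 = F1 (2 * pi) - F1 0.
  by apply: is_derive_uniq_diff (ltW pi2) (dV _ hs1) _ => t ht; rewrite ImG; exact: d1.
rewrite e0 e1 => h; suff : - (F1 (2 * pi) - F1 0) + (F0 (2 * pi) - F0 0) = 0 by lra.
apply: h.
- move=> s t /andP[a b] _; rewrite -uE //; apply: dP => //.
  by apply/andP; split; lra.
- by move=> s t hs ht; exact: dV.
- by move=> s t /andP[a b] _; apply: dG; exact: le_lt_trans b s10.
Qed.

(** The mean does not depend on the radius, and on circles shrinking to 0 it tends to the value at
    the centre. *)
Lemma mean_value (rho : R) F : 0 < rho -> rho < 1 ->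
  (forall t, 0 <= t <= 2 * pi -> is_derive t 1 F (complex.Re (f (rho%:C%C * cis t)))) ->
  F (2 * pi) - F 0 = 2 * pi * complex.Re (f 0).
Proof.
move=> r0 r1 dF; pose s1 := ln rho.
have s10 : s1 < 0 by apply: ln_lt0; rewrite r0.
have es1 : expR s1 = rho by rewrite lnK ?posrE.
apply/eqP; rewrite -subr_eq0 -normr_le0; apply/ler_addgt0Pr => e e0; rewrite add0r.
have e1 : 0 < e / (2 * pi) by rewrite divr_gt0.
have [d d0 hd] : exists2 d, 0 < d & forall w, nc (w - 0) < d -> nc (f w - f 0) <= e / (2 * pi).
  have n0 : nc 0 < 1 by rewrite nc0.
  exact: (cdiff_cont (df n0) e1).
pose s0 := Num.min s1 (ln (d / 2)) - 1.
have s01 : s0 < s1.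
  have : Num.min s1 (ln (d / 2)) <= s1 by rewrite ge_min lexx.
  by rewrite /s0; lra.
have es0 : expR s0 < d.
  have h : Num.min s1 (ln (d / 2)) <= ln (d / 2) by rewrite ge_min lexx orbT.
  apply: (@lt_trans _ _ (d / 2)); last lra.
  rewrite -[ltRHS]lnK ?posrE ?divr_gt0 // ltr_expR /s0; lra.
have [F0 dF0] := circle_primitive (lt_trans s01 s10).
have dF1 t : 0 <= t <= 2 * pi -> is_derive t 1 F (complex.Re (f (cexp (s1 +i* t)%C))).
  by rewrite cexpE es1; exact: dF.
rewrite (circle_const s01 s10 dF0 dF1).
pose c := complex.Re (f 0).
have hq (t : R) : is_derive t 1 (fun y => c * y + 0 * (y - 0) ^+ 2 / 2) (c + 0 * (t - 0)).
  exact: is_derive_quad.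
have h (t : R) : 0 <= t <= 2 * pi -> is_derive t 1 (fun y => F0 y - (c * y + 0 * (y - 0) ^+ 2 / 2))
    (complex.Re (f (cexp (s0 +i* t)%C)) - (c + 0 * (t - 0))).
  by move=> ht; exact: (is_derive_sub (dF0 t ht) (hq t)).
have := mv_bound (ltW pi2) h (K := e / (2 * pi)).
rewrite subr0 divfK ?gt_eqF // => k.
have {k} := k _; rewrite !mul0r !mulr0 !addr0 subr0.
have -> : F0 (2 * pi) - c * (2 * pi) - F0 0 = F0 (2 * pi) - F0 0 - 2 * pi * c by ring.
apply=> t _; rewrite mul0r addr0 /c -raddfB; apply: le_trans (Re_le_nc _) _; apply: hd.
by rewrite subr0 nc_cexp.
Qed.

End Disc.

Lemma mean_max (f : C -> C) (rho K : R) : (forall z, nc z < 1 -> cdiff f z) ->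
  0 < rho -> rho < 1 -> (forall z, nc z = rho -> nc (f z) <= K) -> nc (f 0) <= K.
Proof.
move=> df r0 r1 hK; have n0 := nc_ge0 (f 0).
have K0 : 0 <= K.
  apply: le_trans (nc_ge0 (f rho%:C%C)) _; apply: hK.
  by rewrite nc_real ger0_norm // ltW.
have [->|f0] := eqVneq (f 0) 0; first by rewrite nc0.
have a0 : 0 < nc (f 0) by rewrite nc_gt0.
(* Rotate [f] so that its value at 0 becomes positive. *)
pose c := (nc (f 0))%:C%C / f 0.
have nc1' : nc c = 1 by rewrite /c ncM ncV nc_real gtr0_norm // mulfV // gt_eqF.
pose g z := c * f z.
have dg z : nc z < 1 -> cdiff g z.
  by move=> hz; apply: cdiffM; [exact: cdiff_cst|exact: df].
have pi2 : (0 : R) < 2 * pi by rewrite mulr_gt0 // pi_gt0.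
have [F dF] := circle_primitive dg (ln_lt0 (introT andP (conj r0 r1))).
have e t : cexp (ln rho +i* t)%C = rho%:C%C * cis t by rewrite cexpE lnK ?posrE.
have dF' t : 0 <= t <= 2 * pi -> is_derive t 1 F (complex.Re (g (rho%:C%C * cis t))).
  by rewrite -e; exact: dF.
have := mean_value dg r0 r1 dF'.
have -> : complex.Re (g 0) = nc (f 0).
  by rewrite /g /c divfK //.
have := mv_bound (ltW pi2) dF' (K := K); rewrite subr0 => h1 h2.
have : `|F (2 * pi) - F 0| <= K * (2 * pi).
  apply: h1 => t _; apply: le_trans (Re_le_nc _) _; rewrite ncM nc1' mul1r; apply: hK.
  by rewrite ncM nc_cis mulr1 nc_real gtr0_norm.
rewrite h2 normrM (gtr0_norm pi2) (ger0_norm n0) mulrC ler_pM2r //.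
Qed.



End MeanValue.

(** * Maximum principle and Taylor remainders *)

Section Taylor.
Variable R : realType.
Local Notation nc := (@Normc.normc R).
Local Notation C := R[i].

Lemma le_of_pow (x K : R) n : 0 <= x ->
  (forall r, 0 < r -> r < 1 -> x * r ^+ n <= K) -> x <= K.
Proof.
move=> x0 h; apply/ler_addgt0Pr => e e0.
have bern (d : R) : 0 <= d -> d <= 1 -> 1 - n%:R * d <= (1 - d) ^+ n.
  move=> d0 d1; elim: (n) => [|m IH]; first by rewrite mul0r subr0 expr0.
  have d2 : 0 <= 1 - d by rewrite subr_ge0.
  rewrite exprS; apply: le_trans (ler_wpM2l d2 IH).
  have m0 : 0 <= m%:R * (d * d) by rewrite !mulr_ge0.
  by rewrite -natr1; move: m0; lra.
pose d := Num.min (2^-1) (e / ((x + 1) * (n%:R + 1))).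
have p0 : 0 < (x + 1) * (n%:R + 1) by rewrite mulr_gt0 // ltr_wpDl.
have d0 : 0 < d by rewrite lt_min invr_gt0 ltr0n divr_gt0.
have d1 : d <= 2^-1 by rewrite ge_min lexx.
have d2 : d * ((x + 1) * (n%:R + 1)) <= e.
  by rewrite -ler_pdivlMr // ge_min lexx orbT.
clearbody d.
have := h (1 - d); rewrite subr_gt0 gtrBl => /(_ _ d0).
have dl : d < 1 by lra.
move=> /(_ dl) k; have := ler_wpM2l x0 (bern d (ltW d0) (ltW dl)).
have : 0 <= d * (x + n%:R + 1) by rewrite mulr_ge0 ?addr_ge0 // ltW.
move: k d2; lra.
Qed.

Lemma cdiff_near (f g : C -> C) z (d : R) : 0 < d ->
  (forall w, nc (w - z) < d -> f w = g w) -> cdiff f z -> cdiff g z.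
Proof.
move=> d0 fg [p hp [d' d'0 h]]; exists p => //.
exists (Num.min d d'); first by rewrite lt_min d0.
move=> w; rewrite lt_min => /andP[k1 k2].
rewrite -(fg w k1) -(fg z); last by rewrite subrr nc0.
exact: h.
Qed.

Section Moebius.
Variable a : C.
Hypothesis a1 : nc a < 1.

Let den z : C := 1 + (a^*)%C * z.
(** The automorphism of the disc taking 0 to [a]; it carries estimates at the centre to the point
    [a]. *)
Definition moebius z : C := (z + a) * (den z)^-1.

Let nca : nc (a^*)%C = nc a.
Proof. by case: a => p q; rewrite /= sqrrN. Qed.

Lemma moebius_id z : nc (den z) ^+ 2 - nc (z + a) ^+ 2 = (1 - nc a ^+ 2) * (1 - nc z ^+ 2).
Proof. by rewrite !sqr_nc /den; case: a => p q; case: z => x y /=; ring. Qed.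

Lemma moebius_den z : nc z < 1 -> 1 - nc a <= nc (den z).
Proof.
move=> z1; have := ncB_le 1 (- ((a^*)%C * z)); rewrite opprK ncN nc1 ncM nca.
have : nc a * nc z <= nc a * 1 by apply: ler_wpM2l; [exact: nc_ge0|exact: ltW].
by rewrite /den; lra.
Qed.

Lemma moebius_den0 z : nc z < 1 -> den z != 0.
Proof. by move=> /moebius_den h; rewrite -nc_gt0; have := a1; lra. Qed.

Lemma moebius_cdiff z : nc z < 1 -> cdiff moebius z.
Proof.
move=> z1; apply: cdiffM; first by apply: cdiffD; [exact: cdiff_id|exact: cdiff_cst].
apply: cdiffV; last exact: moebius_den0.
apply: cdiffD; first exact: cdiff_cst.
by apply: cdiffM; [exact: cdiff_cst|exact: cdiff_id].
Qed.

Lemma moebius0 : moebius 0 = a.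
Proof. by rewrite /moebius /den mulr0 addr0 invr1 mulr1 add0r. Qed.

Lemma sqr_moebius z : nc z < 1 ->
  nc (moebius z) ^+ 2 = 1 - (1 - nc a ^+ 2) * (1 - nc z ^+ 2) / nc (den z) ^+ 2.
Proof.
move=> z1; have d0 : 0 < nc (den z) by rewrite nc_gt0 moebius_den0.
rewrite /moebius ncM ncV exprMn exprVn -moebius_id; field.
by rewrite gt_eqF.
Qed.

Lemma moebius_disc z : nc z < 1 -> nc (moebius z) < 1.
Proof.
move=> z1; rewrite -(@ltr_pXn2r _ 2) ?nnegrE ?nc_ge0 // expr1n sqr_moebius //.
rewrite gtrBl divr_gt0 ?exprn_gt0 ?nc_gt0 ?moebius_den0 //.
by rewrite mulr_gt0 // subr_gt0 expr_lt1 ?nc_ge0.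
Qed.

(** Circles near the unit circle are mapped near it, which keeps the weight [nc z ^+ n] of
    [disc_max] under control. *)
Lemma moebius_circle z : nc z < 1 ->
  1 - (1 - nc z ^+ 2) * ((1 + nc a) / (1 - nc a)) <= nc (moebius z) ^+ 2.
Proof.
move=> z1; rewrite sqr_moebius // lerD2l lerN2.
have a0 := nc_ge0 a; have a2 : 0 < 1 - nc a by rewrite subr_gt0.
have z2 : 0 <= 1 - nc z ^+ 2 by rewrite subr_ge0 ltW // expr_lt1 ?nc_ge0.
have hd := moebius_den z1.
have d0 : 0 < nc (den z) by rewrite nc_gt0 moebius_den0.
rewrite ler_pdivrMr ?exprn_gt0 //.
have h : (1 - nc a) * (1 - nc a) <= nc (den z) ^+ 2.
  by rewrite expr2; apply: ler_pM => //; exact: ltW.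
have := ler_wpM2l (_ : 0 <= (1 - nc z ^+ 2) * ((1 + nc a) / (1 - nc a))) h.
have -> : (1 - nc z ^+ 2) * ((1 + nc a) / (1 - nc a)) * ((1 - nc a) * (1 - nc a)) =
    (1 - nc a ^+ 2) * (1 - nc z ^+ 2) by field; rewrite gt_eqF.
by apply; rewrite mulr_ge0 // divr_ge0 ?(ltW a2) // addr_ge0.
Qed.

End Moebius.

(* The weight [nc z ^+ n] lets [g] be an n-th difference quotient at 0. *)
Lemma disc_max (g : C -> C) (K : R) n : (forall z, nc z < 1 -> cdiff g z) ->
  (forall z, nc z < 1 -> nc (g z) * nc z ^+ n <= K) ->
  forall a, nc a < 1 -> nc (g a) <= K.
Proof.
move=> dg hK a a1; apply: (@le_of_pow _ _ n); first exact: nc_ge0.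
move=> r r0 r1; have a0 := nc_ge0 a.
pose c := (1 + nc a) / (1 - nc a).
have c0 : 0 < c by rewrite divr_gt0 ?subr_gt0 // ltr_pwDl.
(* [d] will be [1 - rho^2], so small that [moebius a] maps the circle of radius [rho] outside the
   open disc of radius [r]. *)
pose d := Num.min (2^-1) ((1 - r ^+ 2) / c).
have r2 : r ^+ 2 < 1 by rewrite expr_lt1 // ltW.
have d0 : 0 < d by rewrite lt_min invr_gt0 ltr0n divr_gt0 // subr_gt0.
have d1 : d <= 2^-1 by rewrite ge_min lexx.
have dc : d * c <= 1 - r ^+ 2 by rewrite -ler_pdivlMr // ge_min lexx orbT.
clearbody d; pose rho := Num.sqrt (1 - d).
have rho2 : rho ^+ 2 = 1 - d by rewrite sqr_sqrtr //; lra.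
have rho0 : 0 < rho by rewrite sqrtr_gt0; lra.
have rho1 : rho < 1 by rewrite -(@ltr_pXn2r _ 2) ?nnegrE ?(ltW rho0) // rho2 expr1n; lra.
rewrite -ler_pdivlMr ?exprn_gt0 // -[a in nc (g a)]moebius0.
apply: (@mean_max _ (g \o moebius a) rho) => //.
  move=> z z1; apply: cdiff_comp; first exact: moebius_cdiff.
  by apply: dg; exact: moebius_disc.
move=> z zr /=; have z1 : nc z < 1 by rewrite zr.
have hm : r <= nc (moebius a z).
  rewrite -(@ler_pXn2r _ 2) ?nnegrE ?nc_ge0 ?(ltW r0) //.
  apply: le_trans (moebius_circle a1 z1); rewrite zr rho2 -/c; lra.
rewrite ler_pdivlMr ?exprn_gt0 //.
apply: le_trans (hK _ (moebius_disc a1 z1)).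
apply: ler_wpM2l; first exact: nc_ge0.
by apply: lerXn2r; rewrite ?nnegrE ?nc_ge0 ?(ltW r0).
Qed.

Lemma cisD s t : cis (s + t) = cis s * cis t :> C.
Proof. by rewrite /cis cosD sinD; congr Complex; ring. Qed.

Lemma cis0 : cis 0 = 1 :> C.
Proof. by rewrite /cis cos0 sin0. Qed.

Lemma cisMn n t : cis (n%:R * t) = cis t ^+ n :> C.
Proof.
elim: n => [|n IH]; first by rewrite mul0r cis0.
by rewrite -natr1 mulrDl mul1r cisD IH exprSr.
Qed.

Lemma cis_conj t : (cis t)^-1 = ((cis t)^*)%C :> C.
Proof.
have c0 : cis t != 0 :> C by rewrite -nc_gt0 nc_cis.
apply: (mulfI c0); rewrite mulfV // /cis /=.
by congr Complex; rewrite ?opprK; [rewrite mulrN opprK -!expr2 cos2Dsin2|ring].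
Qed.

Lemma expr_div_le (z : C) j n : z != 0 -> (j <= n)%N -> z ^+ j / z ^+ n = (z ^+ (n - j))^-1.
Proof.
move=> z0 jn; have -> : z ^+ n = z ^+ (n - j) * z ^+ j by rewrite -exprD subnK.
by rewrite invfM mulrCA divff ?mulr1 // expf_neq0.
Qed.

Lemma Re_conj_mul (x y : C) (s : R) :
  complex.Re ((x^*)%C * s%:C%C * y) = complex.Re (x * (s%:C%C * (y^*)%C)).
Proof. by case: x => a b; case: y => c d /=; ring. Qed.

Lemma trig_primitive (c : C) n : (0 < n)%N -> exists2 P : R -> R,
  forall t : R, is_derive t 1 P (complex.Re (c * cis t ^+ n)) & P (2 * pi) = P 0.
Proof.
move=> n0; have n1 : n%:R != 0 :> R by rewrite pnatr_eq0 -lt0n.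
pose L := n%:R : R.
exists (fun t => complex.Re c / L * sin (L * t) + complex.Im c / L * cos (L * t)).
  move=> t.
  have h : is_derive t 1 (fun t : R => L * t) (L * 1).
    by apply: is_derive_scale; exact: is_derive_id.
  have hs := is_derive1_comp (is_derive_sin (L * t)) h.
  have hc := is_derive1_comp (is_derive_cos (L * t)) h.
  have := is_derive_add (is_derive_scale (complex.Re c / L) hs)
    (is_derive_scale (complex.Im c / L) hc).
  apply: is_derive_congr; rewrite -cisMn /cis; case: c => p q /=.
  by rewrite /L; field.
have e : cis (L * (2 * pi)) = cis (L * 0) :> C.
  by rewrite (cisMn n (2 * pi)) (cisMn n 0) cis_2pi.
by case: e => -> ->.
Qed.

Section Coefficients.
Variables (f : C -> C) (M : R) (a : nat -> C).
Hypothesis df : forall z, nc z < 1 -> cdiff f z.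
Hypothesis fM : forall z, nc z < 1 -> nc (f z) <= M.
Hypothesis fa : forall n, exists B, exists2 r : R, 0 < r & forall z, 0 < nc z -> nc z < r ->
  nc (f z - \sum_(k < n) a k * z ^+ k) <= B * nc z ^+ n.

(** The n-th difference quotient of [f] at 0. It is differentiable there because
    [g n z = a n + z * g n.+1 z] and [g n.+1] is continuous at 0, by the expansion [fa]. *)
Let g n z : C := if z == 0 then a n else (f z - \sum_(k < n) a k * z ^+ k) / z ^+ n.

Let gS n z : g n z = a n + z * g n.+1 z.
Proof.
rewrite /g; have [->|z0] := eqVneq z 0; first by rewrite mul0r addr0.
by rewrite big_ord_recr /= exprS; field; rewrite expf_neq0.
Qed.

Let g0 n : g n 0 = a n.
Proof. by rewrite /g eqxx. Qed.

Let gE n z : z != 0 -> g n z * z ^+ n = f z - \sum_(k < n) a k * z ^+ k.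
Proof. by move=> z0; rewrite /g (negbTE z0) divfK // expf_neq0. Qed.

Let g_bounded n : exists B, exists2 r : R, 0 < r & forall z, nc z < r -> nc (g n z) <= B.
Proof.
have [B [r r0 h]] := fa n; exists (Num.max B (nc (a n))); exists r => // z zr.
have [->|z0] := eqVneq z 0; first by rewrite g0 le_max lexx orbT.
have zp : 0 < nc z by rewrite nc_gt0.
rewrite le_max; apply/orP; left.
rewrite -(ler_pM2r (exprn_gt0 n zp)) -ncX -ncM gE // ncX; exact: h.
Qed.

Let g_cont0 n : ccont (g n) 0.
Proof.
move=> e e0; have [B [r r0 h]] := g_bounded n.+1.
have B0 : 0 < `|B| + 1 by rewrite ltr_pwDr.
exists (Num.min r (e / (`|B| + 1))); first by rewrite lt_min r0 divr_gt0.
move=> w; rewrite subr0 lt_min => /andP[/h k1 k2].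
rewrite gS g0 addrAC subrr add0r ncM.
have k3 : nc (g n.+1 w) <= `|B| + 1 by apply: le_trans k1 _; have := ler_norm B; lra.
have := ler_pM (nc_ge0 _) (nc_ge0 _) (ltW k2) k3.
by rewrite divfK // gt_eqF.
Qed.

Let dg n z : nc z < 1 -> cdiff (g n) z.
Proof.
move=> z1; have [->|z0] := eqVneq z 0.
  exists (g n.+1); first exact: g_cont0.
  by exists 1 => // w _; rewrite g0 subr0 gS mulrC.
have zp : 0 < nc z by rewrite nc_gt0.
apply: (@cdiff_near (fun w => (f w - \sum_(k < n) a k * w ^+ k) * (w ^+ n)^-1) _ _ _ zp).
  move=> w hw; have w0 : w != 0.
    by apply: contraTneq hw => ->; rewrite sub0r ncN ltxx.
  by rewrite /g (negbTE w0).
apply: cdiffM; last by apply: cdiffV; [apply: cdiffX; exact: cdiff_id|exact: expf_neq0].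
apply: cdiffD; first exact: df.
apply: cdiffN; apply: cdiff_sum => i; apply: cdiffM; first exact: cdiff_cst.
by apply: cdiffX; exact: cdiff_id.
Qed.

(** [a n] is the value of [g n] at 0, hence controlled by a mean over a circle of radius [r]. There
    the terms [a_j z^j / z^n] with [j < n] have mean 0, so [g n] may be replaced by [f / z^n], of
    size [M / r^n]; then [r] tends to 1. *)
Lemma taylor_coef n : nc (a n) <= M.
Proof.
apply: (@le_of_pow _ _ n); first exact: nc_ge0.
move=> r r0 r1; rewrite -ler_pdivlMr ?exprn_gt0 //.
have [->|an0] := eqVneq (a n) 0.
  rewrite nc0 divr_ge0 ?exprn_ge0 ?(ltW r0) //.
  by apply: le_trans (nc_ge0 (f 0)) _; apply: fM; rewrite nc0.
pose c := (nc (a n))%:C%C / a n.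
have ap : 0 < nc (a n) by rewrite nc_gt0.
have cn : nc c = 1 by rewrite /c ncM ncV nc_real gtr0_norm // mulfV // gt_eqF.
have dcg z : nc z < 1 -> cdiff (fun z => c * g n z) z.
  by move=> hz; apply: cdiffM; [exact: cdiff_cst|exact: dg].
have s0 : ln r < 0 by apply: ln_lt0; rewrite r0.
have [F dF] := circle_primitive dcg s0.
have dF' (t : R) : 0 <= t <= 2 * pi -> is_derive t 1 F (complex.Re (c * g n (r%:C%C * cis t))).
  by move=> ht; have := dF t ht; rewrite cexpE lnK ?posrE.
have := mean_value dcg r0 r1 dF'.
have -> : complex.Re (c * g n 0) = nc (a n) by rewrite g0 /c divfK.
move=> hF.
(* Under the real part a negative power of [cis t] can be conjugated into a positive one, as
   [trig_primitive] requires; [b j] is the coefficient after conjugation. *)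
pose b (j : 'I_n) := (((c * a j)^*)%C * ((r ^+ (n - j))^-1)%:C%C : C).
have hP (j : 'I_n) : exists P : R -> R,
    (forall t : R, is_derive t 1 P (complex.Re (b j * cis t ^+ (n - j)))) /\ P (2 * pi) = P 0.
  have nj : (0 < n - j)%N by rewrite subn_gt0.
  by have [P h1 h2] := trig_primitive (b j) nj; exists P.
have [P HP] := choice hP.
have dS m (Q : 'I_m -> R -> R) (q : 'I_m -> R) (t : R) : (forall j, is_derive t 1 (Q j) (q j)) ->
    is_derive t 1 (fun t => \sum_(j < m) Q j t) (\sum_(j < m) q j).
  elim: m Q q => [|m IH] Q q hQ.
    rewrite big_ord0 (_ : (fun t => _) = cst 0); first exact: is_derive_cst.
    by apply/funext => s; rewrite big_ord0.
  rewrite big_ord_recl (_ : (fun t => _) = (fun t => Q ord0 t + \sum_(j < m) Q (lift ord0 j) t)).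
    by apply: is_derive_add => //; exact: IH.
  by apply/funext => s; rewrite big_ord_recl.
have dH (t : R) : 0 <= t <= 2 * pi -> is_derive t 1 (fun t => F t + \sum_(j < n) P j t)
    (complex.Re (c * (f (r%:C%C * cis t) / (r%:C%C * cis t) ^+ n))).
  move=> ht.
  have h := is_derive_add (dF' t ht)
    (dS n P (fun j => complex.Re (b j * cis t ^+ (n - j))) t (fun j => (HP j).1 t)).
  apply: is_derive_congr h.
  set z := r%:C%C * cis t.
  have z0 : z != 0 by rewrite -nc_gt0 /z ncM nc_cis mulr1 nc_real gtr0_norm.
  have zn0 : z ^+ n != 0 by rewrite expf_neq0.
  have eb (j : 'I_n) : complex.Re (b j * cis t ^+ (n - j)) =
      complex.Re (c * (a j * z ^+ j / z ^+ n)).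
    rewrite -[a j * _ / _]mulrA.
    have -> : z ^+ j / z ^+ n = (z ^+ (n - j))^-1.
      exact: expr_div_le (ltnW (ltn_ord j)).
    have -> : (z ^+ (n - j))^-1 = ((r ^+ (n - j))^-1)%:C%C * ((cis t ^+ (n - j))^*)%C.
      rewrite /z exprMn invfM rmorphV ?unitfE ?expf_neq0 ?gt_eqF // rmorphXn.
      by rewrite -!exprVn cis_conj rmorphXn.
    by rewrite /b Re_conj_mul !mulrA.
  rewrite (eq_bigr _ (fun j _ => eb j)) -raddf_sum -raddfD /=; congr complex.Re.
  rewrite -mulr_sumr -mulrDr; congr (_ * _).
  apply: (mulIf zn0); rewrite mulrDl gE // mulr_suml divfK //.
  by rewrite [X in _ + X](eq_bigr (fun j : 'I_n => a j * z ^+ j)) ?subrK // => j _; rewrite divfK.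
have pi2 : (0 : R) < 2 * pi by rewrite mulr_gt0 // pi_gt0.
have := mv_bound (ltW pi2) dH (K := M / r ^+ n); rewrite subr0.
have -> : F (2 * pi) + \sum_(j < n) P j (2 * pi) - (F 0 + \sum_(j < n) P j 0) =
    F (2 * pi) - F 0.
  by rewrite (eq_bigr (fun j => P j 0)); [ring|move=> j _; have [_ ->] := HP j].
rewrite hF normrM (gtr0_norm pi2) (ger0_norm (nc_ge0 _)) => h.
have {h} : 2 * pi * nc (a n) <= M / r ^+ n * (2 * pi).
  apply: h => t _; apply: le_trans (Re_le_nc _) _.
  have nz : nc (r%:C%C * cis t) = r by rewrite ncM nc_cis mulr1 nc_real gtr0_norm.
  rewrite ncM cn mul1r ncM ncV ncX nz; apply: ler_wpM2r.
    by rewrite invr_ge0 exprn_ge0 // ltW.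
  by apply: fM; rewrite nz.
by rewrite mulrC ler_pM2r.
Qed.

(** [g n z * z ^+ n] is at most [M (n + 1)] on the disc: [f] counts once and so does each subtracted
    term. [disc_max] then removes the weight. The linear growth is harmless against [nc z ^+ n]. *)
Lemma taylor_bound n z : nc z < 1 -> z != 0 ->
  nc (f z - \sum_(k < n) a k * z ^+ k) <= M * n.+1%:R * nc z ^+ n.
Proof.
move=> z1 z0; have nk k : nc (a k) <= M by exact: taylor_coef.
have M0 : 0 <= M by apply: le_trans (nc_ge0 _) (nk 0%N).
have key w : nc w < 1 -> w != 0 -> nc (f w - \sum_(k < n) a k * w ^+ k) <= M * n.+1%:R.
  move=> w1 w0; have hs : nc (\sum_(k < n) a k * w ^+ k) <= M * n%:R.
    elim: (n) => [|m IH]; first by rewrite big_ord0 nc0 mulr0.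
    rewrite big_ord_recr /= -natr1 mulrDr mulr1; apply: le_trans (ncD_le _ _) _.
    apply: lerD => //; rewrite ncM ncX -[leRHS]mulr1; apply: ler_pM => //.
    - exact: nc_ge0.
    - by rewrite exprn_ge0 // nc_ge0.
    - by rewrite exprn_ile1 ?nc_ge0 // ltW.
  apply: le_trans (ncD_le _ _) _; rewrite ncN -natr1 mulrDr mulr1 addrC.
  by apply: lerD => //; exact: fM.
rewrite -gE // ncM ncX; apply: ler_wpM2r; first by rewrite exprn_ge0 // nc_ge0.
apply: (@disc_max (g n) _ n) => // [w|w w1]; first exact: dg.
have [->|w0] := eqVneq w 0; last by rewrite -ncX -ncM gE //; exact: key.
rewrite g0 nc0; case: (n) => [|m]; first by rewrite expr0 !mulr1.
by rewrite expr0n mulr0 mulr_ge0.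
Qed.

End Coefficients.
End Taylor.

(** * Boundary values and Taylor coefficients *)

Section TransferTaylor.
Variables (R : realType) (X U Y : hilbertType R).
Local Notation nc := (@Normc.normc R).
Local Notation C := R[i].

Lemma nc_inner (Z : hilbertType R) (x y : Z) :
  nc (inner x y) <= Num.sqrt (n2 x * n2 y).
Proof.
rewrite -(@ler_pXn2r _ 2) ?nnegrE ?nc_ge0 ?sqrtr_ge0 // sqr_sqrtr ?mulr_ge0 ?rip_ge0 //.
set c := inner x y.
have h : rip x (c *: y) = nc c ^+ 2.
  by rewrite complex_ReIm ripDr !ripZr sqr_nc /c innerE /=; ring.
have := rip_CS x (c *: y); rewrite h n2Z -sqr_nc.
have [->|c0] := eqVneq (nc c ^+ 2) 0; first by rewrite mulr_ge0 ?rip_ge0.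
have {}c0 : 0 < nc c ^+ 2 by rewrite lt_neqAle eq_sym c0 sqr_ge0.
move: (nc c ^+ 2) c0 => k k0; rewrite mulrCA expr2 ler_pM2l //.
Qed.

Lemma inner_suml (Z : hilbertType R) n (F : 'I_n -> Z) y :
  inner (\sum_(i < n) F i) y = \sum_(i < n) inner (F i) y.
Proof.
elim/big_rec2: _ => [|i p q _ <-]; last by rewrite linearDl.
by rewrite innerE !rip0l.
Qed.

Lemma inner_sumr (Z : hilbertType R) n (c : 'I_n -> C) (F : 'I_n -> Z) x :
  inner x (\sum_(i < n) (c i)^*%C *: F i) = \sum_(i < n) c i * inner x (F i).
Proof.
rewrite inner_conj inner_suml rmorph_sum /=; apply: eq_bigr => i _.
by rewrite linearZl_LR /= rmorphM /= conjcK -inner_conj.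
Qed.

Variables (theta : C -> U -> Y) (Sg : system X U Y).
Hypotheses (sth : schur theta) (bSg : bounded_system Sg) (rth : realization theta Sg).

Let bA : bounded_op (sysA Sg). Proof. by case: bSg. Qed.
Let bB : bounded_op (sysB Sg). Proof. by case: bSg. Qed.
Let bC : bounded_op (sysC Sg). Proof. by case: bSg. Qed.
Let bD : bounded_op (sysD Sg). Proof. by case: bSg. Qed.
Let lA := bop_lin bA.
Let lB := bop_lin bB.
Let lC := bop_lin bC.

Definition tcoef n u : Y :=
  if n is m.+1 then sysC Sg (iter m (sysA Sg) (sysB Sg u)) else sysD Sg u.

Lemma inner_adj (Z T : hilbertType R) (f : Z -> T) x y : bounded_op f ->
  inner (f x) y = inner x (adj f y).
Proof.
move=> bf; rewrite !innerE adj_rip //; congr Complex.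
by rewrite adj_rip // (linopZ (adj_linear bf)).
Qed.

Lemma tcoef_adj n u y : inner (tcoef n u) y = inner u (impulse Sg n y).
Proof.
case: n => [|n] /=; first exact: inner_adj.
rewrite inner_adj // /obs; elim: n (adj _ y) => [|n IH] z /=; first exact: inner_adj.
by rewrite inner_adj // IH -iterSr.
Qed.

Lemma theta_bounded z : nc z < 1 -> bounded_op (theta z).
Proof. by move=> z1; have [h _ _] := sth; apply: h; rewrite normrcE ltcR. Qed.

Lemma theta_contr z u : nc z < 1 -> n2 (theta z u) <= n2 u.
Proof.
move=> z1; have [_ _ h] := sth.
have := h z _ u; rewrite normrcE ltcR => /(_ z1).
by rewrite mul1r !normE lecR ler_sqrt ?rip_ge0.
Qed.

Lemma theta_cdiff u y z : nc z < 1 -> cdiff (fun z => inner (theta z u) y) z.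
Proof.
move=> z1; have [_ h _] := sth.
have [|L bL hL] := h z; first by rewrite normrcE ltcR.
pose K := Num.sqrt (n2 u * n2 y).
have K0 : 0 <= K by exact: sqrtr_ge0.
pose f z := inner (theta z u) y.
exists (fun w => if w == z then inner (L u) y else (f w - f z) / (w - z)); last first.
  exists 1 => // w _; case: eqVneq => [->|wz]; first by rewrite subrr mulr0 addr0.
  by rewrite divfK ?subr_eq0 // addrC subrK.
move=> e e0; have e1 : 0 < e / (K + 1) by rewrite divr_gt0 // ltr_wpDl.
have [d d0 hd] := hL _ e1; exists d => // w hw; rewrite eqxx.
case: eqVneq => [_|wz]; first by rewrite subrr nc0 ltW.
have h0 : w - z != 0 by rewrite subr_eq0.
have := hd (w - z); rewrite normrcE !ltcR nc_gt0 h0 => /(_ hw) /(_ u).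
rewrite (addrC z) subrK; set v := (X in `|X|) => hv.
have -> : (f w - f z) / (w - z) - inner (L u) y = inner v y.
  by rewrite /v /f [in RHS]linearBl /= linearZl_LR /= [in RHS]linearBl /= mulrBr mulrBl !(mulrC _^-1).
apply: le_trans (nc_inner _ _) _.
have hv2 : n2 v <= (e / (K + 1)) ^+ 2 * n2 u.
  move: hv; rewrite !normE -rmorphM lecR => hv.
  have := ler_pM (sqrtr_ge0 _) (sqrtr_ge0 _) hv hv.
  by rewrite -!expr2 exprMn !sqr_sqrtr ?rip_ge0.
apply: (@le_trans _ _ (e / (K + 1) * K)); last first.
  by rewrite mulrAC ler_pdivrMr ?ltr_wpDl // ler_wpM2l ?(ltW e0) // lerDl.
rewrite -(@ler_pXn2r _ 2) ?nnegrE ?sqrtr_ge0 //; last by rewrite mulr_ge0 // ltW.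
rewrite exprMn !sqr_sqrtr ?mulr_ge0 ?rip_ge0 // mulrA.
by apply: ler_wpM2r; rewrite ?rip_ge0.
Qed.

Lemma resolvent_series (lam : C) x b n : x - lam *: sysA Sg x = b ->
  x = \sum_(k < n) lam ^+ k *: iter k (sysA Sg) b + lam ^+ n *: iter n (sysA Sg) x.
Proof.
move=> e; elim: n => [|n IH]; first by rewrite big_ord0 add0r expr0 scale1r.
rewrite {1}IH big_ord_recr /= -addrA; congr (_ + _).
have ln : linear (iter n (sysA Sg)) by exact: iter_linear.
rewrite -[in LHS](subrK (lam *: sysA Sg x) x) e (linopD ln) scalerDr (linopZ ln) scalerA.
by rewrite -iterSr -exprSr.
Qed.

(** The realization, valid near 0, identifies the Taylor coefficients of [theta]; [taylor_bound]
    extends the expansion to the whole disc. *)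
Lemma theta_near0 u y n : exists B, exists2 r : R, 0 < r & forall z, 0 < nc z -> nc z < r ->
  nc (inner (theta z u) y - \sum_(k < n) inner (tcoef k u) y * z ^+ k) <= B * nc z ^+ n.
Proof.
have [r r0 hr] := rth.
case: n => [|n].
  exists (Num.sqrt (n2 u * n2 y)); exists 1 => // z _ z1.
  rewrite big_ord0 subr0 expr0 mulr1; apply: le_trans (nc_inner _ _) _.
  by apply: ler_wsqrtr; apply: ler_wpM2r; [exact: rip_ge0|exact: theta_contr].
have [_ [K K0 hK]] := (bounded_opP _).1 bA.
have [_ [K' K'0 hK']] := (bounded_opP _).1 bC.
have hn k x : n2 (iter k (sysA Sg) x) <= K ^+ k * n2 x.
  elim: k => [|k IH] /=; first by rewrite mul1r.
  by apply: le_trans (hK _) _; rewrite exprS -mulrA; exact: ler_wpM2l.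
pose b := sysB Sg u.
exists (Num.sqrt (K' * (K ^+ n * (4 * n2 b)) * n2 y)).
exists (Num.min r (Num.min 1 (4 * (K + 1))^-1)).
  by rewrite !lt_min r0 ltr01 invr_gt0 mulr_gt0 // ltr_wpDl.
move=> z z0; rewrite !lt_min => /and3P[zr z1 zK].
have [[g [bg gl gr]] ->] : boundedly_invertible (pencil Sg z) /\
    theta z u = transfer Sg z u.
  have [|h1 h2] := hr z; [by rewrite normrcE ltcR|by split => //; exact: h2].
have lp : linear (pencil Sg z).
  move=> a v w; rewrite /pencil lA scalerDr scalerBr !scalerA (mulrC z a) opprD addrACA //.
have gE : app (op_inv (graph (pencil Sg z))) b = g b.
  apply: appE; last by rewrite /op_inv /graph /= gr.
  apply: op_inv_operator; first exact: graph_operator.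
  move=> x; rewrite /graph /= => h.
  by rewrite -(gl x) -h -[in LHS](linop0 lp) gl.
have xE : g b - z *: sysA Sg (g b) = b by exact: gr.
rewrite /transfer gE; set x := g b in xE *.
have x4 : n2 x <= 4 * n2 b.
  (* The radius makes [2 |z A x|^2 <= |x|^2 / 2]; with [x = b + z A x] this gives
     [|x|^2 <= 4 |b|^2]. *)
  have zK2 : nc z ^+ 2 * K <= 4^-1.
    have h : nc z * (4 * (K + 1)) <= 1.
      rewrite -ler_pdivlMr ?mulr_gt0 ?ltr_wpDl // mul1r; exact: ltW.
    have := ler_wpM2r (mulr_ge0 (nc_ge0 z) K0) (ltW z1); have := nc_ge0 z.
    by move: h; lra.
  have := n2D_le b (z *: sysA Sg x); rewrite -[X in X + _]xE subrK n2Z -sqr_nc.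
  have h1 := ler_wpM2l (sqr_ge0 (nc z)) (hK x).
  have h2 := ler_wpM2r (rip_ge0 x) zK2.
  by move: h1 h2; rewrite mulrA; lra.
have -> : inner (sysD Sg u + z *: sysC Sg x) y - \sum_(k < n.+1) inner (tcoef k u) y * z ^+ k =
    z ^+ n.+1 * inner (sysC Sg (iter n (sysA Sg) x)) y.
  rewrite big_ord_recl /= expr0 mulr1 linearDl /= addrAC opprD addrA subrr sub0r.
  rewrite {1}(resolvent_series n xE) (linopD lC) (linop_sum lC) (linopZ lC).
  rewrite linearZl_LR /= linearDl /= mulrDr linearZl_LR /= mulrA -exprS addrA.
  rewrite [X in X + _](_ : _ = 0) ?add0r //.
  apply/eqP; rewrite addrC subr_eq0 inner_suml mulr_sumr; apply/eqP; apply: eq_bigr => k _.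
  by rewrite (linopZ lC) linearZl_LR /= mulrA -exprS mulrC.
rewrite ncM ncX mulrC; apply: ler_wpM2r; first by rewrite exprn_ge0 // nc_ge0.
apply: le_trans (nc_inner _ _) _; apply: ler_wsqrtr; apply: ler_wpM2r; first exact: rip_ge0.
apply: le_trans (hK' _) _; apply: ler_wpM2l => //; apply: le_trans (hn _ _) _.
by apply: ler_wpM2l => //; rewrite exprn_ge0.
Qed.

Definition fourier N (z : C) (y : Y) : U :=
  \sum_(n < N) (z^*)%C ^+ n *: impulse Sg n y.

(** Apply the scalar estimate to [<theta(w) v, y>] as a function of [w], with [v] the error itself,
    frozen at [z]: the remainder at [z] is [|v|^2], while the function is bounded by [|v| |y|]. *)
Lemma theta_adj_fourier N z y : nc z < 1 -> z != 0 ->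
  n2 (adj (theta z) y - fourier N z y) <=
    (N.+1%:R * nc z ^+ N) ^+ 2 * n2 y.
Proof.
move=> z1 z0; set v := _ - _.
pose M := Num.sqrt (n2 v * n2 y).
have h := @taylor_bound R (fun z => inner (theta z v) y) M (fun k => inner (tcoef k v) y)
  (fun z => @theta_cdiff v y z) _ (theta_near0 v y) N z z1 z0.
have e : inner (theta z v) y - \sum_(k < N) inner (tcoef k v) y * z ^+ k = inner v v.
  have -> : inner v v = inner v (adj (theta z) y) - inner v (fourier N z y) by rewrite -linearBr.
  rewrite inner_adj; last exact: theta_bounded.
  congr (_ - _).
  rewrite /fourier; under [in RHS]eq_bigr => k _ do rewrite -rmorphXn.
  rewrite inner_sumr; apply: eq_bigr => k _.
  by rewrite tcoef_adj mulrC.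
move: h; rewrite e innerxx nc_real ger0_norm ?rip_ge0 // => h.
have {}h : n2 v <= M * N.+1%:R * nc z ^+ N.
  apply: h => w w1; apply: le_trans (nc_inner _ _) _.
  by apply: ler_wsqrtr; apply: ler_wpM2r; [exact: rip_ge0|exact: theta_contr].
rewrite exprMn; set q := _ ^+ N in h *; have q0 : 0 <= q by rewrite exprn_ge0 ?nc_ge0.
have hM : M * N.+1%:R * q = N.+1%:R * q * M by rewrite -mulrA mulrC.
have := ler_pM (rip_ge0 v) (rip_ge0 v) h h; rewrite hM -!expr2 !exprMn /M sqr_sqrtr ?mulr_ge0 ?rip_ge0 //.
have [->|v0] := eqVneq (n2 v) 0; first by rewrite !mulr_ge0 ?sqr_ge0 ?rip_ge0.
have {}v0 : 0 < n2 v by rewrite lt_neqAle eq_sym v0 rip_ge0.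
move: (n2 v) v0 (N.+1%:R ^+ 2 * q ^+ 2) => s s0 p.
by rewrite expr2 mulrCA ler_pM2l.
Qed.

End TransferTaylor.

(** * Means over circles and Parseval's identity *)

Section CircleMean.
Variable R : realType.
Local Notation nc := (@Normc.normc R).
Local Notation C := R[i].
Local Notation mu := (@lebesgue_measure R).

(** A mean is the normalized increment of a primitive, which keeps sums and multiples elementary;
    continuity allows the passage to the Lebesgue integral for dominated convergence. *)
Definition circle_mean (phi : R -> R) (m : R) : Prop := continuous phi /\
  exists2 F : R -> R, (forall t : R, is_derive t 1 F (phi t)) & F (2 * pi) - F 0 = 2 * pi * m.

Lemma circle_mean_eq phi psi m m' : circle_mean phi m -> phi =1 psi -> m = m' ->
  circle_mean psi m'.
Proof. by move=> h /funext <- <-. Qed.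

Lemma circle_mean_cst m : circle_mean (fun=> m) m.
Proof.
split; first by move=> t; exact: cvg_cst.
exists (fun t => m * t); last by ring.
by move=> t; apply: is_derive_congr (is_derive_scale m (is_derive_id _ _)); rewrite mulr1.
Qed.

Lemma circle_meanD phi psi m m' : circle_mean phi m -> circle_mean psi m' ->
  circle_mean (fun t => phi t + psi t) (m + m').
Proof.
move=> [c [F dF eF]] [c' [F' dF' eF']]; split.
  by move=> t; apply: cvgD; [exact: c|exact: c'].
exists (fun t => F t + F' t); first by move=> t; exact: is_derive_add.
by rewrite [RHS]mulrDr -eF -eF'; ring.
Qed.

Lemma circle_meanZ k phi m : circle_mean phi m -> circle_mean (fun t => k * phi t) (k * m).
Proof.
move=> [c [F dF eF]]; split.
  by move=> t; apply: cvgM; [exact: cvg_cst|exact: c].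
exists (fun t => k * F t); first by move=> t; exact: is_derive_scale.
by rewrite [RHS]mulrCA -eF; ring.
Qed.

Lemma circle_mean_sum n (phi : 'I_n -> R -> R) (m : 'I_n -> R) :
  (forall i, circle_mean (phi i) (m i)) ->
  circle_mean (fun t => \sum_(i < n) phi i t) (\sum_(i < n) m i).
Proof.
elim: n phi m => [|n IH] phi m h.
  by apply: circle_mean_eq (circle_mean_cst 0) _ _ => [t|]; rewrite big_ord0.
apply: circle_mean_eq (circle_meanD (h ord0) (IH _ _ (fun i => h (lift ord0 i)))) _ _.
  by move=> t; rewrite big_ord_recl.
by rewrite big_ord_recl.
Qed.

Lemma circle_mean_trig (c : C) n : (0 < n)%N ->
  circle_mean (fun t => complex.Re (c * cis t ^+ n)) 0.
Proof.
move=> n0; split; last first.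
  by have [P dP eP] := trig_primitive c n0; exists P => //; rewrite eP subrr mulr0.
move=> t; pose L := n%:R : R.
have h : is_derive t 1 (fun t : R => L * t) (L * 1).
  by apply: is_derive_scale; exact: is_derive_id.
have hs := is_derive1_comp (is_derive_sin (L * t)) h.
have hc := is_derive1_comp (is_derive_cos (L * t)) h.
have := is_derive_add (is_derive_scale (complex.Re c) hc)
    (is_derive_scale (- complex.Im c) hs).
move=> [+ _] => /derivable1_diffP/differentiable_continuous.
congr (continuous_at _ _); apply/funext => s.
by rewrite -cisMn /cis /L; case: c => p q /=; ring.
Qed.

Lemma circle_mean_integral phi m : circle_mean phi m ->
  (\int[mu]_(t in `[0%R, (2 * pi)%R]) (phi t)%:E = (2 * pi * m)%:E)%E.
Proof.
move=> [c [F dF eF]]; have F_cont : continuous F.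
  by move=> t; have [/derivable1_diffP/differentiable_continuous] := dF t.
rewrite (@continuous_FTC2 _ phi F) -?eF //; first by rewrite mulr_gt0 // pi_gt0.
- exact: continuous_subspaceT.
- split; first by move=> t _; have [] := dF t.
    exact: cvg_at_right_filter (F_cont 0).
  exact: cvg_at_left_filter (F_cont _).
- by move=> t _; rewrite derive1E; have [_] := dF t.
Qed.

Lemma nc_conj (z : C) : nc (z^*)%C = nc z.
Proof. by case: z => a b /=; rewrite sqrrN. Qed.

Variable U : hilbertType R.

Definition trigpoly (d : nat -> U) N (z : C) : U := \sum_(n < N) (z^*)%C ^+ n *: d n.

Lemma rip_scale2 (a b : C) (x y : U) : rip (a *: x) (b *: y) =
  complex.Re (a * (b^*)%C * inner x y).
Proof. by rewrite /rip linearZl_LR /= linearZr_LR /= mulrA. Qed.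

(** Parseval, by induction on [N]: the new coefficient meets the old ones in trigonometric monomials
    of degree [N - n > 0], which have mean 0. *)
Lemma circle_mean_trigpoly d (r : R) N :
  circle_mean (fun t => n2 (trigpoly d N (r%:C%C * cis t)))
    (\sum_(n < N) r ^+ n ^+ 2 * n2 (d n)).
Proof.
elim: N => [|N IH].
  apply: circle_mean_eq (circle_mean_cst 0) _ _; last by rewrite big_ord0.
  by move=> t; rewrite /trigpoly big_ord0 rip0l.
pose c (n : 'I_N) := (r ^+ (n + N))%:C%C * inner (d n) (d N).
have h (n : 'I_N) : circle_mean (fun t => complex.Re (c n * cis t ^+ (N - n))) 0.
  by apply: circle_mean_trig; rewrite subn_gt0.
have {}h := circle_mean_sum h.
have := circle_meanD (circle_meanD IH (circle_mean_cst (r ^+ N ^+ 2 * n2 (d N))))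
  (circle_meanZ 2 h).
move/circle_mean_eq; apply; last by rewrite big_ord_recr /= big1_eq mulr0 addr0.
move=> t; set z := _ * cis t; have ez : z = r%:C%C * cis t by [].
clearbody z; rewrite /trigpoly big_ord_recr /= [RHS]n2D; congr (_ + _ + 2 * _).
  by rewrite n2Z -sqr_nc ncX nc_conj ez ncM nc_cis nc_real mulr1 -normrX real_normK ?num_real.
rewrite rip_suml; apply: eq_bigr => n _; rewrite rip_scale2 /c.
congr (complex.Re _); rewrite mulrAC; congr (_ * _).
have -> : ((z^*)%C ^+ N)^*%C = z ^+ N by rewrite -rmorphXn conjcK.
have -> : (z^*)%C = r%:C%C * (cis t)^-1.
  by rewrite ez [LHS]rmorphM [X in X * _]conjc_real cis_conj.
rewrite ez !exprMn.
have ct : cis t != 0 :> C by rewrite -nc_gt0 nc_cis.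
have -> : cis t ^+ N = cis t ^+ (N - n) * cis t ^+ n by rewrite -exprD subnK // ltnW.
rewrite exprD rmorphM /= !rmorphXn exprVn.
have cn : cis t ^+ n != 0 by rewrite expf_neq0.
move: (cis t ^+ n) cn => s s0; move: (cis t ^+ (N - n)) (r%:C%C ^+ n) (r%:C%C ^+ N) => a b e.
by field.
Qed.
End CircleMean.

Section Radial.
Variable R : realType.
Local Notation mu := (@lebesgue_measure R).

Lemma circle_mean_dominated (phi_ : nat -> R -> R) (m_ : nat -> R) phi m (K : R) :
  (forall j, circle_mean (phi_ j) (m_ j)) -> circle_mean phi m ->
  {ae mu, forall t : R, t \in `[0, 2 * pi] -> (fun j => phi_ j t) @ \oo --> phi t} ->
  (forall j t, `|phi_ j t| <= K) -> m_ @ \oo --> m.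
Proof.
move=> h_ h hae hK; have pi2 : 0 < 2 * pi :> R by rewrite mulr_gt0 // pi_gt0.
have meas (psi : R -> R) p : circle_mean psi p ->
    measurable_fun `[0, 2 * pi]%classic psi.
  move=> [c _]; apply: (measurable_funS measurableT) => //.
  exact: continuous_measurable_fun.
have [||||||_ _] := @dominated_convergence _ _ R mu `[0, 2 * pi] _ (fun j => EFin \o phi_ j)
    (EFin \o phi) (fun=> K%:E).
- exact: measurable_itv.
- by move=> j; apply/measurable_EFinP; exact: meas (h_ j).
- apply/measurable_EFinP; exact: meas h.
- case: hae => A [mA A0 hA]; exists A; split => // t ht; apply: hA => h'; apply: ht => /= th.
  by apply: cvg_EFin; [exact: nearW|exact: h'].
- apply: (@continuous_compact_integrable _ (fun=> K)); first exact: segment_compact.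
  by apply: continuous_subspaceT => t; exact: cvg_cst.
- by apply: aeW => t j _; rewrite lee_fin.
have -> : [sequence (\int[mu]_(x in `[0%R, (2 * pi)%R]) (EFin \o phi_ n) x)%E]_n =
    EFin \o (fun n => 2 * pi * m_ n).
  by apply/funext => j; exact: circle_mean_integral (h_ j).
rewrite (circle_mean_integral h) => /fine_cvg hc.
have : (fun n => (2 * pi)^-1 * (2 * pi * m_ n)) @ \oo --> (2 * pi)^-1 * (2 * pi * m).
  by apply: cvgM; [exact: cvg_cst|exact: hc].
have -> : (fun n => (2 * pi)^-1 * (2 * pi * m_ n)) = m_.
  by apply/funext => n; rewrite mulKf ?gt_eqF.
by rewrite mulKf ?gt_eqF.
Qed.

(** Split [r^n = s^n s^n] with [s = sqrt r]: one factor absorbs [n + 1], since [(n + 1) s^n <= 1 + s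
    + ... + s^n <= 1 / (1 - s)], and the other tends to 0. *)
Lemma geometric_tail (r e : R) : 0 < r -> r < 1 -> 0 < e ->
  exists N, forall n, (N <= n)%N -> n.+1%:R * r ^+ n <= e.
Proof.
move=> r0 r1 e0; pose s := Num.sqrt r.
have s0 : 0 < s by rewrite sqrtr_gt0.
have ss : s ^+ 2 = r by rewrite sqr_sqrtr // ltW.
have s1 : s < 1 by rewrite -(@ltr_pXn2r _ 2) ?nnegrE ?(ltW s0) // ss expr1n.
have hs n : n.+1%:R * s ^+ n <= (1 - s)^-1.
  rewrite -[leRHS]mul1r ler_pdivlMr ?subr_gt0 //.
  have : n.+1%:R * s ^+ n <= \sum_(i < n.+1) s ^+ i.
    rewrite -[n.+1 in leLHS]card_ord mulr_natl -sumr_const; apply: ler_sum => i _.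
    by apply: ler_wiXn2l; rewrite ?ltW // -ltnS.
  move=> h; have := ler_wpM2r (_ : 0 <= 1 - s) h; rewrite subr_ge0 => /(_ (ltW s1)).
  move/le_trans; apply; rewrite -opprB mulrN mulrC -subrX1 opprB lerBlDr lerDl.
  by rewrite exprn_ge0 // ltW.
have /cvgrPdist_le : (fun n => s ^+ n) @ \oo --> 0 by apply: cvg_expr; rewrite ger0_norm // ltW.
move=> /(_ (e * (1 - s))); rewrite mulr_gt0 ?subr_gt0 // => /(_ isT)[N _ hN].
exists N => n /hN; rewrite /= sub0r normrN ger0_norm => [h|]; last by rewrite exprn_ge0 // ltW.
rewrite -ss -exprM mulnC exprM expr2 mulrA.
have h0 : 0 <= s ^+ n by rewrite exprn_ge0 ?ltW.
apply: le_trans (ler_wpM2r h0 (hs n)) _.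
by rewrite ler_pdivrMl ?subr_gt0 // mulrC.
Qed.

(** A sequence of radii, as dominated convergence needs; [j.+2] keeps the first one positive. *)
Definition radius j : R := 1 - j.+2%:R^-1.

Lemma radius_itv j : 0 < radius j < 1.
Proof.
rewrite /radius subr_gt0 invf_lt1 ?ltr0n // ltr1n ltrBlDr ltrDl invr_gt0 ltr0n //.
Qed.

Lemma radius_cvg : radius @ \oo --> (1 : R).
Proof.
apply/cvgrPdist_le => e /(@small_inv R)[N hN]; exists N => // n /= hn.
rewrite /radius opprB addrC subrK ger0_norm ?invr_ge0 //.
by apply: (hN n.+1); apply: leq_trans hn _.
Qed.

Lemma radius_left (V : topologicalType) (f : R -> V) (l : V) : f @ 1^'- --> l ->
  (fun j => f (radius j)) @ \oo --> l.
Proof.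
move=> h A /h /radius_cvg; apply: (@filterS _ \oo) => j; have /andP[_ r1] := radius_itv j.
by move/(_ r1).
Qed.

Lemma radiusX k : small (fun j => (1 - radius j ^+ k) ^+ 2).
Proof.
apply/small_cvg => [j|]; first exact: sqr_ge0.
have h : (fun j => 1 - radius j ^+ k) @ \oo --> (1 - 1 ^+ k : R).
  apply: cvgB; first exact: cvg_cst.
  exact: (cvg_comp _ _ radius_cvg (@exprn_continuous R k 1)).
have -> : (fun j => (1 - radius j ^+ k) ^+ 2) =
    (fun j => (1 - radius j ^+ k) * (1 - radius j ^+ k)).
  by apply/funext => j; rewrite expr2.
rewrite expr1n subrr in h; rewrite -[X in _ --> X](mulr0 0); exact: (cvgM h h).
Qed.

End Radial.

Section ImpulseNorms.
Variables (R : realType) (X U Y : hilbertType R).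
Local Notation nc := (@Normc.normc R).
Local Notation C := R[i].

Lemma adj_contr (Z T : hilbertType R) (f : Z -> T) : bounded_op f ->
  (forall x, n2 (f x) <= n2 x) -> forall y, n2 (adj f y) <= n2 y.
Proof.
move=> bf hf y; have h1 := adj_rip bf (adj f y) y.
by have h2 := rip_le (f (adj f y)) y; have h3 := hf (adj f y); lra.
Qed.

(** Letting [j] tend to infinity bounds each partial sum by [S]; conversely a partial sum dominates
    the damped sum of the same length, because [r_ j < 1]. Nonnegative weights take the place of a
    Tauberian condition. *)
Lemma abel_sum (w : nat -> R) (r_ : nat -> R) (N_ : nat -> nat) (S : R) :
  (forall n, 0 <= w n) -> (forall j, 0 < r_ j < 1) -> r_ @ \oo --> (1 : R) ->
  (forall j, (j <= N_ j)%N) ->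
  (fun j => \sum_(n < N_ j) r_ j ^+ n ^+ 2 * w n) @ \oo --> S ->
  (fun N => \sum_(n < N) w n) @ \oo --> S.
Proof.
move=> w0 r01 r1 Nj hS.
have homo m n : (m <= n)%N -> \sum_(i < m) w i <= \sum_(i < n) w i.
  move=> mn; rewrite -(subnKC mn) big_split_ord /= lerDl; exact: sumr_ge0.
have homo' j m n : (m <= n)%N ->
    \sum_(i < m) r_ j ^+ i ^+ 2 * w i <= \sum_(i < n) r_ j ^+ i ^+ 2 * w i.
  move=> mn; rewrite -(subnKC mn) big_split_ord /= lerDl; apply: sumr_ge0 => i _.
  by rewrite mulr_ge0 ?sqr_ge0.
have le_w j m : \sum_(i < m) r_ j ^+ i ^+ 2 * w i <= \sum_(i < m) w i.
  apply: ler_sum => i _; rewrite -[leRHS]mul1r; apply: ler_wpM2r => //.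
  have /andP[a b] := r01 j.
  by rewrite exprn_ile1 ?exprn_ge0 ?exprn_ile1 ?ltW.
have h1 N : (fun j => \sum_(n < N) r_ j ^+ n ^+ 2 * w n) @ \oo --> \sum_(n < N) w n.
  elim: N => [|N IH].
    rewrite big_ord0 (_ : (fun j => _) = fun=> 0); first exact: cvg_cst.
    by apply/funext => j; rewrite big_ord0.
  rewrite big_ord_recr /= (_ : (fun j => _) = (fun j => \sum_(n < N) r_ j ^+ n ^+ 2 * w n +
      (r_ j ^+ N) ^+ 2 * w N)); last by apply/funext => j; rewrite big_ord_recr.
  apply: cvgD; first exact: IH.
  have {2}-> : w N = (1 ^+ N * 1 ^+ N) * w N by rewrite !expr1n !mul1r.
  have hN : (fun j => r_ j ^+ N) @ \oo --> (1 ^+ N : R).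
    exact: (cvg_comp _ _ r1 (@exprn_continuous R N 1)).
  by apply: cvgM; [exact: (cvgM hN hN)|exact: cvg_cst].
have leS N : \sum_(n < N) w n <= S.
  apply: (ler_cvg_to (h1 N) hS); near=> j; apply: homo'.
  by apply: leq_trans (Nj j); near: j; exact: nbhs_infty_ge.
apply/cvgrPdist_le => e e0.
have /cvgrPdist_le/(_ e e0)[N _ /(_ N (leqnn _)) hN] := hS.
exists (N_ N) => // n /= hn; rewrite ger0_norm; last by rewrite subr_ge0; exact: leS.
have h2 := le_trans (le_w N (N_ N)) (homo _ _ hn).
apply: le_trans (le_trans (ler_norm _) hN).
by rewrite lerD2l lerN2; exact: h2.
Unshelve. all: by end_near.
Qed.

Variables (theta : C -> U -> Y) (Sg : system X U Y).
Hypotheses (sth : schur theta) (bSg : bounded_system Sg) (rth : realization theta Sg).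

Lemma fourier_bound N z y : nc z < 1 -> z != 0 -> N.+1%:R * nc z ^+ N <= 1 ->
  n2 (fourier Sg N z y) <= 4 * n2 y.
Proof.
move=> z1 z0 h; have h1 := theta_adj_fourier sth bSg rth N y z1 z0.
have h2 := adj_contr (theta_bounded sth z1) (fun u => theta_contr sth u z1) y.
have h3 : (N.+1%:R * nc z ^+ N) ^+ 2 * n2 y <= n2 y.
  rewrite -[leRHS]mul1r; apply: ler_wpM2r; first exact: rip_ge0.
  by rewrite exprn_ile1 // mulr_ge0 // exprn_ge0 // nc_ge0.
have := n2D_le (adj (theta z) y) (- (adj (theta z) y - fourier Sg N z y)).
by rewrite n2N opprB addrC subrK; lra.
Qed.

Section Shift.
Variables (k : nat) (y y' : Y).

(** The coefficients of the adjoint of [theta] at [z] applied to [y' + conj(z)^k y]. Their squared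
    norms contain the shifted pairings, so only norms need limits. *)
Definition shifted n : U :=
  impulse Sg n y' + (if (k <= n)%N then impulse Sg (n - k) y else 0).

Lemma trigpoly_shifted M z : trigpoly shifted (k + M) z =
  fourier Sg (k + M) z y' + (z^*)%C ^+ k *: fourier Sg M z y.
Proof.
rewrite /trigpoly /shifted; under eq_bigr => n _ do rewrite scalerDr.
rewrite big_split; congr (_ + _).
rewrite big_split_ord /= big1 => [|i _]; last by rewrite leqNgt ltn_ord scaler0.
rewrite add0r scaler_sumr; apply: eq_bigr => i _.
by rewrite leq_addr addKn exprD scalerA.
Qed.

Lemma circle_mean_shift : (0 < k)%N ->
  circle_mean (fun t => n2 (y' + (cis t)^*%C ^+ k *: y))
    (n2 y' + n2 y).
Proof.
move=> k0; have := circle_meanD (circle_mean_cst (n2 y' + n2 y))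
  (circle_meanZ 2 (circle_mean_trig (inner y' y) k0)).
move/circle_mean_eq; apply=> [t|]; last by rewrite mulr0 addr0.
rewrite [RHS]n2D n2Z -sqr_nc ncX nc_conj nc_cis !expr1n mul1r; congr (_ + 2 * _).
rewrite -[y' in RHS]scale1r rip_scale2 mul1r mulrC; congr (complex.Re (_ * _)).
by rewrite -rmorphXn conjcK.
Qed.

Variable M_ : nat -> nat.
Hypothesis M_tail : forall j n, (M_ j <= n)%N -> n.+1%:R * radius R j ^+ n <= j.+1%:R^-1.

Let P j t := trigpoly shifted (k + M_ j) ((radius R j)%:C%C * cis t).

Lemma nc_radius j t : nc ((radius R j)%:C%C * cis t) = radius R j.
Proof.
by rewrite ncM nc_cis mulr1 nc_real gtr0_norm //; have /andP[] := radius_itv R j.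
Qed.

Lemma shifted_bound j t : n2 (P j t) <= 8 * n2 y' + 8 * n2 y.
Proof.
have /andP[r0 r1] := radius_itv R j.
rewrite /P trigpoly_shifted; have hz := nc_radius j t; set z := _ * _ in hz *.
have z1 : nc z < 1 by rewrite hz.
have z0 : z != 0 by rewrite -nc_gt0 hz.
have hj : j.+1%:R^-1 <= 1 :> R by rewrite invf_le1 ?ltr0n // ler1n.
have b1 : n2 (fourier Sg (k + M_ j) z y') <= 4 * n2 y'.
  apply: fourier_bound => //; rewrite hz; apply: le_trans hj; apply: M_tail; exact: leq_addl.
have b2 : n2 (fourier Sg (M_ j) z y) <= 4 * n2 y.
  by apply: fourier_bound => //; rewrite hz; apply: le_trans hj; exact: M_tail.
apply: le_trans (n2D_le _ _) _.
have : n2 ((z^*)%C ^+ k *: fourier Sg (M_ j) z y) <=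
    n2 (fourier Sg (M_ j) z y).
  rewrite n2Z -sqr_nc ncX nc_conj hz -[leRHS]mul1r; apply: ler_wpM2r; first exact: rip_ge0.
  by rewrite exprn_ile1 ?exprn_ge0 ?exprn_ile1 // ltW.
lra.
Qed.

Section Pointwise.
Variables (t : R) (T : U -> Y).
Hypotheses (bv : boundary_value theta (cis t) T) (TT : forall y, T (adj T y) = y).

Let bT : bounded_op T. Proof. by case: bv. Qed.

(** Strong convergence of [theta] gives only weak convergence of the adjoints. But [adj T] preserves
    the norm, which the contractions cannot exceed: [|x - adj T v|^2 <= 2 |v|^2 - 2 <x, adj T v>]
    whenever [|x| <= |v|]. *)
Lemma adj_radial v :
  small (fun j => n2 (adj (theta ((radius R j)%:C%C * cis t)) v - adj T v)).
Proof.
have nT : n2 (adj T v) = n2 v by rewrite -adj_rip // TT.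
pose q j := 2 * n2 v - 2 * rip (theta ((radius R j)%:C%C * cis t) (adj T v)) v.
have qle j : n2 (adj (theta ((radius R j)%:C%C * cis t)) v - adj T v) <= q j.
  have z1 : nc ((radius R j)%:C%C * cis t) < 1.
    by rewrite nc_radius; have /andP[] := radius_itv R j.
  rewrite n2B nT /q (adj_rip (theta_bounded sth z1)) (ripC (adj T v)).
  have := adj_contr (theta_bounded sth z1) (fun u => theta_contr sth u z1) v; lra.
apply: (small_le qle); apply/small_cvg => [j|].
  by apply: le_trans (qle j); exact: rip_ge0.
have : q @ \oo --> 2 * n2 v - 2 * rip (T (adj T v)) v.
  apply: cvgB; first exact: cvg_cst.
  apply: cvgM; first exact: cvg_cst.
  apply: cvg_ripl; have [_ h] := bv; exact: (radius_left (h (adj T v))).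
by rewrite TT subrr.
Qed.

Lemma fourier_radial (N_ : nat -> nat) v : (forall j, (M_ j <= N_ j)%N) ->
  small (fun j => n2 (fourier Sg (N_ j) ((radius R j)%:C%C * cis t) v - adj T v)).
Proof.
move=> MN.
have h j : n2 (fourier Sg (N_ j) ((radius R j)%:C%C * cis t) v - adj T v) <=
    2 * n2 v * j.+1%:R^-1 + 2 * n2 (adj (theta ((radius R j)%:C%C * cis t)) v - adj T v).
  apply: le_trans (n2_tri _ (adj (theta ((radius R j)%:C%C * cis t)) v) _) _; apply: lerD => //.
  rewrite n2BC; have hz := nc_radius j t; have /andP[r0 r1] := radius_itv R j.
  set z := _ * cis t in hz *; have z1 : nc z < 1 by rewrite hz.
  have z0 : z != 0 by rewrite -nc_gt0 hz.
  have := theta_adj_fourier sth bSg rth (N_ j) v z1 z0; rewrite hz.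
  have hj : j.+1%:R^-1 <= 1 :> R by rewrite invf_le1 ?ltr0n // ler1n.
  have := M_tail (MN j); set q := _ * radius R j ^+ _ => hq.
  have q0 : 0 <= q by rewrite mulr_ge0 // exprn_ge0 // ltW.
  have q2 : q ^+ 2 <= j.+1%:R^-1.
    by rewrite expr2; apply: le_trans (hq); rewrite ler_piMl //; exact: le_trans hq hj.
  have := ler_wpM2r (rip_ge0 v) q2; move: (j.+1%:R^-1) => i; lra.
apply: (small_le h); apply: smallD.
  by apply: smallZ; [rewrite mulr_ge0 ?rip_ge0|exact: small_inv].
by apply: smallZ => //; exact: adj_radial.
Qed.

Lemma shifted_cvg : (fun j => n2 (P j t)) @ \oo -->
  n2 (y' + (cis t)^*%C ^+ k *: y).
Proof.
pose c : C := (cis t)^*%C ^+ k.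
have -> : n2 (y' + c *: y) = n2 (adj T y' + c *: adj T y).
  by rewrite -(linopZ (adj_linear bT)) -(linopD (adj_linear bT)) -adj_rip // TT.
apply: cvg_n2; apply/cvg_n2P.
pose z j := (radius R j)%:C%C * cis t.
have h j : n2 (P j t - (adj T y' + c *: adj T y)) <=
   2 * n2 (fourier Sg (k + M_ j) (z j) y' - adj T y') +
   (4 * n2 (fourier Sg (M_ j) (z j) y - adj T y) +
   4 * n2 (adj T y) * (1 - radius R j ^+ k) ^+ 2).
  have /andP[r0 r1] := radius_itv R j.
  have ec : ((z j)^*)%C ^+ k = (radius R j ^+ k)%:C%C * c.
    by rewrite /z /c [X in X ^+ _]rmorphM [X in (X * _) ^+ _]conjc_real exprMn rmorphXn.
  rewrite /P trigpoly_shifted -/(z j) ec; set f := fourier _ _ _ _; set g := fourier _ _ _ _.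
  set s := radius R j ^+ k.
  have -> : f + (s%:C%C * c) *: g - (adj T y' + c *: adj T y) =
      (f - adj T y') + ((s%:C%C * c) *: (g - adj T y) + ((s - 1)%:C%C * c) *: adj T y).
    rewrite scalerBr rmorphB mulrBl mul1r scalerBl opprD addrACA; congr (_ + _).
    by rewrite -addrA; congr (_ + _); rewrite addrA addNr add0r.
  apply: le_trans (n2D_le _ _) _; rewrite lerD2l.
  have h1 := n2D_le ((s%:C%C * c) *: (g - adj T y)) (((s - 1)%:C%C * c) *: adj T y).
  have c1 : nc c = 1 by rewrite /c ncX nc_conj nc_cis expr1n.
  have s0 : 0 <= s by rewrite exprn_ge0 // ltW.
  have s1 : s <= 1 by rewrite exprn_ile1 // ltW.
  move: h1; rewrite !n2Z -!sqr_nc !ncM c1 !mulr1 !nc_real !real_normK ?num_real //.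
  have s2 : s ^+ 2 <= 1 by rewrite exprn_ile1.
  have := ler_wpM2r (rip_ge0 (g - adj T y)) s2; rewrite -[(s - 1) ^+ 2]sqrrN opprB.
  lra.
apply: (small_le h); apply: smallD.
  apply: smallZ => //; apply: (fourier_radial (N_ := fun j => (k + M_ j)%N)) => j; exact: leq_addl.
apply: smallD; first by apply: smallZ => //; exact: fourier_radial.
by apply: smallZ; [rewrite mulr_ge0 ?rip_ge0|exact: radiusX].
Qed.

End Pointwise.
End Shift.

Hypothesis ci : co_inner theta.

Lemma tail_exists : exists M : nat -> nat, forall j, (j <= M j)%N /\
  forall n, (M j <= n)%N -> n.+1%:R * radius R j ^+ n <= j.+1%:R^-1.
Proof.
suff h j : exists M, (j <= M)%N /\
    forall n, (M <= n)%N -> n.+1%:R * radius R j ^+ n <= j.+1%:R^-1.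
  by have [M hM] := choice h; exists M.
have /andP[r0 r1] := radius_itv R j.
have [|N hN] := @geometric_tail R (radius R j) j.+1%:R^-1 r0 r1; first by rewrite invr_gt0.
exists (maxn j N); split; first exact: leq_maxl.
by move=> n; rewrite geq_max => /andP[_ /hN].
Qed.

(** Parseval on the circle of radius [radius R j] for truncated series, dominated convergence to the
    mean of [|y' + conj(z)^k y|^2] on the unit circle, then [abel_sum]. Truncation at [k + M j]
    makes both Fourier sums accurate, and [j <= M j] lets the length grow. *)
Lemma shifted_norms k y y' : (0 < k)%N ->
  (fun N => \sum_(n < N) n2 (shifted k y y' n)) @ \oo --> n2 y' + n2 y.
Proof.
move=> k0; have [M hM] := tail_exists.
refine (abel_sum (w := fun n => n2 (shifted k y y' n)) (r_ := radius R)
  (N_ := fun j => (k + M j)%N) _ _ _ _ _).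
- by move=> n; exact: rip_ge0.
- exact: radius_itv.
- exact: radius_cvg.
- by move=> j; apply: leq_trans (leq_addl _ _); have [] := hM j.
have hT j n : (M j <= n)%N -> n.+1%:R * radius R j ^+ n <= j.+1%:R^-1.
  by have [_] := hM j; apply.
apply: (circle_mean_dominated (fun j => circle_mean_trigpoly _ _ _) (circle_mean_shift y y' k0)).
  case: ci => A [mA A0 hA]; exists A; split => // t ht; apply: hA => h; apply: ht => th.
  have [T bv TT] := h th; exact: (shifted_cvg hT bv TT).
move=> j t; rewrite ger0_norm ?rip_ge0 //; exact: shifted_bound.
Qed.

Lemma impulse_orthonormal : orthonormal_impulses Sg.
Proof.
have norms y : (fun N => \sum_(n < N) n2 (impulse Sg n y)) @ \oo --> n2 y.
  (* Putting 0 for the shifted vector leaves the impulses of [y]. *)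
  have := @shifted_norms 1 0 y isT; rewrite rip0l addr0.
  rewrite (_ : (fun N => _) = (fun N => \sum_(n < N) n2 (impulse Sg n y))) //.
  apply/funext => N; apply: eq_bigr => n _; rewrite /shifted (linop0 (impulse_linear bSg _)).
  by rewrite if_same addr0.
move=> y y' [|k].
  have -> : (fun N => \sum_(n < N) rip (impulse Sg n y) (impulse Sg (n + 0) y')) =
    (fun N => 2^-1 * (\sum_(n < N) n2 (impulse Sg n (y + y')) -
       \sum_(n < N) n2 (impulse Sg n y) -
       \sum_(n < N) n2 (impulse Sg n y'))).
    apply/funext => N; rewrite -!sumrB mulr_sumr; apply: eq_bigr => n _.
    by rewrite addn0 (linopD (impulse_linear bSg _)) n2D; field.
  have -> : (if 0%N == 0%N then rip y y' else 0) = 2^-1 * (n2 (y + y') - n2 y - n2 y').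
    by rewrite eqxx n2D; field.
  apply: cvgM; first exact: cvg_cst.
  by apply: cvgB; [apply: cvgB|]; exact: norms.
(* Polarization: sums to [N + k.+1] align the shifted sequence with the impulses of [y'], and the
   first [k.+1] terms cancel. *)
have -> : (fun N => \sum_(n < N) rip (impulse Sg n y) (impulse Sg (n + k.+1) y')) =
    (fun N => 2^-1 * (\sum_(n < N + k.+1) n2 (shifted k.+1 y y' n) -
       \sum_(n < N) n2 (impulse Sg n y) -
       \sum_(n < N + k.+1) n2 (impulse Sg n y'))).
  apply/funext => N; rewrite (addnC N) !big_split_ord /=.
  have -> : \sum_(i < k.+1) n2 (shifted k.+1 y y' i) =
      \sum_(i < k.+1) n2 (impulse Sg i y').
    by apply: eq_bigr => i _; rewrite /shifted leqNgt ltn_ord addr0.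
  rewrite opprD addrACA -addrA addrACA subrr add0r.
  rewrite -opprD -big_split -sumrB mulr_sumr; apply: eq_bigr => n _.
  rewrite /shifted leq_addr addKn n2D (addnC n) addSn /= (ripC (impulse Sg n y)).
  by field.
have -> : (if k.+1 == 0%N then rip y y' else 0) = 2^-1 * (n2 y' + n2 y - n2 y - n2 y').
  by rewrite /=; ring.
apply: cvgM; first exact: cvg_cst.
apply: cvgB; first apply: cvgB.
- rewrite (cvg_shiftn k.+1 (fun N => \sum_(n < N) n2 (shifted k.+1 y y' n))).
  exact: shifted_norms.
- exact: norms.
- by rewrite (cvg_shiftn k.+1 (fun N => \sum_(n < N) n2 (impulse Sg n y'))); exact: norms.
Qed.

End ImpulseNorms.

Theorem corollary5p6 (R : realType) (X U Y : hilbertType R)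
    (sepX : separable X) (sepU : separable U) (sepY : separable Y)
    (theta : R[i] -> U -> Y) (Sg : system X U Y) :
  schur theta -> co_inner theta ->
  bounded_system Sg -> minimal Sg -> realization theta Sg ->
  exists H : set (X * X),
    RIcirc Sg = [set H] /\
    forall y : Y, delta (adj_system Sg) (op_inv H) y = 0.
Proof.
move=> sth ci bSg mSg rth.
exact: (RIcirc_unique bSg mSg (impulse_orthonormal sth bSg rth ci)).
Qed.
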